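(* Suppose that each $f_i$ is $\mu$-strongly concave in $y$, that each $f_i$ is jointly $L$-smooth with $L$-Lipschitz second derivatives in the sense given in the context, that the stochastic gradients are unbiased and bounded in norm by $C$, and that the weight matrix $W$ is doubly stochastic with $\rho_W<1$. Let $0<\beta<\alpha<1$, $\gamma_x,\gamma_y>0$, $\kappa:=L/\mu$, and let the total number of iterations $K$ satisfy $$K=\Omega\left(\max\left\{\left(\frac{\gamma_x^2\kappa^4}{\gamma_y^2}\right)^{\frac{1}{\alpha-\beta}},\ \left(\frac{1}{(1-\rho_W)^2}\right)^{\max\{\frac1\alpha,\frac1\beta\}}\right\}\right).$$ Then the iterates of D-AdaST satisfy $$\frac1K\sum_{k=0}^{K-1}\mathbb{E}\left[\|\nabla\varPhi(\bar{x}_k)\|^2\right]=\tilde{\mathcal{O}}\left(\frac{1}{K^{1-\alpha}}+\frac{1}{(1-\rho_W)^{\alpha}K^{\alpha}}\right)+\tilde{\mathcal{O}}\left(\frac{1}{K^{1-\beta}}+\frac{1}{(1-\rho_W)K^{\beta}}\right).$$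
   Context: Problem: $\min_{x\in\mathbb{R}^p}\max_{y\in\mathcal{Y}}f(x,y)=\frac1n\sum_{i=1}^nf_i(x,y)$, $f_i(x,y)=\mathbb{E}_{\xi_i\sim\mathcal{D}_i}[F_i(x,y;\xi_i)]$, with $\mathcal{Y}\subset\mathbb{R}^d$ closed and convex. $y^*(x)=\arg\max_{y\in\mathcal{Y}}f(x,y)$ and $\varPhi(x)=f(x,y^*(x))$; $\varPhi^{\max}=\max_x\varPhi(x)$ and $\varPhi^*=\min_x\varPhi(x)$ are assumed finite. Assumptions, for every $i$: (strong concavity) $f_i(x,y)-f_i(x,y')\ge\langle\nabla_yf_i(x,y),y-y'\rangle+\frac\mu2\|y-y'\|^2$ for all $x\in\mathbb{R}^p$, $y,y'\in\mathcal{Y}$, where $\mu>0$; (smoothness) for $z\in\{x,y\}$ and all $x,x'\in\mathbb{R}^p$, $y,y'\in\mathcal{Y}$: $\|\nabla_zf_i(x,y)-\nabla_zf_i(x',y')\|^2\le L^2(\|x-x'\|^2+\|y-y'\|^2)$ and $\|\nabla^2_{zy}f_i(x,y)-\nabla^2_{zy}f_i(x',y')\|^2\le L^2(\|x-x'\|^2+\|y-y'\|^2)$; (stochastic gradients) for i.i.d. samples, $\mathbb{E}_{\xi_i}[\nabla_zF_i(x,y;\xi_i)]=\nabla_zf_i(x,y)$ and $\|\nabla_zF_i(x,y;\xi_i)\|\le C$ for $z\in\{x,y\}$, $x\in\mathbb{R}^p$, $y\in\mathcal{Y}$; (graph) $W\in\mathbb{R}^{n\times n}$, induced by the communication graph,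 is doubly stochastic ($W\mathbf{1}=\mathbf{1}$, $\mathbf{1}^TW=\mathbf{1}^T$) and $\rho_W:=\|W-\mathbf{J}\|_2^2<1$, $\mathbf{J}=\mathbf{1}\mathbf{1}^T/n$. D-AdaST algorithm: node $i$ keeps $x_{i,k}\in\mathbb{R}^p$, $y_{i,k}\in\mathcal{Y}$ and scalars $m^x_{i,k},m^y_{i,k}$, with $m^x_{i,0}=m^y_{i,0}=c>0$. $\mathbf{x}_k,\mathbf{y}_k$ are the matrices with rows $x_{i,k}^T,y_{i,k}^T$; $\mathbf{m}^x_k,\mathbf{m}^y_k\in\mathbb{R}^n$ collect the scalars. With i.i.d. samples, $g^x_{i,k}=\nabla_xF_i(x_{i,k},y_{i,k};\xi^x_{i,k})$, $g^y_{i,k}=\nabla_yF_i(x_{i,k},y_{i,k};\xi^y_{i,k})$; $\nabla_xF(\mathbf{x}_k,\mathbf{y}_k;\xi^x_k)$, $\nabla_yF(\mathbf{x}_k,\mathbf{y}_k;\xi^y_k)$ are the matrices with rows $(g^x_{i,k})^T$, $(g^y_{i,k})^T$; $\mathbf{h}^z_k=[\|g^z_{1,k}\|^2,\dots,\|g^z_{n,k}\|^2]^T$ for $z\in\{x,y\}$. For $k=0,1,\dots$: $$\mathbf{m}^x_{k+1}=W(\mathbf{m}^x_k+\mathbf{h}^x_k),\quad\mathbf{m}^y_{k+1}=W(\mathbf{m}^y_k+\mathbf{h}^y_k),$$ $$\mathbf{x}_{k+1}=W(\mathbf{x}_k-\gamma_xV_{k+1}^{-\alpha}\nabla_xF(\mathbf{x}_k,\mathbf{y}_k;\xi^x_k)),\quad\mathbf{y}_{k+1}=\mathcal{P}_{\mathcal{Y}}(W(\mathbf{y}_k+\gamma_yU_{k+1}^{-\beta}\nabla_yF(\mathbf{x}_k,\mathbf{y}_k;\xi^y_k))),$$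 where $V_k=\mathrm{diag}\{v_{i,k}\}$, $U_k=\mathrm{diag}\{u_{i,k}\}$, $v_{i,k}=\max\{m^x_{i,k},m^y_{i,k}\}$, $u_{i,k}=m^y_{i,k}$, and $\mathcal{P}_{\mathcal{Y}}$ is the row-wise Euclidean projection onto $\mathcal{Y}$. Averages: $\bar{x}_k=\frac1n\sum_ix_{i,k}$, $\bar v_k=\frac1n\sum_iv_{i,k}$, $\bar u_k=\frac1n\sum_iu_{i,k}$. Stepsize inconsistency: $\zeta_v^2=\sup_{i\in[n],k>0}(v_{i,k}^{-\alpha}-\bar v_k^{-\alpha})^2/(\bar v_k^{-\alpha})^2$, $\zeta_u^2=\sup_{i\in[n],k>0}(u_{i,k}^{-\beta}-\bar u_k^{-\beta})^2/(\bar u_k^{-\beta})^2$, where $\bar v_k^{-\alpha}=(\bar v_k)^{-\alpha}$ etc.; these are treated as finite deterministic constants. Asymptotic notation: $\Omega$ and $\tilde{\mathcal{O}}$ hide factors that may depend on $L,\mu,C,n,c,\alpha,\beta,\gamma_x,\gamma_y$, $\varPhi^{\max}-\varPhi^*$, the initial point, and $\zeta_v,\zeta_u$, but not otherwise on $K$ or $\rho_W$; $\tilde{\mathcal{O}}$ additionally hides factors polylogarithmic in $K$. *)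

(* Defs.v *)
From mathcomp Require Export all_boot all_order all_algebra.
From mathcomp Require Export all_classical all_reals all_analysis ess_sup_inf.

Set Implicit Arguments.
Unset Strict Implicit.
Unset Printing Implicit Defensive.

Export Order.TTheory GRing.Theory Num.Theory.
Export numFieldNormedType.Exports.

Open Scope classical_set_scope.
Open Scope ring_scope.

Section EuclideanGeometry.
Context {R : realType}.

(* The norm carried by 'M[R]_(m, n) in MathComp-Analysis is the max norm, hence
   these two. On rows and columns, [norm2] is the Euclidean norm. *)
Definition norm2 m n (A : 'M[R]_(m, n)) : R :=
  Num.sqrt (\sum_i \sum_j A i j ^+ 2).

Definition opnorm2 m n (A : 'M[R]_(m, n)) : R :=
  sup [set norm2 (A *m v) | v in [set v : 'cV[R]_n | norm2 v <= 1]].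

Definition inner n (u v : 'rV[R]_n) : R := \sum_j u 0 j * v 0 j.

Definition grad n (g : 'rV[R]_n -> R) (x : 'rV[R]_n) : 'rV[R]_n :=
  \row_j 'D_(delta_mx 0 j) g x.

(* The defaults in [xget] are irrelevant for a strongly concave objective with
   bounded gradients, resp. a nonempty closed convex set. *)
Definition argmax_on n (Y : set 'rV[R]_n) (g : 'rV[R]_n -> R) : 'rV[R]_n :=
  xget 0 [set y | Y y /\ forall y', Y y' -> g y' <= g y].

Definition proj_on n (Y : set 'rV[R]_n) (z : 'rV[R]_n) : 'rV[R]_n :=
  xget z [set y | Y y /\ forall y', Y y' -> norm2 (z - y) <= norm2 (z - y')].

Definition avg_row n m (A : 'M[R]_(n, m)) : 'rV[R]_m :=
  n%:R^-1 *: \sum_i row i A.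

Definition avg n (v : 'cV[R]_n) : R := n%:R^-1 * \sum_i v i 0.

End EuclideanGeometry.

Section Network.
Context {R : realType} {n : nat}.

Definition doubly_stochastic (W : 'M[R]_n) : Prop :=
  [/\ forall i j, 0 <= W i j,
      W *m const_mx 1 = const_mx 1 :> 'cV[R]_n &
      const_mx 1 *m W = const_mx 1 :> 'rV[R]_n].

Definition rhoW (W : 'M[R]_n) : R :=
  opnorm2 (W - const_mx (n%:R^-1)) ^+ 2.

End Network.

Definition mutually_independent d (T : measurableType d) (R : realType)
    (P : probability T R) (J : eqType) (dE : J -> measure_display)
    (E : forall j, measurableType (dE j)) (X : forall j, T -> E j) : Prop :=
  forall (s : seq J) (B : forall j, set (E j)), uniq s ->
    (forall j, measurable (B j)) ->
    P (\big[setI/setT]_(j <- s) (X j @^-1` B j)) =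
    (\prod_(j <- s) P (X j @^-1` B j))%E.

Section Objectives.
Context {R : realType} {p d : nat}.
Implicit Types (Y : set 'rV[R]_d) (f : 'rV[R]_p -> 'rV[R]_d -> R).

Definition gradx f (x : 'rV[R]_p) (y : 'rV[R]_d) : 'rV[R]_p :=
  grad (fun x' => f x' y) x.
Definition grady f (x : 'rV[R]_p) (y : 'rV[R]_d) : 'rV[R]_d := grad (f x) y.

(* Entry (a, b) is the derivative along z_a of the y_b-component of the
   y-gradient, for z = x, y. *)
Definition hessxy f (x : 'rV[R]_p) (y : 'rV[R]_d) : 'M[R]_(p, d) :=
  'J (fun x' => grady f x' y) x.
Definition hessyy f (x : 'rV[R]_p) (y : 'rV[R]_d) : 'M[R]_(d, d) :=
  'J (grady f x) y.

Definition strongly_concave (mu : R) Y f : Prop :=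
  forall x y y', Y y -> Y y' ->
    f x y - f x y' >=
      inner (grady f x y) (y - y') + mu / 2 * norm2 (y - y') ^+ 2.

(* Y may have boundary points (or an empty interior), so derivatives at points
   of R^p x Y are those of a function defined around R^p x Y. *)
Definition twice_differentiable_on Y f : Prop :=
  forall x y, Y y ->
    (\forall z \near ((x, y) : 'rV[R]_p * 'rV[R]_d),
       differentiable (fun z' : 'rV[R]_p * 'rV[R]_d => f z'.1 z'.2) z) /\
    differentiable (fun z : 'rV[R]_p * 'rV[R]_d => grady f z.1 z.2) (x, y).

Definition lipschitz_sq (L : R) Y m n
    (G : 'rV[R]_p -> 'rV[R]_d -> 'M[R]_(m, n)) (N : 'M[R]_(m, n) -> R) : Prop :=
  forall x x' y y', Y y -> Y y' ->
    N (G x y - G x' y') ^+ 2 <=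
      L ^+ 2 * (norm2 (x - x') ^+ 2 + norm2 (y - y') ^+ 2).

Definition smooth (L : R) Y f : Prop :=
  [/\ twice_differentiable_on Y f,
      lipschitz_sq L Y (gradx f) (@norm2 R 1 p),
      lipschitz_sq L Y (grady f) (@norm2 R 1 d),
      lipschitz_sq L Y (hessxy f) (@opnorm2 R p d) &
      lipschitz_sq L Y (hessyy f) (@opnorm2 R d d)].

Definition expected_obj dS (S : measurableType dS) (D : probability S R)
    (F : 'rV[R]_p -> 'rV[R]_d -> S -> R) x y : R :=
  fine ('E_D[F x y]).

Definition borel (T : topologicalType) := g_sigma_algebraType (@open T).

(* Unbiased stochastic gradients of norm at most C. The first three clauses are
   what makes the expectations meaningful; joint measurability (the point (x, y)
   ranging over R^p x Y with its Borel sets) makes the stochastic gradients at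
   random iterates random variables. *)
Definition stochastic_gradients (C : R) Y dS (S : measurableType dS)
    (D : probability S R) (F : 'rV[R]_p -> 'rV[R]_d -> S -> R) : Prop :=
  let f := expected_obj D F in
  let Fs s := fun x y => F x y s in
  let dom := [set t : borel ('rV[R]_p * 'rV[R]_d)%type * S | Y t.1.2] in
  [/\ forall x y, Y y -> D.-integrable [set: S] (EFin \o F x y),
      forall x y s, Y y ->
        differentiable (fun z : 'rV[R]_p * 'rV[R]_d => F z.1 z.2 s) (x, y),
      (forall a, measurable_fun dom (fun t => gradx (Fs t.2) t.1.1 t.1.2 0 a)) /\
      (forall b, measurable_fun dom (fun t => grady (Fs t.2) t.1.1 t.1.2 0 b)),
      forall x y, Y y ->
        (forall a, ('E_D[fun s => gradx (Fs s) x y 0%R a] =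
                    (gradx f x y 0%R a)%:E)%E) /\
        (forall b, ('E_D[fun s => grady (Fs s) x y 0%R b] =
                    (grady f x y 0%R b)%:E)%E) &
      forall x y s, Y y ->
        norm2 (gradx (Fs s) x y) <= C /\ norm2 (grady (Fs s) x y) <= C].

Definition Phi Y f (x : 'rV[R]_p) : R := f x (argmax_on Y (f x)).

End Objectives.

Section DAdaST.
Context {R : realType} {n p d : nat}.

Record state := State {
  st_x : 'M[R]_(n, p);
  st_y : 'M[R]_(n, d);
  st_mx : 'cV[R]_n;
  st_my : 'cV[R]_n }.

Definition colmax (a b : 'cV[R]_n) : 'cV[R]_n := \col_i Num.max (a i 0) (b i 0).

Definition st_v (s : state) : 'cV[R]_n := colmax (st_mx s) (st_my s).
Definition st_u (s : state) : 'cV[R]_n := st_my s.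

Definition diag_powR (v : 'cV[R]_n) (a : R) : 'M[R]_n :=
  diag_mx (\row_i (v i 0) `^ a).

Definition sq_row_norms m (G : 'M[R]_(n, m)) : 'cV[R]_n :=
  \col_i norm2 (row i G) ^+ 2.

Definition dadast_step (W : 'M[R]_n) (Y : set 'rV[R]_d) (alpha beta gx gy : R)
    (Gx : 'M[R]_(n, p)) (Gy : 'M[R]_(n, d)) (s : state) : state :=
  let mx' := W *m (st_mx s + sq_row_norms Gx) in
  let my' := W *m (st_my s + sq_row_norms Gy) in
  let x' := W *m (st_x s - gx *: (diag_powR (colmax mx' my') (- alpha) *m Gx)) in
  let y' := W *m (st_y s + gy *: (diag_powR my' (- beta) *m Gy)) in
  State x' (\matrix_i proj_on Y (row i y')) mx' my'.

Section Run.
Context {dS : 'I_n -> measure_display} {S : forall i, measurableType (dS i)}.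
Variables (F : forall i : 'I_n, 'rV[R]_p -> 'rV[R]_d -> S i -> R).

Definition stoch_gradx (s : state) (xi : forall i, S i) : 'M[R]_(n, p) :=
  \matrix_i gradx (fun x y => F x y (xi i)) (row i (st_x s)) (row i (st_y s)).
Definition stoch_grady (s : state) (xi : forall i, S i) : 'M[R]_(n, d) :=
  \matrix_i grady (fun x y => F x y (xi i)) (row i (st_x s)) (row i (st_y s)).

Variables (W : 'M[R]_n) (Y : set 'rV[R]_d) (alpha beta gx gy c : R).
Variables (x0 : 'M[R]_(n, p)) (y0 : 'M[R]_(n, d)).

Fixpoint dadast (xix xiy : forall i, nat -> S i) (k : nat) : state :=
  if k is k'.+1 then
    let s := dadast xix xiy k' in
    dadast_step W Y alpha beta gx gy
      (stoch_gradx s (xix ^~ k')) (stoch_grady s (xiy ^~ k')) s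
  else State x0 y0 (const_mx c) (const_mx c).

End Run.

(* Along one trajectory w_0, w_1, ... of positive vectors, the supremum over
   nodes i and times k > 0 of the squared relative deviation. *)
Definition path_zeta_sq (a : R) (w : nat -> 'cV[R]_n) : \bar R :=
  ereal_sup [set (((w k i 0) `^ (- a) - (avg (w k)) `^ (- a)) ^+ 2
                  / ((avg (w k)) `^ (- a)) ^+ 2)%:E
            | k in [set k : nat | (0 < k)%N] & i in [set: 'I_n]].

End DAdaST.

(* Main.v *)
(** Second derivatives are not used. Let [z] be an exponential moving average of
    the mean iterate, updated with weight proportional to the current y-stepsize.
    The tracking error is measured as [sum_i |y_i - y^*(z)|^2] rather than at the
    mean iterate: the move of [z] is of the order of the y-stepsize times
    [|xbar - z|], so the drift of the target is controlled by the Lipschitz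
    continuity of [y^*] alone, and [|xbar - z|^2] obeys a recursion driven by
    (x-stepsize / y-stepsize)^2 times the squared x-gradient. Since beta < alpha,
    that ratio squared is at most e + M / (accumulated squared gradients), and for
    small e the e-part is absorbed by the descent of Phi.

    Along one trajectory, the descent of Phi, the recursions for [|xbar - z|^2]
    and for the tracking error, and the consensus recursions are summed; the
    remainders are sums of h_k / S_k^q with S_k = c + h_0 + ... + h_{k-1}, hence
    powers of K times ln K. The stepsize inconsistency costs only the ratio
    |v_i - mean v| / mean v, and |v_i - mean v| is bounded by a multiple of
    1 / (1 - sqrt rho_W). What is left is a sum of gradient errors with coefficients
    depending on the past; its expectation is 0 because the current sample is
    independent of the past. *)

Require Import Defs.
From mathcomp Require Import measurable_realfun ring lra.

Set Implicit Arguments.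
Unset Strict Implicit.
Unset Printing Implicit Defensive.

(** The obstacle is that the stepsizes of step [k] already contain the sample of step [k]: a
    gradient error multiplied by such a stepsize does not have mean zero. Each recursion is
    therefore divided by its own stepsize before it is summed, so that the error appears with a
    coefficient known before the sample is drawn. The telescoping differences then carry growing
    weights [vb] or [ub]; Abel summation pays for them with the boundedness of [Phi], of the
    averaging error and of the tracking error ([Y] is bounded, see [diam_Y]). Where an x-stepsize
    remains, in the recursion for [z], it is replaced by the previous one at a relative cost
    [C^2 / Vm]. True gradients are traded for observed ones in the same spirit: |G|^2 <= |g|^2 - 2
    <G, g - G>, where |g|^2 is summable against the accumulators and the inner product is one more
    centred term. The hidden constants must not depend on the network or the horizon, so all
    dependence on K and on the spectral gap is collected in nine elementary quantities, bounded in
    [rate_bounds]. *)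

Lemma le_sqr (R : realDomainType) (x y : R) : 0 <= x -> x <= y -> x ^+ 2 <= y ^+ 2.
Proof. by move=> x0 xy; rewrite ler_sqr ?nnegrE// (le_trans x0). Qed.

(** * Euclidean geometry and gossip averaging *)

Section Inner.
Context {R : realType} {m : nat}.
Implicit Types (u v w : 'rV[R]_m) (a b e : R).

Lemma innerC u v : inner u v = inner v u.
Proof. by apply: eq_bigr => j _; rewrite mulrC. Qed.

Lemma innerDl u v w : inner (u + v) w = inner u w + inner v w.
Proof. by rewrite -big_split; apply: eq_bigr => j _; rewrite mxE mulrDl. Qed.

Lemma innerZl a u v : inner (a *: u) v = a * inner u v.
Proof. by rewrite /inner mulr_sumr; apply: eq_bigr => j _; rewrite mxE mulrA. Qed.

Lemma innerNl u v : inner (- u) v = - inner u v.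
Proof. by rewrite -scaleN1r innerZl mulN1r. Qed.

Lemma inner0l v : inner 0 v = 0.
Proof. by rewrite -[X in inner X v](scale0r v) innerZl mul0r. Qed.

Lemma innerDr u v w : inner w (u + v) = inner w u + inner w v.
Proof. by rewrite !(innerC w) innerDl. Qed.

Lemma innerZr a u v : inner v (a *: u) = a * inner v u.
Proof. by rewrite !(innerC v) innerZl. Qed.

Lemma innerNr u v : inner v (- u) = - inner v u.
Proof. by rewrite !(innerC v) innerNl. Qed.

Definition innerE := (innerDl, innerDr, innerNl, innerNr, innerZl, innerZr).

Lemma inner_suml (I : finType) (f : I -> 'rV[R]_m) v :
  inner (\sum_i f i) v = \sum_i inner (f i) v.
Proof.
elim/big_rec2: _ => [|i x y _ <-]; last by rewrite innerDl.
by rewrite /inner big1// => j _; rewrite mxE mul0r.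
Qed.

Lemma inner_sumr (I : finType) (f : I -> 'rV[R]_m) v :
  inner v (\sum_i f i) = \sum_i inner v (f i).
Proof. by rewrite innerC inner_suml; apply: eq_bigr => i _; rewrite innerC. Qed.

Lemma norm2_sq u : norm2 u ^+ 2 = inner u u.
Proof.
rewrite /norm2 big_ord1 sqr_sqrtr; last by apply: sumr_ge0 => j _; exact: sqr_ge0.
by apply: eq_bigr => j _; rewrite expr2.
Qed.

Lemma norm2_ge0 (k : nat) (A : 'M[R]_(k, m)) : 0 <= norm2 A.
Proof. exact: sqrtr_ge0. Qed.

Lemma norm2N u : norm2 (- u) = norm2 u.
Proof.
apply/eqP; rewrite -(@eqrXn2 _ 2) ?norm2_ge0// !norm2_sq !innerE.
by apply/eqP; ring.
Qed.

Lemma norm2BC u v : norm2 (u - v) = norm2 (v - u).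
Proof. by rewrite -norm2N opprB. Qed.

Lemma norm2Z_sq a u : norm2 (a *: u) ^+ 2 = a ^+ 2 * norm2 u ^+ 2.
Proof. by rewrite !norm2_sq !innerE mulrA expr2. Qed.

Lemma norm2D_sq u v :
  norm2 (u + v) ^+ 2 = norm2 u ^+ 2 + 2 * inner u v + norm2 v ^+ 2.
Proof. by rewrite !norm2_sq !innerE (innerC v u); ring. Qed.

Lemma norm2B_sq u v :
  norm2 (u - v) ^+ 2 = norm2 u ^+ 2 - 2 * inner u v + norm2 v ^+ 2.
Proof. by rewrite !norm2_sq !innerE (innerC v u); ring. Qed.

Lemma norm2D_sq_le u v : norm2 (u + v) ^+ 2 <= 2 * norm2 u ^+ 2 + 2 * norm2 v ^+ 2.
Proof. by have := sqr_ge0 (norm2 (u - v)); rewrite norm2B_sq norm2D_sq; lra. Qed.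

Lemma inner_young e u v : 0 < e ->
  2 * inner u v <= e * norm2 u ^+ 2 + e^-1 * norm2 v ^+ 2.
Proof.
move=> e0; rewrite -(ler_pM2l e0) -subr_ge0.
have -> : e * (e * norm2 u ^+ 2 + e^-1 * norm2 v ^+ 2) - e * (2 * inner u v) =
  norm2 (e *: u - v) ^+ 2.
  by rewrite norm2B_sq norm2Z_sq !innerE; field; rewrite gt_eqF.
exact: sqr_ge0.
Qed.

Lemma inner_youngN e u v : 0 < e ->
  - (2 * inner u v) <= e * norm2 u ^+ 2 + e^-1 * norm2 v ^+ 2.
Proof. by move=> e0; rewrite -mulrN -innerNr (le_trans (inner_young _ _ e0))// norm2N. Qed.

Lemma norm2D_sq_eps e u v : 0 < e ->
  norm2 (u + v) ^+ 2 <= (1 + e) * norm2 u ^+ 2 + (1 + e^-1) * norm2 v ^+ 2.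
Proof. by move=> e0; rewrite norm2D_sq; have := inner_young u v e0; lra. Qed.

Lemma norm2_eq0 u : norm2 u = 0 -> u = 0.
Proof.
move=> u0; have := norm2_sq u; rewrite u0 expr0n/= => /esym/eqP.
rewrite psumr_eq0 => [|j _]; last by rewrite -expr2 sqr_ge0.
move=> /allP uj; apply/rowP => j; rewrite mxE.
by have := uj j (mem_index_enum _); rewrite /= mulf_eq0 orbb => /eqP.
Qed.

Lemma norm20 : norm2 (0 : 'rV[R]_m) = 0.
Proof.
by apply/eqP; rewrite -(@eqrXn2 _ 2) ?norm2_ge0// norm2_sq inner0l expr0n.
Qed.

Lemma inner_le u v : inner u v <= norm2 u * norm2 v.
Proof.
have [/norm2_eq0 ->|u0] := eqVneq (norm2 u) 0.
  by rewrite inner0l mulr_ge0 ?norm2_ge0.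
have [/norm2_eq0 ->|v0] := eqVneq (norm2 v) 0.
  by rewrite innerC inner0l mulr_ge0 ?norm2_ge0.
have pu : 0 < norm2 u by rewrite lt_def u0 norm2_ge0.
have pv : 0 < norm2 v by rewrite lt_def v0 norm2_ge0.
have e0 : 0 < norm2 v / norm2 u by rewrite divr_gt0.
have := inner_young u v e0.
have -> : norm2 v / norm2 u * norm2 u ^+ 2 + (norm2 v / norm2 u)^-1 * norm2 v ^+ 2 =
  2 * (norm2 u * norm2 v) by field; rewrite u0 v0.
by rewrite ler_pM2l.
Qed.

Lemma inner_abs u v : `|inner u v| <= norm2 u * norm2 v.
Proof.
rewrite ler_norml inner_le andbT lerNl -innerNl.
by rewrite (le_trans (inner_le _ _))// norm2N.
Qed.

Lemma norm2D u v : norm2 (u + v) <= norm2 u + norm2 v.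
Proof.
rewrite -ler_sqr ?nnegrE ?addr_ge0 ?norm2_ge0// norm2D_sq.
by have := inner_le u v; rewrite sqrrD; lra.
Qed.

Lemma norm2B u v : norm2 (u - v) <= norm2 u + norm2 v.
Proof. by rewrite -(norm2N v) norm2D. Qed.

Lemma norm2_dist u v w : norm2 (u - w) <= norm2 (u - v) + norm2 (v - w).
Proof. by rewrite -(subrKA v u) (le_trans (norm2D _ _)) ?norm2N. Qed.

Lemma norm2Z a u : norm2 (a *: u) = `|a| * norm2 u.
Proof.
apply/eqP; rewrite -(@eqrXn2 _ 2) ?mulr_ge0 ?norm2_ge0//.
by rewrite norm2Z_sq exprMn real_normK ?num_real.
Qed.

Lemma coord_norm2 u j : `|u 0 j| <= norm2 u.
Proof.
rewrite -ler_sqr ?nnegrE ?norm2_ge0// norm2_sq real_normK ?num_real//.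
rewrite /inner (bigD1 j)//= -expr2 lerDl sumr_ge0// => i _.
by rewrite -expr2 sqr_ge0.
Qed.

Lemma norm_le_norm2 u : `|u| <= norm2 u.
Proof.
rewrite [leLHS]/Num.norm/= mx_normrE (bigmax_le _ (norm2_ge0 _))// => -[i j] _ /=.
by rewrite (ord1 i) coord_norm2.
Qed.

Lemma coord_norm u j : `|u 0 j| <= `|u|.
Proof.
rewrite [leRHS]/Num.norm/= mx_normrE.
exact: (le_bigmax _ (fun i : 'I_1 * 'I_m => `|u i.1 i.2|) (0, j)).
Qed.

Lemma norm2_le_norm u : norm2 u <= m%:R * `|u|.
Proof.
rewrite -ler_sqr ?nnegrE ?norm2_ge0 ?mulr_ge0// norm2_sq.
have : inner u u <= \sum_(j < m) `|u| ^+ 2.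
  apply: ler_sum => j _; rewrite -expr2 -(@real_normK _ (u 0 j)) ?num_real//.
  by rewrite ler_sqr ?nnegrE ?coord_norm.
move=> /le_trans; apply; rewrite sumr_const card_ord -[leLHS]mulr_natl exprMn.
rewrite ler_wpM2r ?sqr_ge0// -natrX ler_nat.
case: (posnP m) => [->//|m0].
by rewrite expnS expn1 leq_pmulr.
Qed.

(** Jensen's inequality for the squared norm: the gap between the two sides is the weighted variance
    around the mean [g]. *)
Lemma norm2_sum_sq (I : finType) (a : I -> R) (f : I -> 'rV[R]_m) :
  (forall i, 0 <= a i) -> \sum_i a i = 1 ->
  norm2 (\sum_i a i *: f i) ^+ 2 <= \sum_i a i * norm2 (f i) ^+ 2.
Proof.
move=> a0 a1; set g := \sum_i _.
have : 0 <= \sum_i a i * norm2 (f i - g) ^+ 2.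
  by apply: sumr_ge0 => i _; rewrite mulr_ge0 ?sqr_ge0.
under eq_bigr do rewrite norm2B_sq mulrDr mulrBr.
rewrite big_split sumrB/= -mulr_suml a1 mul1r.
have -> : \sum_i a i * (2 * inner (f i) g) = 2 * norm2 g ^+ 2.
  rewrite norm2_sq {2}/g inner_suml mulr_sumr; apply: eq_bigr => i _.
  by rewrite innerZl; ring.
by lra.
Qed.

End Inner.

Section Rows.
Context {R : realType} {n : nat}.

(** The squared Frobenius norm, summed by rows because the rows belong to the nodes. *)
Definition frob m (A : 'M[R]_(n, m)) : R := \sum_i norm2 (row i A) ^+ 2.

Lemma frob_ge0 m (A : 'M[R]_(n, m)) : 0 <= frob A.
Proof. by apply: sumr_ge0 => i _; exact: sqr_ge0. Qed.

Lemma norm2_frob m (A : 'M[R]_(n, m)) : norm2 A ^+ 2 = frob A.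
Proof.
rewrite sqr_sqrtr; last by do 2!apply: sumr_ge0 => ? _; exact: sqr_ge0.
apply: eq_bigr => i _; rewrite norm2_sq; apply: eq_bigr => j _.
by rewrite !mxE expr2.
Qed.

Lemma norm2_avg_sq m (f : 'I_n -> 'rV[R]_m) : (0 < n)%N ->
  norm2 (n%:R^-1 *: \sum_i f i) ^+ 2 <= n%:R^-1 * \sum_i norm2 (f i) ^+ 2.
Proof.
move=> n0; rewrite scaler_sumr mulr_sumr; apply: norm2_sum_sq => //.
by rewrite sumr_const card_ord -[LHS]mulr_natr mulVf// pnatr_eq0 -lt0n.
Qed.

End Rows.

Section Network.
Context {R : realType} {n : nat}.
Implicit Types W : 'M[R]_n.

Definition dev m (A : 'M[R]_(n, m)) : 'M[R]_(n, m) := \matrix_i (row i A - avg_row A).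

Lemma row_dev m (A : 'M[R]_(n, m)) i : row i (dev A) = row i A - avg_row A.
Proof. exact: rowK. Qed.

Lemma avg_row_mulmx m (A : 'M[R]_(n, m)) : const_mx n%:R^-1 *m A = avg_row A.
Proof.
apply/rowP => j; rewrite !mxE summxE mulr_sumr; apply: eq_bigr => i _.
by rewrite !mxE.
Qed.

Lemma dev_mulmx m (A : 'M[R]_(n, m)) : dev A = A - const_mx n%:R^-1 *m A.
Proof.
apply/row_matrixP => i; rewrite row_dev linearB/= row_mul -avg_row_mulmx.
by congr (_ - _ *m _); apply/rowP => j; rewrite !mxE.
Qed.

Lemma doubly_stochastic_row W i : doubly_stochastic W -> \sum_j W i j = 1.
Proof.
move=> [_ /matrixP/(_ i 0)]; rewrite !mxE => <- _.
by apply: eq_bigr => j _; rewrite mxE mulr1.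
Qed.

Lemma doubly_stochastic_col W j : doubly_stochastic W -> \sum_i W i j = 1.
Proof.
move=> [_ _ /matrixP/(_ 0 j)]; rewrite !mxE => <-.
by apply: eq_bigr => i _; rewrite mxE mul1r.
Qed.

Lemma avg_row_stochastic m W (A : 'M[R]_(n, m)) : doubly_stochastic W ->
  avg_row (W *m A) = avg_row A.
Proof.
move=> dW; rewrite -!avg_row_mulmx mulmxA; congr (_ *m _).
apply/rowP => j; rewrite !mxE.
under eq_bigr do rewrite !mxE.
by rewrite -mulr_sumr doubly_stochastic_col// mulr1.
Qed.

(** [W J = J W = J J = J], so subtracting the mean commutes with gossip and leaves [W - J] acting on
    the deviations. This is how [rhoW] enters. *)
Lemma dev_stochastic m W (A : 'M[R]_(n, m)) : (0 < n)%N -> doubly_stochastic W ->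
  dev (W *m A) = (W - const_mx n%:R^-1) *m dev A.
Proof.
move=> n0 dW; set J : 'M[R]_n := const_mx n%:R^-1.
have nV : n%:R^-1 *+ n = 1 :> R by rewrite -[LHS]mulr_natr mulVf// pnatr_eq0 -lt0n.
have WJ : W *m J = J.
  apply/matrixP => i j; rewrite !mxE; under eq_bigr do rewrite !mxE.
  by rewrite -mulr_suml doubly_stochastic_row// mul1r.
have JW : J *m W = J.
  apply/matrixP => i j; rewrite !mxE; under eq_bigr do rewrite !mxE.
  by rewrite -mulr_sumr doubly_stochastic_col// mulr1.
have JJ : J *m J = J.
  apply/matrixP => i j; rewrite !mxE; under eq_bigr do rewrite !mxE.
  by rewrite sumr_const card_ord -mulrnAr nV mulr1.
rewrite !dev_mulmx -/J [RHS]mulmxBl [W *m (_ - _)]mulmxBr [J *m (_ - _)]mulmxBr.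
by rewrite !mulmxA WJ JJ JW subrr subr0.
Qed.

Lemma opnorm2_le k l (A : 'M[R]_(k, l)) (v : 'cV[R]_l) :
  norm2 (A *m v) <= opnorm2 A * norm2 v.
Proof.
(* Cauchy-Schwarz row by row: [opnorm2] is a supremum, which says something only once the set is
   known to be bounded. *)
have cs (u : 'cV[R]_l) : norm2 (A *m u) <= norm2 A * norm2 u.
  rewrite -ler_sqr ?nnegrE ?mulr_ge0 ?norm2_ge0// exprMn !norm2_frob.
  rewrite /frob mulr_suml; apply: ler_sum => i _.
  have -> : \sum_j norm2 (row j u) ^+ 2 = norm2 u^T ^+ 2.
    rewrite norm2_sq; apply: eq_bigr => j _; rewrite norm2_sq /inner big_ord1.
    by rewrite !mxE.
  rewrite -exprMn ler_sqr ?nnegrE ?mulr_ge0 ?norm2_ge0//.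
  have -> : norm2 (row i (A *m u)) = `|inner (row i A) u^T|.
    rewrite /norm2 !big_ord1 sqrtr_sqr !mxE; congr (`|_|).
    by apply: eq_bigr => j _; rewrite !mxE.
  exact: inner_abs.
have ub : has_ubound [set norm2 (A *m u) | u in [set u : 'cV[R]_l | norm2 u <= 1]].
  exists (norm2 A) => _ [q /= q1 <-]; rewrite (le_trans (cs q))//.
  by rewrite -[leRHS]mulr1 ler_wpM2l ?norm2_ge0.
have [v0|v0] := eqVneq (norm2 v) 0.
  by rewrite (le_trans (cs v))// v0 !mulr0.
have pv : 0 < norm2 v by rewrite lt_def v0 norm2_ge0.
have nZ k' (a : R) (u : 'cV[R]_k') : 0 <= a -> norm2 (a *: u) = a * norm2 u.
  move=> a0; apply/eqP; rewrite -(@eqrXn2 _ 2) ?mulr_ge0 ?norm2_ge0//.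
  apply/eqP; rewrite exprMn !norm2_frob mulr_sumr.
  by apply: eq_bigr => i _; rewrite linearZ/= norm2Z_sq.
have : norm2 (A *m ((norm2 v)^-1 *: v)) <= opnorm2 A.
  apply: ub_le_sup => //; exists ((norm2 v)^-1 *: v) => //=.
  by rewrite nZ ?invr_ge0 ?norm2_ge0// mulVf.
rewrite -scalemxAr nZ ?invr_ge0 ?norm2_ge0//.
by rewrite ler_pdivrMl// mulrC.
Qed.

(** The operator norm controls the image of one vector, so the squared Frobenius norm is resummed
    over columns. *)
Lemma opnorm2_frob m (A : 'M[R]_n) (B : 'M[R]_(n, m)) :
  frob (A *m B) <= opnorm2 A ^+ 2 * frob B.
Proof.
have frobE (D : 'M[R]_(n, m)) : frob D = \sum_j norm2 (col j D) ^+ 2.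
  transitivity (\sum_i \sum_j D i j ^+ 2).
    by apply: eq_bigr => i _; rewrite norm2_sq; apply: eq_bigr => j _; rewrite !mxE expr2.
  rewrite exchange_big; apply: eq_bigr => j _; rewrite norm2_frob.
  by apply: eq_bigr => i _; rewrite norm2_sq /inner big_ord1 !mxE expr2.
rewrite !frobE mulr_sumr; apply: ler_sum => j _.
rewrite colE -mulmxA -colE -exprMn ler_sqr ?nnegrE ?norm2_ge0 ?opnorm2_le//.
exact: le_trans (norm2_ge0 _) (opnorm2_le _ _).
Qed.

Lemma frob_dev_stochastic m W (A : 'M[R]_(n, m)) : (0 < n)%N -> doubly_stochastic W ->
  frob (dev (W *m A)) <= rhoW W * frob (dev A).
Proof. by move=> n0 dW; rewrite dev_stochastic// opnorm2_frob. Qed.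

Lemma sum_row_avg m (A : 'M[R]_(n, m)) : (0 < n)%N ->
  \sum_i row i A = n%:R *: avg_row A.
Proof. by move=> n0; rewrite scalerA divff ?scale1r// pnatr_eq0 -lt0n. Qed.

(** Bias-variance decomposition: the cross term vanishes because the deviations sum to zero. *)
Lemma frob_dist m (A : 'M[R]_(n, m)) (c : 'rV[R]_m) : (0 < n)%N ->
  \sum_i norm2 (row i A - c) ^+ 2 = frob (dev A) + n%:R * norm2 (avg_row A - c) ^+ 2.
Proof.
move=> n0; transitivity (\sum_i (norm2 (row i (dev A)) ^+ 2 +
    2 * inner (row i (dev A)) (avg_row A - c) + norm2 (avg_row A - c) ^+ 2)).
  by apply: eq_bigr => i _; rewrite -norm2D_sq row_dev subrKA.
rewrite !big_split/= sumr_const card_ord -mulr_sumr -inner_suml.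
under [X in inner X _]eq_bigr do rewrite row_dev.
rewrite sumrB sum_row_avg// sumr_const card_ord scaler_nat subrr inner0l mulr0 addr0.
by congr (_ + _); rewrite mulr_natl.
Qed.

Lemma frob_dev_le m (A : 'M[R]_(n, m)) (c : 'rV[R]_m) : (0 < n)%N ->
  frob (dev A) <= \sum_i norm2 (row i A - c) ^+ 2.
Proof. by move=> n0; rewrite frob_dist// lerDl mulr_ge0 ?sqr_ge0. Qed.

Lemma frob_dev_frob m (A : 'M[R]_(n, m)) : (0 < n)%N -> frob (dev A) <= frob A.
Proof.
by move=> n0; rewrite (le_trans (frob_dev_le A 0 n0))//; under eq_bigr do rewrite subr0.
Qed.

(** The mean of projected rows is not the projection of the mean, but the spread around the mean is
    at most the spread around any point, here [P (avg_row A)]. *)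
Lemma frob_dev_proj m (A B : 'M[R]_(n, m)) (P : 'rV[R]_m -> 'rV[R]_m) : (0 < n)%N ->
  (forall u v, norm2 (P u - P v) <= norm2 (u - v)) ->
  (forall i, row i B = P (row i A)) -> frob (dev B) <= frob (dev A).
Proof.
move=> n0 Pn BP; rewrite (le_trans (frob_dev_le B (P (avg_row A)) n0))//.
apply: ler_sum => i _; rewrite BP row_dev.
by rewrite ler_sqr ?nnegrE ?norm2_ge0.
Qed.

Lemma rhoW_ge0 W : 0 <= rhoW W. Proof. exact: sqr_ge0. Qed.

Definition gap W : R := 1 - Num.sqrt (rhoW W).

Lemma gap_gt0 W : rhoW W < 1 -> 0 < gap W.
Proof. by move=> r1; rewrite subr_gt0 -[ltRHS]sqrtr1 ltr_sqrt. Qed.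

Lemma gap_le1 W : gap W <= 1.
Proof. by rewrite gerBl sqrtr_ge0. Qed.

Lemma rhoW_gap W : rhoW W = (1 - gap W) ^+ 2.
Proof. by rewrite /gap subKr sqr_sqrtr ?rhoW_ge0. Qed.

(** [1 - rho = s * (2 - s) <= 2 * s]: powers of [1 / gap] become powers of [1 / (1 - rho)] at the
    price of a factor 2 each. *)
Lemma gap_ge W : rhoW W < 1 -> (1 - rhoW W) / 2 <= gap W.
Proof.
move=> r1; rewrite rhoW_gap; have := gap_gt0 r1; have := gap_le1 W.
by move: (gap W) => s; nra.
Qed.

(** Young's inequality with weight [s = gap W]: the factor [(1 - s)^2] of the contraction leaves
    [(1 - s)^2 * (1 + s) <= 1 - s] on the old deviation and [(1 - s)^2 * (1 + 1 / s) <= 1 / s] on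
    the perturbation. *)
Lemma consensus_step m W (A B : 'M[R]_(n, m)) : (0 < n)%N -> doubly_stochastic W ->
  rhoW W < 1 ->
  frob (dev (W *m (A + B))) <= (1 - gap W) * frob (dev A) + (gap W)^-1 * frob B.
Proof.
move=> n0 dW r1; have s0 := gap_gt0 r1; have s1 := gap_le1 W.
rewrite (le_trans (frob_dev_stochastic _ n0 dW))//.
have dD : dev (A + B) = dev A + dev B by rewrite !dev_mulmx mulmxDr opprD addrACA.
have : frob (dev (A + B)) <=
    (1 + gap W) * frob (dev A) + (1 + (gap W)^-1) * frob (dev B).
  rewrite dD /frob !mulr_sumr -big_split; apply: ler_sum => i _.
  by rewrite [row i (_ + _)]linearD; exact: norm2D_sq_eps.
rewrite rhoW_gap; have := frob_dev_frob B n0; have := frob_ge0 (dev B).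
have := frob_ge0 (dev A); move: (frob (dev (A + B))) (frob (dev A)) (frob (dev B)) (frob B).
move: (gap W) s0 s1 => s s0 s1 x a b b' a0 b0 bb' xab.
have sV : s * s^-1 = 1 by rewrite divff// gt_eqF.
have sV1 : 0 < s^-1 by rewrite invr_gt0.
move: (s^-1) sV sV1 xab => t st t0 xab.
have h : (1 - s) ^+ 2 * x <= (1 - s) ^+ 2 * ((1 + s) * a + (1 + t) * b).
  by rewrite ler_wpM2l ?sqr_ge0.
have ha : (1 - s) ^+ 2 * (1 + s) * a <= (1 - s) * a.
  by apply: ler_wpM2r => //; nra.
have hb : (1 - s) ^+ 2 * (1 + t) * b <= t * b'.
  apply: ler_pM => //; first by rewrite mulr_ge0 ?sqr_ge0 ?addr_ge0// ltW.
  have -> : (1 - s) ^+ 2 * (1 + t) = t - 1 - s + s ^+ 2 + (s - 2) * (s * t - 1) by ring.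
  by rewrite st subrr mulr0; nra.
by nra.
Qed.

(** Row sums equal to 1 allow Jensen's inequality for each node; column sums equal to 1 give back
    the plain sum over nodes. *)
Lemma stochastic_row_jensen m W (A : 'M[R]_(n, m)) (c : 'rV[R]_m) :
  doubly_stochastic W ->
  \sum_i norm2 (row i (W *m A) - c) ^+ 2 <= \sum_i norm2 (row i A - c) ^+ 2.
Proof.
move=> dW; have [W0 _ _] := dW.
apply: (@le_trans _ _ (\sum_i \sum_j W i j * norm2 (row j A - c) ^+ 2)); last first.
  rewrite exchange_big/=; apply: ler_sum => j _.
  by rewrite -mulr_suml doubly_stochastic_col// mul1r.
apply: ler_sum => i _.
have -> : row i (W *m A) - c = \sum_j W i j *: (row j A - c).
  rewrite row_mul mulmx_sum_row.
  under [RHS]eq_bigr do rewrite scalerBr.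
  rewrite sumrB -scaler_suml doubly_stochastic_row// scale1r.
  by congr (_ - _); apply: eq_bigr => j _; rewrite mxE.
by apply: norm2_sum_sq => //; exact: doubly_stochastic_row.
Qed.

Lemma stochastic_ge W (v : 'cV[R]_n) c : doubly_stochastic W ->
  (forall i, c <= v i 0) -> forall i, c <= (W *m v) i 0.
Proof.
move=> dW cv i; have [W0 _ _] := dW; rewrite mxE.
rewrite -[leLHS]mul1r -(doubly_stochastic_row i dW) mulr_suml.
by apply: ler_sum => j _; rewrite ler_wpM2l.
Qed.

Lemma avg_avg_row (v : 'cV[R]_n) : avg v = avg_row v 0 0.
Proof.
by rewrite !mxE summxE; congr (_ * _); apply: eq_bigr => i _; rewrite mxE.
Qed.

Lemma avg_stochastic W (v : 'cV[R]_n) : doubly_stochastic W -> avg (W *m v) = avg v.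
Proof. by move=> dW; rewrite !avg_avg_row avg_row_stochastic. Qed.

Lemma frob_dev_col (v : 'cV[R]_n) i : (v i 0 - avg v) ^+ 2 <= frob (dev v).
Proof.
rewrite /frob (bigD1 i)//= norm2_sq row_dev /inner big_ord1 avg_avg_row.
have -> : (row i v - avg_row v) 0 0 = v i 0 - avg_row v 0 0 by rewrite !mxE.
by rewrite -expr2 lerDl sumr_ge0// => j _; exact: sqr_ge0.
Qed.

End Network.

(** * Projections and strongly concave maximisation *)

Section Euclidean.
Context {R : realType} {d : nat}.
Implicit Types (Y : set 'rV[R]_d) (y z : 'rV[R]_d).

Lemma convex_setP Y y y' (t : R) : convex_set Y -> Y y -> Y y' -> 0 <= t -> t <= 1 ->
  Y (t *: y + (1 - t) *: y').
Proof.
move=> cY Yy Yy' t0 t1.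
have := cY y y' (Itv01 t0 t1); rewrite !inE => /(_ Yy Yy').
by [].
Qed.

Lemma convex_avg n Y (A : 'M[R]_(n, d)) : (0 < n)%N -> convex_set Y ->
  (forall i, Y (row i A)) -> Y (avg_row A).
Proof.
move=> n0 cY YA.
(* Convexity is a statement about two points, so the uniform mean is built along a list, each new
   element entering with weight 1 / size. *)
suff H k (f : 'I_n -> 'rV[R]_d) (s : seq 'I_n) : size s = k.+1 -> (forall i, Y (f i)) ->
    Y ((size s)%:R^-1 *: \sum_(i <- s) f i).
  have := H n.-1 (fun i => row i A) (index_enum 'I_n).
  rewrite /index_enum -enumT size_enum_ord prednK// => /(_ erefl YA).
  by rewrite big_enum.
elim: k s => [|k IH] [|i s]// [sk] Yf.
  rewrite (size0nil sk) big_seq1 /= invr1 scale1r; exact: Yf.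
rewrite big_cons scalerDr.
have t0 : 0 <= (k.+2)%:R^-1 :> R by rewrite invr_ge0.
have t1 : (k.+2)%:R^-1 <= 1 :> R by rewrite invf_le1 ?ltr0n// ler1n.
have := convex_setP cY (Yf i) (IH s sk Yf) t0 t1.
rewrite /= sk scalerA; congr (Y (_ + _ *: _)).
have k1 : k.+1%:R != 0 :> R by rewrite pnatr_eq0.
have k2 : k.+2%:R != 0 :> R by rewrite pnatr_eq0.
have -> : 1 - k.+2%:R^-1 = k.+1%:R / k.+2%:R :> R.
  by apply: (mulIf k2); rewrite divfK// mulrBl mulVf// mul1r -[k.+2]addn1 natrD addrK.
by rewrite mulrAC divff// mul1r.
Qed.

Lemma within_lipschitz Y (g : 'rV[R]_d -> R) (M : R) :
  (forall y y', Y y -> Y y' -> `|g y - g y'| <= M * norm2 (y - y')) ->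
  {within Y, continuous g}.
Proof.
move=> gL; apply/subspace_continuousP => y Yy.
apply/cvgrPdist_lt => e e0.
have M1 : 0 < `|M| * d%:R + 1 by rewrite ltr_wpDl// mulr_ge0.
suff : \forall t \near y, Y t -> `|g y - g t| < e by [].
near=> t => Yt.
rewrite (le_lt_trans (gL _ _ Yy Yt))//.
have : `|y - t| < e / (`|M| * d%:R + 1).
  by near: t; apply: cvgr_dist_lt; [exact: cvg_id|rewrite divr_gt0].
rewrite ltr_pdivlMr// => h.
have h1 : M * norm2 (y - t) <= `|M| * (d%:R * `|y - t|).
  apply: (@le_trans _ _ (`|M| * norm2 (y - t))).
    by rewrite ler_wpM2r ?norm2_ge0// ler_norm.
  by rewrite ler_wpM2l// norm2_le_norm.
have : 0 <= `|y - t| by [].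
move: h h1; rewrite mulrDr mulr1 mulrA (mulrC `|y - t|) => h h1 h2.
by rewrite (le_lt_trans h1)// (le_lt_trans _ h)// lerDl.
Unshelve. all: by end_near. Qed.

Lemma compact_bounded2 Y (M : R) : closed Y ->
  (forall y y', Y y -> Y y' -> norm2 (y - y') <= M) -> compact Y.
Proof.
move=> cY bY.
have [->|/set0P[y0 Yy0]] := eqVneq Y set0; first exact: compact0.
apply: bounded_closed_compact => //.
exists (`|y0| + M); split; first exact: num_real.
move=> r ltr y Yy /=; rewrite (le_trans _ (ltW ltr))//.
rewrite -[y](subrK y0) addrC (le_trans (ler_normD _ _))// lerD2l.
by rewrite (le_trans (norm_le_norm2 _))// bY.
Qed.

Lemma within_norm2_dist Y z : {within Y, continuous (fun y => norm2 (z - y))}.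
Proof.
apply: (@within_lipschitz _ _ 1) => y y' _ _; rewrite mul1r ler_norml.
have := norm2_dist z y y'; have := norm2_dist z y' y; rewrite (norm2BC y' y).
by lra.
Qed.

End Euclidean.

Section Projection.
Context {R : realType} {d : nat}.
Variables (Y : set 'rV[R]_d) (M : R).
Hypotheses (cY : closed Y) (vY : convex_set Y) (Y0 : Y !=set0).
Hypothesis bY : forall y y', Y y -> Y y' -> norm2 (y - y') <= M.

(** The minimiser exists by compactness; [bY] is supplied later by [diam_Y]. *)
Lemma proj_onP z : Y (proj_on Y z) /\
  forall y, Y y -> norm2 (z - proj_on Y z) <= norm2 (z - y).
Proof.
have [c /set_mem Yc cmin] :=
  compact_EVT_min Y0 (compact_bounded2 cY bY) (@within_norm2_dist _ _ Y z).
have h : [set y | Y y /\ forall y', Y y' -> norm2 (z - y) <= norm2 (z - y')] !=set0.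
  by exists c; split => // y Yy; apply: cmin; rewrite inE.
by have [] := xgetPex z h.
Qed.

Lemma proj_on_in z : Y (proj_on Y z). Proof. by have [] := proj_onP z. Qed.

Lemma proj_on_id y : Y y -> proj_on Y y = y.
Proof.
move=> Yy; have [_ /(_ _ Yy)] := proj_onP y; rewrite subrr norm20 => h.
have /norm2_eq0/eqP : norm2 (y - proj_on Y y) = 0.
  by apply/eqP; rewrite eq_le h norm2_ge0.
by rewrite subr_eq0 => /eqP.
Qed.

Lemma proj_on_variational z y : Y y ->
  inner (z - proj_on Y z) (y - proj_on Y z) <= 0.
Proof.
move=> Yy; have [Yp pmin] := proj_onP z; set q := proj_on Y z in Yp pmin *.
set a := inner _ _; set b := norm2 (y - q) ^+ 2.
have b0 : 0 <= b by exact: sqr_ge0.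
have key t : 0 <= t -> t <= 1 -> 2 * t * a <= t ^+ 2 * b.
  move=> t0 t1; have := pmin _ (convex_setP vY Yy Yp t0 t1).
  move=> /(le_sqr (norm2_ge0 _)).
  have -> : z - (t *: y + (1 - t) *: q) = (z - q) - t *: (y - q).
    by apply/rowP => j; rewrite !mxE; ring.
  by rewrite (norm2B_sq (z - q)) norm2Z_sq innerZr -/a -/b; nra.
rewrite leNgt; apply/negP => a0.
have b1 : 0 < 1 + b + a by lra.
(* A step with [0 < t <= 1] and [t * b < 2 * a] contradicts [key]; here
   [t * b = a - t - t * a < a]. *)
set t := a / (1 + b + a).
have tE : t * (1 + b + a) = a by rewrite divfK// gt_eqF.
have t0 : 0 < t by rewrite divr_gt0.
have t1 : t <= 1 by rewrite ler_pdivrMr// mul1r; lra.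
have h : 2 * a <= t * b.
  by rewrite -(ler_pM2l t0); have := key _ (ltW t0) t1; rewrite expr2; lra.
have tb : 0 <= t * b by rewrite mulr_ge0// ltW.
have ta : 0 < t * a by rewrite mulr_gt0.
by move: tE; rewrite !mulrDr mulr1; lra.
Qed.

(** Adding the two variational inequalities makes the inner product of [p - q] with the difference
    of the residuals nonnegative; expanding the square of [u - v] then gives the claim. *)
Lemma proj_on_nonexpansive u v : norm2 (proj_on Y u - proj_on Y v) <= norm2 (u - v).
Proof.
set p := proj_on Y u; set q := proj_on Y v.
have hu := proj_on_variational u (proj_on_in v).
have hv := proj_on_variational v (proj_on_in u).
rewrite -/p -/q in hu hv.
rewrite -ler_sqr ?nnegrE ?norm2_ge0//.
have -> : u - v = ((u - p) - (v - q)) + (p - q) by apply/rowP => j; rewrite !mxE; ring.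
rewrite [leRHS]norm2D_sq.
have := sqr_ge0 (norm2 (u - p - (v - q))).
have : inner (u - p - (v - q)) (p - q) = - inner (u - p) (q - p) - inner (v - q) (p - q).
  by rewrite !innerE; ring.
by lra.
Qed.

Lemma proj_on_le u y : Y y -> norm2 (proj_on Y u - y) <= norm2 (u - y).
Proof. by move=> Yy; rewrite -{1}(proj_on_id Yy) proj_on_nonexpansive. Qed.

End Projection.

Section Gradient.
Context {R : realType} {p : nat}.
Implicit Types (g : 'rV[R]_p -> R) (x h : 'rV[R]_p).

Lemma derive_grad g x h : differentiable g x -> 'D_h g x = inner (grad g x) h.
Proof.
move=> dg; rewrite deriveE// [in LHS](row_sum_delta h) linear_sum.
apply: eq_bigr => j _; rewrite linearZ/= mxE deriveE//.
by rewrite mulrC.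
Qed.

Lemma is_derive_line g x h (t : R) : differentiable g (x + t *: h) ->
  is_derive t 1 (fun s => g (x + s *: h)) (inner (grad g (x + t *: h)) h).
Proof.
move=> dg; have E : (fun s : R => s^-1 *: (g (x + (s *: 1 + t) *: h) - g (x + t *: h))) =
    (fun s => s^-1 *: (g (s *: h + (x + t *: h)) - g (x + t *: h))).
  apply/funext => s; congr (_ *: (g _ - _)).
  by rewrite scalerDl addrCA -scalerA scale1r.
have dr : derivable g (x + t *: h) h by exact: diff_derivable.
split; first by rewrite /derivable E.
by rewrite -derive_grad// /derive E.
Qed.

(** [grad] is a row of directional derivatives, so a two-sided quadratic expansion identifies it. It
    is meant for [Phi], about whose differentiability nothing is assumed. *)
Lemma grad_expansion g x (v : 'rV[R]_p) (M : R) :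
  (forall h, `|g (x + h) - g x - inner v h| <= M * norm2 h ^+ 2) -> grad g x = v.
Proof.
move=> gM; apply/rowP => j; rewrite mxE; set e := delta_mx 0 j.
have ve : inner v e = v 0 j.
  rewrite /inner (bigD1 j)//= mxE !eqxx mulr1 big1 ?addr0// => i ij.
  by rewrite mxE eqxx (negPf ij) mulr0.
rewrite -ve; apply: cvg_lim => //; apply/cvgrPdist_le => r r0.
have M0 : 0 < `|M| * norm2 e ^+ 2 + 1 by rewrite ltr_wpDl// mulr_ge0// sqr_ge0.
near=> s.
have s0 : s != 0 by near: s; exact: nbhs_dnbhs_neq.
have sr : `|s| <= r / (`|M| * norm2 e ^+ 2 + 1).
  near: s; apply: dnbhs0_le; rewrite divr_gt0//.
have -> : inner v e - s^-1 *: (g (s *: e + x) - g x) =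
    - s^-1 * (g (x + s *: e) - g x - inner v (s *: e)).
  by rewrite innerZr [s *: e + x]addrC /GRing.scale/=; field.
rewrite normrM normrN normfV mulrC ler_pdivrMr ?normr_gt0//.
rewrite (le_trans (gM _))// norm2Z_sq mulrCA.
move: sr; rewrite ler_pdivlMr// mulrDr mulr1 => sr.
rewrite -(@real_normK _ s) ?num_real// expr2 -mulrA [leRHS]mulrC.
rewrite ler_wpM2l// (le_trans _ sr)// ler_wpDr// ler_wpM2l//.
by rewrite ler_wpM2r ?sqr_ge0// ler_norm.
Unshelve. all: by end_near. Qed.

End Gradient.

(* [Gx] and [Gy] stand for the two partial gradients; only the x-derivative is
   needed as an actual derivative. *)
Section Objective.
Context {R : realType} {p d : nat}.
Variables (f : 'rV[R]_p -> 'rV[R]_d -> R).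
Variables (Gx : 'rV[R]_p -> 'rV[R]_d -> 'rV[R]_p) (Gy : 'rV[R]_p -> 'rV[R]_d -> 'rV[R]_d).
Variables (Y : set 'rV[R]_d) (mu L C : R).

Record minimax_objective : Prop := MinimaxObjective {
  mo_mu : 0 < mu;
  mo_L : 0 <= L;
  mo_closed : closed Y;
  mo_convex : convex_set Y;
  mo_nonempty : Y !=set0;
  mo_sc : forall x y y', Y y -> Y y' ->
    f x y - f x y' >= inner (Gy x y) (y - y') + mu / 2 * norm2 (y - y') ^+ 2;
  mo_lipx : forall x x' y y', Y y -> Y y' ->
    norm2 (Gx x y - Gx x' y') ^+ 2 <= L ^+ 2 * (norm2 (x - x') ^+ 2 + norm2 (y - y') ^+ 2);
  mo_derx : forall x h y (t : R), Y y ->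
    is_derive t (1 : R) (fun s : R => f (x + s *: h) y) (inner (Gx (x + t *: h) y) h);
  mo_bx : forall x y, Y y -> norm2 (Gx x y) <= C;
  mo_by : forall x y, Y y -> norm2 (Gy x y) <= C }.

Hypothesis mo : minimax_objective.

Let mu0 := mo_mu mo.
Let L0 := mo_L mo.

Lemma mo_C_ge0 : 0 <= C.
Proof.
by have [y Yy] := mo_nonempty mo; exact: le_trans (norm2_ge0 _) (mo_bx mo 0 Yy).
Qed.

Lemma lipx x x' y y' : Y y -> Y y' ->
  norm2 (Gx x y - Gx x' y') <= L * (norm2 (x - x') + norm2 (y - y')).
Proof.
move=> Yy Yy'; rewrite -ler_sqr ?nnegrE ?mulr_ge0 ?addr_ge0 ?norm2_ge0//.
rewrite (le_trans (mo_lipx mo _ _ Yy Yy'))// exprMn ler_wpM2l ?sqr_ge0//.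
rewrite sqrrD lerD2r lerDl mulrn_wge0// mulr_ge0 ?norm2_ge0//.
Qed.

(** With [r] the distance, adding strong concavity at [y] and at [y'] gives [mu * r^2 <= 2 * C * r]:
    strong concavity with bounded gradients forces [Y] to be bounded. *)
Lemma diam_Y y y' : Y y -> Y y' -> norm2 (y - y') <= 2 * C / mu.
Proof.
move=> Yy Yy'; rewrite ler_pdivlMr// mulrC.
have h1 := mo_sc mo 0 Yy Yy'; have h2 := mo_sc mo 0 Yy' Yy.
have C0 := mo_C_ge0.
have [->|r0] := eqVneq (norm2 (y - y')) 0; first by rewrite mulr0 mulr_ge0.
have {}r0 : 0 < norm2 (y - y') by rewrite lt_def r0 norm2_ge0.
have i1 := inner_abs (Gy 0 y) (y - y'); have i2 := inner_abs (Gy 0 y') (y' - y).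
rewrite norm2BC in h2; rewrite (norm2BC y') in i2.
have b1 := mo_by mo 0 Yy; have b2 := mo_by mo 0 Yy'.
have c1 : norm2 (Gy 0 y) * norm2 (y - y') <= C * norm2 (y - y') by rewrite ler_wpM2r// ltW.
have c2 : norm2 (Gy 0 y') * norm2 (y - y') <= C * norm2 (y - y') by rewrite ler_wpM2r// ltW.
rewrite -(ler_pM2r r0).
move: i1 i2; rewrite !ler_norml => /andP[i1 _] /andP[i2 _].
by move: h1 h2 c1 c2 i1 i2; rewrite expr2; lra.
Qed.

Local Notation ystar x := (argmax_on Y (f x)).

(** Strong concavity read in both directions, without its quadratic term, makes [f x] Lipschitz with
    constant [C] on the compact set [Y]. *)
Lemma argmaxP x : Y (ystar x) /\ forall y, Y y -> f x y <= f x (ystar x).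
Proof.
have fc : {within Y, continuous (f x)}.
  apply: (@within_lipschitz _ _ _ _ C) => y y' Yy Yy'; rewrite ler_norml.
  have aux u v : Y u -> Y v -> - (C * norm2 (u - v)) <= f x u - f x v.
    move=> Yu Yv; apply: le_trans (mo_sc mo x Yu Yv).
    have := inner_abs (Gy x u) (u - v); rewrite ler_norml => /andP[+ _].
    have : norm2 (Gy x u) * norm2 (u - v) <= C * norm2 (u - v).
      by rewrite ler_wpM2r ?norm2_ge0// (mo_by mo).
    have : 0 <= mu / 2 * norm2 (u - v) ^+ 2 by rewrite mulr_ge0 ?sqr_ge0// divr_ge0// ltW.
    by lra.
  by have := aux _ _ Yy Yy'; have := aux _ _ Yy' Yy; rewrite (norm2BC y'); lra.
have [c /set_mem Yc cmax] :=
  compact_EVT_max (mo_nonempty mo) (compact_bounded2 (mo_closed mo) diam_Y) fc.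
have h : [set y | Y y /\ forall y', Y y' -> f x y' <= f x y] !=set0.
  by exists c; split => // y Yy; apply: cmax; rewrite inE.
by have [] := xgetPex 0 h.
Qed.

Lemma argmax_in x : Y (ystar x). Proof. by have [] := argmaxP x. Qed.

Lemma PhiE x : Phi Y f x = f x (ystar x). Proof. by []. Qed.

(** Strong concavity at the midpoint [m] towards both ends: the linear terms cancel and
    [f x m <= f x q]. This avoids a first-order optimality condition at the boundary of [Y], with
    [mu / 4] instead of [mu / 2]. *)
Lemma quadratic_growth x y : Y y ->
  mu / 4 * norm2 (y - ystar x) ^+ 2 <= f x (ystar x) - f x y.
Proof.
move=> Yy; have [Yq qmax] := argmaxP x; set q := ystar x in Yq qmax *.
set m := (1/2) *: y + (1 - 1/2) *: q.
have Ym : Y m by apply: convex_setP => //; [exact: mo_convex mo|lra].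
have h1 := mo_sc mo x Ym Yy; have h2 := mo_sc mo x Ym Yq; have h3 := qmax _ Ym.
have E1 : m - y = (-1/2) *: (y - q) by apply/rowP => j; rewrite !mxE; field.
have E2 : m - q = (1/2) *: (y - q) by apply/rowP => j; rewrite !mxE; field.
move: h1 h2; rewrite E1 E2 !innerZr !norm2Z_sq.
by move: (inner _ _) (norm2 _ ^+ 2) => a b; lra.
Qed.

Lemma ascent_direction x y : Y y ->
  inner (Gy x y) (y - ystar x) <= - (mu / 2) * norm2 (y - ystar x) ^+ 2.
Proof.
move=> Yy; have [Yq qmax] := argmaxP x.
by have := mo_sc mo x Yy Yq; have := qmax _ Yy; lra.
Qed.

Lemma line_mvt (g : R -> R) (dg : R -> R) : (forall t : R, is_derive t (1 : R) g (dg t)) ->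
  exists t, [/\ 0 <= t, t <= 1 & g 1 - g 0 = dg t].
Proof.
move=> gd; have c : {within `[0, 1], continuous g}.
  apply: continuous_subspaceT => t.
  by apply: differentiable_continuous; apply/derivable1_diffP; have [] := gd t.
have [t] := @MVT_segment R g dg 0 1 ler01 (fun t _ => gd t) c.
rewrite in_itv/= subr0 mulr1 => /andP[t0 t1] gE; by exists t.
Qed.

Lemma f_quad x h y : Y y ->
  `|f (x + h) y - f x y - inner (Gx x y) h| <= L * norm2 h ^+ 2.
Proof.
move=> Yy; have [t [t0 t1]] := line_mvt (fun t => mo_derx mo x h t Yy).
rewrite scale1r scale0r addr0 => ->.
rewrite -innerNl -innerDl (le_trans (inner_abs _ _))// expr2 mulrA.
rewrite ler_wpM2r ?norm2_ge0// (le_trans (lipx _ _ Yy Yy))// subrr norm20 addr0.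
rewrite ler_wpM2l// addrAC subrr add0r norm2Z ger0_norm//.
by rewrite ler_piMl ?norm2_ge0.
Qed.

(** The mean value theorem along the segment from [x'] to [x], applied to the difference of the
    values at [y] and [y']; the x-gradient is Lipschitz in [y]. *)
Lemma mixed_difference x x' y y' : Y y -> Y y' ->
  f x y - f x y' - (f x' y - f x' y') <= L * norm2 (x - x') * norm2 (y - y').
Proof.
move=> Yy Yy'; set h := x - x'.
have D (t : R) : is_derive t (1 : R) (fun s : R => f (x' + s *: h) y - f (x' + s *: h) y')
    (inner (Gx (x' + t *: h) y - Gx (x' + t *: h) y') h).
  rewrite innerDl innerNl; have dd1 := mo_derx mo x' h t Yy.
  by have dd2 := mo_derx mo x' h t Yy'; exact: is_deriveB.
have [t [t0 t1]] := line_mvt D.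
rewrite scale1r scale0r addr0 (_ : x' + h = x); last by rewrite addrC subrK.
move=> ->.
rewrite (le_trans (inner_le _ _))// mulrAC.
rewrite ler_wpM2r ?norm2_ge0// (le_trans (lipx _ _ Yy Yy'))//.
by rewrite subrr norm20 add0r.
Qed.

(** With [r] the distance of the maximisers, adding the quadratic growth at [x] and at [x'] yields
    [mu / 2 * r^2] on one side and a mixed difference, at most [L * |x - x'| * r], on the other. *)
Lemma argmax_lipschitz x x' :
  norm2 (ystar x - ystar x') <= 2 * L / mu * norm2 (x - x').
Proof.
set r := norm2 (_ - _); have r_ge0 : 0 <= r by exact: norm2_ge0.
have [->|r0] := eqVneq r 0.
  by rewrite mulr_ge0 ?norm2_ge0// divr_ge0 ?mulr_ge0// ltW.
have {}r0 : 0 < r by rewrite lt_def r0.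
have h1 := quadratic_growth x (argmax_in x').
have h2 := quadratic_growth x' (argmax_in x).
have h3 := mixed_difference x x' (argmax_in x) (argmax_in x').
rewrite norm2BC -/r in h1; rewrite -/r in h2; rewrite -/r in h3.
rewrite mulrAC ler_pdivlMr// -(ler_pM2r r0).
by move: h1 h2 h3; rewrite expr2; lra.
Qed.

Lemma argmax_lipschitz_sq x x' :
  norm2 (ystar x - ystar x') ^+ 2 <= (2 * L / mu) ^+ 2 * norm2 (x - x') ^+ 2.
Proof. by rewrite -exprMn le_sqr ?norm2_ge0// argmax_lipschitz. Qed.

Definition gradPhi x := Gx x (ystar x).

(** [L] is the remainder of [f] in [x] at a fixed maximiser; [2 * L^2 / mu] is [L] times the
    Lipschitz constant of the maximiser. *)
Definition PhiL := L + 2 * L ^+ 2 / mu.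

Lemma PhiL_ge0 : 0 <= PhiL.
Proof. by rewrite addr_ge0// divr_ge0 ?mulr_ge0 ?sqr_ge0// ltW. Qed.

(** Envelope argument: each maximiser is suboptimal at the other point, so the increment of [Phi]
    lies between the increments of [f] at fixed [y1] and at fixed [y2]. *)
Lemma Phi_quad x h :
  `|Phi Y f (x + h) - Phi Y f x - inner (gradPhi x) h| <= PhiL * norm2 h ^+ 2.
Proof.
have [Y1 m1] := argmaxP x; have [Y2 m2] := argmaxP (x + h).
have := f_quad x h Y1; have := f_quad x h Y2.
have := m1 _ Y2; have := m2 _ Y1; rewrite !PhiE /gradPhi.
set y1 := ystar x in Y1 m1 *; set y2 := ystar (x + h) in Y2 m2 *.
have dy : norm2 (y2 - y1) <= 2 * L / mu * norm2 h.
  by have := argmax_lipschitz (x + h) x; rewrite addrAC subrr add0r.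
have : inner (Gx x y2) h - inner (Gx x y1) h <= 2 * L ^+ 2 / mu * norm2 h ^+ 2.
  rewrite -innerNl -innerDl (le_trans (inner_le _ _))//.
  have -> : 2 * L ^+ 2 / mu * norm2 h ^+ 2 = L * (2 * L / mu * norm2 h) * norm2 h by ring.
  rewrite ler_wpM2r ?norm2_ge0// (le_trans (lipx _ _ Y2 Y1))//.
  by rewrite subrr norm20 add0r ler_wpM2l.
have : 0 <= 2 * L ^+ 2 / mu * norm2 h ^+ 2.
  by rewrite mulr_ge0 ?sqr_ge0// divr_ge0 ?mulr_ge0 ?sqr_ge0// ltW.
rewrite /PhiL mulrDl !ler_norml => ? ? ? ? /andP[? ?] /andP[? ?].
by apply/andP; split; lra.
Qed.

Lemma grad_Phi x : grad (Phi Y f) x = gradPhi x.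
Proof. by apply: (grad_expansion (M := PhiL)) => h; exact: Phi_quad. Qed.

Lemma gradPhi_bound x : norm2 (gradPhi x) <= C.
Proof. exact: (mo_bx mo x (argmax_in x)). Qed.

Lemma gradPhi_lipschitz x x' :
  norm2 (gradPhi x - gradPhi x') <= L * (1 + 2 * L / mu) * norm2 (x - x').
Proof.
rewrite (le_trans (lipx _ _ (argmax_in x) (argmax_in x')))//.
by rewrite -mulrA ler_wpM2l// mulrDl mul1r lerD2l argmax_lipschitz.
Qed.

End Objective.

(** * Powers and sums *)

Section Powers.
Context {R : realType}.
Implicit Types (x y v V a b c T : R).

Lemma powR_le x y a : 0 <= a -> 0 <= x -> x <= y -> x `^ a <= y `^ a.
Proof. by move=> a0 x0 xy; rewrite ge0_ler_powR ?nnegrE// (le_trans x0). Qed.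

Lemma powR_le_oppr x y a : a <= 0 -> 0 < x -> x <= y -> y `^ a <= x `^ a.
Proof.
move=> a0 x0 xy; rewrite -[a]opprK !(powRN _ (- a)) lef_pV2 ?posrE ?powR_gt0//.
  by rewrite powR_le ?oppr_ge0// ltW.
exact: lt_le_trans xy.
Qed.

(** [(y / x)^a <= y / x] since [y / x >= 1]. It turns relative changes of the stepsize powers into
    relative changes of the accumulators. *)
Lemma powR_ratio x y a : a <= 1 -> 0 < x -> x <= y -> y `^ a * x <= x `^ a * y.
Proof.
move=> a1 x0 xy; have yx : 1 <= y / x by rewrite ler_pdivlMr// mul1r.
have yE : y `^ a = (y / x) `^ a * x `^ a.
  by rewrite -powRM ?(ltW x0) ?(le_trans ler01 yx)// divfK// gt_eqF.
have := ler1_powR yx a1; rewrite ler_pdivlMr// => h.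
by rewrite yE mulrAC mulrC ler_wpM2l// powR_ge0.
Qed.

(* [tau] is the ratio of the local to the mean stepsize. *)
Lemma stepsize_ratio v V a T : 0 <= a -> a <= 1 -> 0 < v -> 0 < V -> 1 <= T ->
  v `^ (- a) <= T * V `^ (- a) ->
  let tau := v `^ (- a) * V `^ a in
  [/\ 0 <= tau, tau <= T & (tau - 1) ^+ 2 <= T ^+ 2 * (`|v - V| / V)].
Proof.
move=> a0 a1 v0 V0 T1; rewrite !powRN => vT tau.
have va := powR_gt0 a v0; have Va := powR_gt0 a V0.
have tau0 : 0 <= tau by rewrite mulr_ge0 ?invr_ge0// ltW.
have tauT : tau <= T.
  have := ler_wpM2r (ltW Va) vT; rewrite mulfVK ?gt_eqF//.
split => //.
have tauE : tau = V `^ a / v `^ a by rewrite /tau mulrC.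
have T2 : 1 <= T ^+ 2 by rewrite expr_ge1// (le_trans ler01).
(* If [V <= v] then [V / v <= tau <= 1], hence [(tau - 1)^2 <= 1 - tau <= (v - V) / V]. *)
have [Vv|vV] := leP V v.
  have h := powR_ratio a1 V0 Vv.
  have t1 : tau <= 1 by rewrite tauE ler_pdivrMr// mul1r powR_le// ltW.
  have tV : V <= tau * v.
    by rewrite tauE mulrAC ler_pdivlMr// mulrC.
  rewrite ger0_norm ?subr_ge0// mulrA ler_pdivlMr//.
  have h1 : (tau - 1) ^+ 2 <= 1 - tau by nra.
  have h2 : (1 - tau) * V <= v - V by nra.
  have h3 : (tau - 1) ^+ 2 * V <= (1 - tau) * V by rewrite ler_wpM2r// ltW.
  have h4 : v - V <= T ^+ 2 * (v - V) by rewrite ler_peMl// subr_ge0.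
  by lra.
(* If [v < V] then [tau - 1 = tau * (1 - q)] with [q = 1 / tau >= v / V]; the factor [tau^2] is paid
   by [tau <= T]. *)
have h := powR_ratio a1 v0 (ltW vV).
rewrite ltr0_norm ?subr_lt0// opprB mulrA ler_pdivlMr//.
set q := v `^ a / V `^ a.
have q0 : 0 <= q by rewrite divr_ge0 ?ltW.
have q1 : q <= 1 by rewrite ler_pdivrMr// mul1r powR_le// ltW.
have qV : v <= q * V by rewrite /q mulrAC ler_pdivlMr// mulrC.
have -> : tau - 1 = tau * (1 - q).
  by rewrite tauE /q; field; rewrite !gt_eqF.
rewrite exprMn -mulrA; apply: ler_pM; rewrite ?sqr_ge0//.
- by rewrite mulr_ge0 ?sqr_ge0// ltW.
- by rewrite le_sqr.
have : (1 - q) ^+ 2 <= 1 - q by nra.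
by move=> /(ler_wpM2r (ltW V0)); lra.
Qed.

(** Adding both ends covers either sign of the exponent; it is needed for [1 - 2 * beta]. *)
Lemma powR_between x y z a : 0 < x -> x <= z -> z <= y -> z `^ a <= x `^ a + y `^ a.
Proof.
move=> x0 xz zy; have z0 : 0 < z by exact: lt_le_trans xz.
have [a0|a0] := leP 0 a.
  by rewrite ler_wpDl ?powR_ge0// powR_le// ltW.
by rewrite ler_wpDr ?powR_ge0// powR_le_oppr// ltW.
Qed.

Lemma powR_sum_exp x a b c : 0 < x -> a + b = c -> x `^ a * x `^ b = x `^ c.
Proof. by move=> x0 <-; rewrite powRD//; apply/implyP => _; rewrite gt_eqF. Qed.

Lemma powR_small (e r c : R) : 0 < r -> 0 < c -> 0 < e ->
  exists2 M, 0 <= M & forall V, c <= V -> (V `^ (- r)) ^+ 2 <= e + M / V.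
Proof.
move=> r0 c0 e0; set q := r * 2.
have q0 : 0 < q by rewrite mulr_gt0.
have sqE V : (V `^ (- r)) ^+ 2 = (V `^ q)^-1.
  by rewrite -powR_mulrn ?powR_ge0// -powRrM mulNr powRN.
(* The threshold above which [V^(-q) <= e]. Below it [V^(-q) <= c^(-q)] and [Vs / V >= 1], whence
   the choice of [M]. *)
set Vs := (e^-1) `^ q^-1.
exists ((c `^ q)^-1 * Vs); first by rewrite mulr_ge0 ?invr_ge0 ?powR_ge0.
move=> V cV; have V0 : 0 < V by exact: lt_le_trans cV.
rewrite sqE; have [VsV|VVs] := leP Vs V.
  rewrite ler_wpDr//; first by rewrite divr_ge0 ?mulr_ge0 ?invr_ge0 ?powR_ge0 ?ltW.
  rewrite -[leRHS]invrK lef_pV2 ?posrE ?powR_gt0 ?invr_gt0//.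
  have -> : e^-1 = Vs `^ q.
    by rewrite -powRrM mulVf ?gt_eqF// powRr1// invr_ge0 ltW.
  by rewrite powR_le ?powR_ge0// ltW.
rewrite ler_wpDl ?(ltW e0)// -mulrA.
apply: (@le_trans _ _ (c `^ q)^-1).
  by rewrite lef_pV2 ?posrE ?powR_gt0// powR_le// ltW.
by rewrite ler_peMr ?invr_ge0 ?powR_ge0// ler_pdivlMr// mul1r ltW.
Qed.

End Powers.

Section Sums.
Context {R : realType}.
Implicit Types (X h b phi P : nat -> R) (s M : R) (K : nat).

(** Each term is at most [ln X_{k+1} - ln X_k], by [ln (1 - t) <= - t]. Every logarithm of the final
    rate comes from here. *)
Lemma sum_log X h K : 0 < X 0%N -> (forall k, 0 <= h k) ->
  (forall k, X k.+1 = X k + h k) ->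
  \sum_(k < K) h k / X k.+1 <= ln (X K) - ln (X 0%N).
Proof.
move=> X0 h0 XS; have Xp k : 0 < X k by elim: k => // k IH; rewrite XS ltr_wpDr.
elim: K => [|K IH]; first by rewrite big_ord0 subrr.
have E : 1 + - (h K / X K.+1) = X K / X K.+1.
  rewrite -[X in X - _](divff (lt0r_neq0 (Xp K.+1))) -mulrBl.
  by rewrite [X in (X - _) / _]XS addrK.
have : ln (1 + - (h K / X K.+1)) <= - (h K / X K.+1).
  by apply: le_ln1Dx; rewrite -subr_gt0 opprK addrC E divr_gt0.
rewrite E lnM ?posrE ?invr_gt0// lnV ?posrE// big_ord_recr/=.
by move: IH; lra.
Qed.

Lemma sum_abel b phi M K : (forall k, 0 <= b k) -> (forall k, b k <= b k.+1) ->
  (forall k, 0 <= phi k) -> (forall k, phi k <= M) ->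
  \sum_(k < K) b k * (phi k - phi k.+1) <= M * b K.
Proof.
move=> b0 bS p0 pM.
(* The induction needs the slack [M - phi K >= 0], at which each increase of the weight is
   charged. *)
suff : \sum_(k < K) b k * (phi k - phi k.+1) <= b K * (M - phi K).
  move=> /le_trans; apply; rewrite mulrBr mulrC gerBl mulr_ge0//.
elim: K => [|K IH]; first by rewrite big_ord0 mulr_ge0// subr_ge0.
rewrite big_ord_recr/=.
have : b K * (M - phi K.+1) <= b K.+1 * (M - phi K.+1) by rewrite ler_wpM2r// subr_ge0.
by lra.
Qed.

Lemma sum_contraction P b s K : (forall k, 0 <= P k) ->
  (forall k, P k.+1 <= (1 - s) * P k + b k) ->
  s * \sum_(k < K) P k <= P 0%N + \sum_(k < K) b k.
Proof.
move=> P0 PS; suff : s * (\sum_(k < K) P k) + P K <= P 0%N + \sum_(k < K) b k.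
  by move=> /(le_trans _); apply; rewrite lerDl.
elim: K => [|K IH]; first by rewrite !big_ord0 mulr0 add0r addr0.
by rewrite !big_ord_recr/= mulrDr; have := PS K; lra.
Qed.

Lemma contraction_bound P s M : 0 < s -> s <= 1 -> 0 <= M -> P 0%N <= M / s ->
  (forall k, P k.+1 <= (1 - s) * P k + M) -> forall k, P k <= M / s.
Proof.
move=> s0 s1 M0 P0 PS; elim=> // k IH; rewrite (le_trans (PS k))//.
have : (1 - s) * P k <= (1 - s) * (M / s) by rewrite ler_wpM2l// subr_ge0.
have : s * (M / s) = M by rewrite mulrC divfK// gt_eqF.
by lra.
Qed.

Lemma sum_combination (a b c : R) (f g h : nat -> R) K :
  \sum_(k < K) (- a * f k - b * g k + c * h k) =
  - a * (\sum_(k < K) f k) - b * (\sum_(k < K) g k) + c * (\sum_(k < K) h k).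
Proof.
elim: K => [|K IH]; first by rewrite !big_ord0; ring.
by rewrite !big_ord_recr/= IH; ring.
Qed.

(** Closes the loop between the squared gradients [SG], the gradient gap [G], the tracking error
    [SE] and the averaging error [SW]. Eliminating [SE] gives [G <= g * SW + h]; since
    [g * d <= 1 / 10], substituting into the bound for [SW] returns [SW] with coefficient at most
    [14 / 30 < 1 / 2], which is absorbed at the cost of a factor 2. *)
Lemma absorb (SG SE SW SP G r4 r5 r6 g1 g2 g3 e1 d g : R) :
  g = g2 * e1 + g3 ->
  0 <= g1 -> 0 <= g2 -> 0 <= g3 -> 0 <= e1 -> 0 <= SW -> 0 <= d ->
  d * (10 * (g + 1)) = 1 ->
  G <= g1 * SP + g2 * SE + g3 * SW ->
  SG <= 8 / 3 * (1 / 2 * G + r4) ->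
  SE <= e1 * SW + r6 ->
  SW <= d * (2 * SG + 2 * G) + r5 ->
  SG <= (8 / 3 + 128 / 9 * (g * d)) * r4 + 8 / 3 * g * r5
    + 4 / 3 * (1 + 28 / 3 * (g * d)) * g2 * r6 + 4 / 3 * (1 + 28 / 3 * (g * d)) * g1 * SP.
Proof.
move=> gE g10 g20 g30 e10 SW0 d0 dE hG hSG hSE hSW.
have g0 : 0 <= g by rewrite gE addr_ge0 ?mulr_ge0.
have gd : g * d <= 1 / 10 by nra.
have gd0 : 0 <= g * d by rewrite mulr_ge0.
have h1 := ler_wpM2l g20 hSE.
set h := g1 * SP + g2 * r6.
have G1 : G <= g * SW + h by rewrite gE /h; lra.
have h2 : 2 * SG + 2 * G <= 14 / 3 * G + 16 / 3 * r4 by lra.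
have h3 := ler_wpM2l d0 h2; have h4 := ler_wpM2l d0 G1.
have h5 : d * g * SW <= 1 / 10 * SW by rewrite (mulrC d) ler_wpM2r.
have h6 : SW <= 2 * (14 / 3 * (d * h) + 16 / 3 * (d * r4) + r5) by lra.
have h7 := ler_wpM2l g0 h6.
have -> : (8 / 3 + 128 / 9 * (g * d)) * r4 + 8 / 3 * g * r5
    + 4 / 3 * (1 + 28 / 3 * (g * d)) * g2 * r6 + 4 / 3 * (1 + 28 / 3 * (g * d)) * g1 * SP =
  8 / 3 * r4 + 4 / 3 * (g * (2 * (14 / 3 * (d * h) + 16 / 3 * (d * r4) + r5)) + h).
  by rewrite /h; field.
by move: hSG G1 h7; lra.
Qed.

End Sums.

(** * Estimates along one trajectory *)

Lemma row_diag_powR (R : realType) n m (v : 'cV[R]_n) (a : R) (G : 'M[R]_(n, m)) i :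
  row i (diag_powR v a *m G) = (v i 0 `^ a) *: row i G.
Proof. by rewrite /diag_powR mul_diag_mx; apply/rowP => j; rewrite !mxE. Qed.

Lemma row_sq_row_norms (R : realType) n m (G : 'M[R]_(n, m)) i :
  sq_row_norms G i 0 = norm2 (row i G) ^+ 2.
Proof. by rewrite mxE. Qed.

Lemma avgD (R : realType) n (u v : 'cV[R]_n) : avg (u + v) = avg u + avg v.
Proof.
rewrite /avg -mulrDr -big_split; congr (_ * _).
by apply: eq_bigr => i _; rewrite mxE.
Qed.

Lemma avg_const (R : realType) n (a : R) : (0 < n)%N -> avg (const_mx a : 'cV[R]_n) = a.
Proof.
move=> n0; rewrite /avg; under eq_bigr do rewrite mxE.
by rewrite sumr_const card_ord -[X in _ * X]mulr_natl mulKf// pnatr_eq0 -lt0n.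
Qed.

Lemma avg_le (R : realType) n (u v : 'cV[R]_n) :
  (forall i, u i 0 <= v i 0) -> avg u <= avg v.
Proof. by move=> uv; rewrite ler_wpM2l ?invr_ge0// ler_sum. Qed.

Definition mean_field (R : realType) n p d m
    (G : 'I_n -> 'rV[R]_p -> 'rV[R]_d -> 'rV[R]_m) x y := n%:R^-1 *: \sum_i G i x y.

Section Trajectory.
Context {R : realType} {n p d : nat}.
Variables (f : 'rV[R]_p -> 'rV[R]_d -> R).
Variables (Gx : 'I_n -> 'rV[R]_p -> 'rV[R]_d -> 'rV[R]_p).
Variables (Gy : 'I_n -> 'rV[R]_p -> 'rV[R]_d -> 'rV[R]_d).
Variables (Y : set 'rV[R]_d) (mu L C : R) (W : 'M[R]_n).
Variables (alpha beta gx gy c T : R).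
Variables (st : nat -> @state R n p d) (gX : nat -> 'M[R]_(n, p)) (gY : nat -> 'M[R]_(n, d)).

Record dadast_path : Prop := DadastPath {
  tr_n0 : (0 < n)%N;
  tr_mo : minimax_objective f (mean_field Gx) (mean_field Gy) Y mu L C;
  tr_lipx : forall i x x' y y', Y y -> Y y' -> norm2 (Gx i x y - Gx i x' y') ^+ 2 <=
    L ^+ 2 * (norm2 (x - x') ^+ 2 + norm2 (y - y') ^+ 2);
  tr_lipy : forall i x x' y y', Y y -> Y y' -> norm2 (Gy i x y - Gy i x' y') ^+ 2 <=
    L ^+ 2 * (norm2 (x - x') ^+ 2 + norm2 (y - y') ^+ 2);
  tr_W : doubly_stochastic W;
  tr_rho : rhoW W < 1;
  tr_c : 0 < c;
  tr_beta : 0 < beta;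
  tr_beta_alpha : beta < alpha;
  tr_alpha : alpha < 1;
  tr_gx : 0 < gx;
  tr_gy : 0 < gy;
  tr_gX : forall k i, norm2 (row i (gX k)) <= C;
  tr_gY : forall k i, norm2 (row i (gY k)) <= C;
  tr_st : forall k, st k.+1 = dadast_step W Y alpha beta gx gy (gX k) (gY k) (st k);
  tr_mx0 : st_mx (st 0) = const_mx c;
  tr_my0 : st_my (st 0) = const_mx c;
  tr_y0 : forall i, Y (row i (st_y (st 0))) }.

(** Separate from [dadast_path] because it holds only almost surely. It keeps the upper half of the
    relative deviation; the index [k.+1] matches the supremum over positive times. *)
Record stepsize_consistent : Prop := StepsizeConsistent {
  tr_T : 1 <= T;
  tr_zv : forall k i, st_v (st k.+1) i 0 `^ (- alpha) <= T * avg (st_v (st k.+1)) `^ (- alpha);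
  tr_zu : forall k i, st_u (st k.+1) i 0 `^ (- beta) <= T * avg (st_u (st k.+1)) `^ (- beta) }.

Hypothesis tr : dadast_path.

Let n0 := tr_n0 tr.
Let mo := tr_mo tr.
Let dW := tr_W tr.
Let c0 := tr_c tr.
Let b0 := tr_beta tr.
Let ba := tr_beta_alpha tr.
Let a1 := tr_alpha tr.
Let gx0 := tr_gx tr.
Let gy0 := tr_gy tr.
Local Notation s := (gap W).
Let s0 : 0 < s := gap_gt0 (tr_rho tr).
Let s1 : s <= 1 := gap_le1 W.
Let a0 : 0 < alpha := lt_trans b0 ba.
Let b1 : beta < 1 := lt_trans ba a1.
Let C0 : 0 <= C := mo_C_ge0 mo.
Let nV0 : 0 < n%:R^-1 :> R.
Proof. by rewrite invr_gt0 ltr0n. Qed.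
Let nR0 : 0 < n%:R :> R.
Proof. by rewrite ltr0n. Qed.
Let nVn : n%:R^-1 * n%:R = 1 :> R.
Proof. by rewrite mulVf// gt_eqF. Qed.

(** * Averaged accumulators and their consensus errors *)

Definition xr k i := row i (st_x (st k)).
Definition yr k i := row i (st_y (st k)).
Definition gxr k i := row i (gX k).
Definition gyr k i := row i (gY k).
Definition xb k := avg_row (st_x (st k)).
Definition yb k := avg_row (st_y (st k)).
Definition hx k := n%:R^-1 * \sum_i norm2 (gxr k i) ^+ 2.
Definition hy k := n%:R^-1 * \sum_i norm2 (gyr k i) ^+ 2.
Definition Xm k := avg (st_mx (st k)).
Definition Um k := avg (st_my (st k)).
(** The maximum of the averages, not the average of the maxima: [Xm] and [Um] satisfy exact
    recursions, so [Vm] is monotone with increments at most [C^2]. *)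
Definition Vm k := Num.max (Xm k) (Um k).
Definition ub k := Um k `^ beta.
Definition vb k := Vm k `^ alpha.
Definition Pk k := frob (dev (st_x (st k))).
Definition Qk k := frob (dev (st_y (st k))).

Lemma yr_in k i : Y (yr k i).
Proof.
case: k => [|k]; first exact: (tr_y0 tr).
rewrite /yr (tr_st tr)/= rowK; apply: proj_on_in; [exact: mo_closed mo| |].
  exact: mo_nonempty mo.
exact: diam_Y mo.
Qed.

Lemma yb_in k : Y (yb k).
Proof. by apply: convex_avg => //; [exact: mo_convex mo|exact: yr_in]. Qed.

Lemma hx_ge0 k : 0 <= hx k.
Proof. by rewrite mulr_ge0// sumr_ge0// => i _; exact: sqr_ge0. Qed.

Lemma hy_ge0 k : 0 <= hy k.
Proof. by rewrite mulr_ge0// sumr_ge0// => i _; exact: sqr_ge0. Qed.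

Lemma sum_hx k : \sum_i norm2 (gxr k i) ^+ 2 = n%:R * hx k.
Proof. by rewrite mulrA divff ?mul1r// gt_eqF. Qed.

Lemma sum_hy k : \sum_i norm2 (gyr k i) ^+ 2 = n%:R * hy k.
Proof. by rewrite mulrA divff ?mul1r// gt_eqF. Qed.

Lemma sum_n (x : R) : \sum_(i < n) x = n%:R * x.
Proof. by rewrite sumr_const card_ord mulr_natl. Qed.

Lemma hx_le k : hx k <= C ^+ 2.
Proof.
rewrite -(ler_pM2l nR0) -sum_hx -sum_n; apply: ler_sum => i _.
by rewrite le_sqr ?norm2_ge0 ?(tr_gX tr).
Qed.

Lemma hy_le k : hy k <= C ^+ 2.
Proof.
rewrite -(ler_pM2l nR0) -sum_hy -sum_n; apply: ler_sum => i _.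
by rewrite le_sqr ?norm2_ge0 ?(tr_gY tr).
Qed.

Lemma avg_sq_row_norms m (G : 'M[R]_(n, m)) :
  avg (sq_row_norms G) = n%:R^-1 * \sum_i norm2 (row i G) ^+ 2.
Proof. by congr (_ * _); apply: eq_bigr => i _; rewrite row_sq_row_norms. Qed.

Lemma XmS k : Xm k.+1 = Xm k + hx k.
Proof. by rewrite /Xm (tr_st tr)/= avg_stochastic// avgD avg_sq_row_norms. Qed.

Lemma UmS k : Um k.+1 = Um k + hy k.
Proof. by rewrite /Um (tr_st tr)/= avg_stochastic// avgD avg_sq_row_norms. Qed.

Lemma Xm0 : Xm 0 = c. Proof. by rewrite /Xm (tr_mx0 tr) avg_const. Qed.
Lemma Um0 : Um 0 = c. Proof. by rewrite /Um (tr_my0 tr) avg_const. Qed.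

Lemma Xm_ge k : c <= Xm k.
Proof.
by elim: k => [|k IH]; rewrite ?Xm0// XmS (le_trans IH)// lerDl hx_ge0.
Qed.

Lemma Um_ge k : c <= Um k.
Proof.
by elim: k => [|k IH]; rewrite ?Um0// UmS (le_trans IH)// lerDl hy_ge0.
Qed.

Lemma Xm_gt0 k : 0 < Xm k. Proof. exact: lt_le_trans c0 (Xm_ge k). Qed.
Lemma Um_gt0 k : 0 < Um k. Proof. exact: lt_le_trans c0 (Um_ge k). Qed.

Lemma Xm_upper k : Xm k <= c + C ^+ 2 * k%:R.
Proof.
elim: k => [|k IH]; first by rewrite Xm0 mulr0 addr0.
by rewrite XmS -natr1 mulrDr mulr1 addrA lerD// hx_le.
Qed.

Lemma Um_upper k : Um k <= c + C ^+ 2 * k%:R.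
Proof.
elim: k => [|k IH]; first by rewrite Um0 mulr0 addr0.
by rewrite UmS -natr1 mulrDr mulr1 addrA lerD// hy_le.
Qed.

Lemma Xm_le_Vm k : Xm k <= Vm k. Proof. by rewrite le_max lexx. Qed.
Lemma Um_le_Vm k : Um k <= Vm k. Proof. by rewrite le_max lexx orbT. Qed.
Lemma Vm_ge k : c <= Vm k. Proof. exact: le_trans (Xm_ge k) (Xm_le_Vm k). Qed.
Lemma Vm_gt0 k : 0 < Vm k. Proof. exact: lt_le_trans c0 (Vm_ge k). Qed.
Lemma Vm_upper k : Vm k <= c + C ^+ 2 * k%:R.
Proof. by rewrite ge_max Xm_upper Um_upper. Qed.

Lemma Um_mono k : Um k <= Um k.+1. Proof. by rewrite UmS lerDl hy_ge0. Qed.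
Lemma Vm_mono k : Vm k <= Vm k.+1.
Proof.
rewrite ge_max !le_max XmS UmS; apply/andP; split; apply/orP.
  by left; rewrite lerDl hx_ge0.
by right; rewrite lerDl hy_ge0.
Qed.

Lemma VmS_le k : Vm k.+1 <= Vm k + C ^+ 2.
Proof.
rewrite ge_max XmS UmS; apply/andP; split; apply: lerD; rewrite ?hx_le ?hy_le//.
  exact: Xm_le_Vm.
exact: Um_le_Vm.
Qed.

Lemma ub_gt0 k : 0 < ub k. Proof. by rewrite powR_gt0 ?Um_gt0. Qed.
Lemma vb_gt0 k : 0 < vb k. Proof. by rewrite powR_gt0 ?Vm_gt0. Qed.
Lemma ub_mono k : ub k <= ub k.+1.
Proof. by rewrite powR_le ?Um_mono// ltW// Um_gt0. Qed.
Lemma vb_mono k : vb k <= vb k.+1.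
Proof. by rewrite powR_le ?Vm_mono// ltW// Vm_gt0. Qed.

Lemma m_ge k i : c <= st_mx (st k) i 0 /\ c <= st_my (st k) i 0.
Proof.
elim: k i => [|k IH] i; first by rewrite (tr_mx0 tr) (tr_my0 tr) !mxE.
rewrite (tr_st tr)/=; split; apply: stochastic_ge => // j; rewrite mxE row_sq_row_norms.
  by rewrite (le_trans (IH j).1)// lerDl sqr_ge0.
by rewrite (le_trans (IH j).2)// lerDl sqr_ge0.
Qed.

Lemma st_v_ge k i : c <= st_v (st k) i 0.
Proof. by rewrite mxE le_max (m_ge k i).1. Qed.

Lemma st_u_ge k i : c <= st_u (st k) i 0.
Proof. exact: (m_ge k i).2. Qed.

Lemma frob_dev_const m (a : 'rV[R]_m) : frob (dev (\matrix_(i < n) a)) = 0.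
Proof.
rewrite /frob big1// => i _; rewrite row_dev rowK /avg_row.
under eq_bigr do rewrite rowK.
rewrite sumr_const card_ord -(scaler_nat n a) scalerA nVn scale1r subrr.
by rewrite norm20 expr0n.
Qed.

Definition Dm := n%:R * C ^+ 2.

(** The squared deviation contracts by [1 - s] with forcing [Dm^2 / s], so it never exceeds
    [(Dm / s)^2]. The bound does not grow in time, so the relative deviation decays like the inverse
    of the accumulator. *)
Lemma m_dev m (G : nat -> 'M[R]_(n, m)) (M : nat -> 'cV[R]_n) :
  M 0%N = const_mx c -> (forall k i, norm2 (row i (G k)) <= C) ->
  (forall k, M k.+1 = W *m (M k + sq_row_norms (G k))) ->
  forall k i, `|M k i 0 - avg (M k)| <= Dm / s.
Proof.
move=> M0 GC MS k i.
have D0 : 0 <= Dm / s by rewrite divr_ge0 ?(ltW s0)// mulr_ge0 ?sqr_ge0.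
rewrite -ler_sqr ?nnegrE// real_normK ?num_real// (le_trans (frob_dev_col _ _))//.
have -> : (Dm / s) ^+ 2 = (s^-1 * Dm ^+ 2) / s by rewrite expr_div_n expr2; field; rewrite gt_eqF.
apply: (@contraction_bound _ (fun k => frob (dev (M k)))) => //.
- by rewrite mulr_ge0 ?sqr_ge0 ?invr_ge0// ltW.
- rewrite M0; have -> : const_mx c = \matrix_(i < n) (const_mx c : 'rV[R]_1).
    by apply/matrixP => ? ?; rewrite !mxE.
  by rewrite frob_dev_const !mulr_ge0 ?invr_ge0 ?sqr_ge0 ?(ltW s0).
move=> {}k; rewrite MS (le_trans (consensus_step _ _ n0 dW (tr_rho tr)))//.
rewrite lerD2l ler_wpM2l ?invr_ge0 ?(ltW s0)//.
apply: (@le_trans _ _ (\sum_(i < n) (C ^+ 2) ^+ 2)).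
  apply: ler_sum => j _; rewrite norm2_sq /inner big_ord1 mxE row_sq_row_norms -expr2.
  by rewrite !le_sqr ?sqr_ge0 ?norm2_ge0.
rewrite sum_n /Dm [leRHS]exprMn ler_wpM2r ?sqr_ge0//.
by rewrite -natrX ler_nat expnS expn1 leq_pmulr.
Qed.

Lemma mx_dev k i : `|st_mx (st k) i 0 - Xm k| <= Dm / s.
Proof.
apply: (m_dev (G := gX) (M := fun k => st_mx (st k))); rewrite ?(tr_mx0 tr)//.
  exact: tr_gX.
by move=> ?; rewrite (tr_st tr).
Qed.

Lemma my_dev k i : `|st_my (st k) i 0 - Um k| <= Dm / s.
Proof.
apply: (m_dev (G := gY) (M := fun k => st_my (st k))); rewrite ?(tr_my0 tr)//.
  exact: tr_gY.
by move=> ?; rewrite (tr_st tr).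
Qed.

Lemma v_dev k i : `|st_v (st k) i 0 - Vm k| <= Dm / s.
Proof.
have := mx_dev k i; have := my_dev k i; rewrite mxE /Vm.
move: (st_mx _ _ _) (st_my _ _ _) (Xm k) (Um k) (Dm / s) => x y X U D.
rewrite !ler_norml => /andP[? ?] /andP[? ?].
by rewrite /Num.max; case: ifPn => ?; case: ifPn => ?; apply/andP; split; lra.
Qed.

Lemma Vm_le_avg k : Vm k <= avg (st_v (st k)).
Proof.
by rewrite ge_max; apply/andP; split; apply: avg_le => i; rewrite [leRHS]mxE le_max lexx ?orbT.
Qed.

Lemma div_mulA (a b e : R) : a / (b * e) = a / b / e.
Proof. by rewrite invfM mulrA. Qed.

(** Update [k] moves y with mean stepsize [th k.+1], which contains the current sample; [th k] is
    known beforehand. *)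
Definition th k := gy / ub k.

(* Since [c <= Um k], this is the largest rate for which [aa * th k <= 1 / 2]. *)
Definition aa := c `^ beta / (2 * gy).

(** The weight uses [th k], so [zz k] depends only on samples drawn before time [k] and may occur in
    coefficients of the noise. *)
Fixpoint zz k := if k is k'.+1 then zz k' + (aa * th k') *: (xb k' - zz k') else xb 0.

Definition ww k := xb k - zz k.
Definition Wk k := norm2 (ww k) ^+ 2.
Definition ystar x := argmax_on Y (f x).
Definition ee k i := yr k i - ystar (zz k).
Definition Ek k := \sum_i norm2 (ee k i) ^+ 2.
(** Ratios of the local to the mean stepsize. In [Sx = gxb + Rx], the remainder [Rx] carries the
    stepsize inconsistency. *)
Definition tv k i := st_v (st k.+1) i 0 `^ (- alpha) * vb k.+1.
Definition tu k i := st_u (st k.+1) i 0 `^ (- beta) * ub k.+1.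
Definition Sx k := n%:R^-1 *: \sum_i tv k i *: gxr k i.
Definition gxb k := n%:R^-1 *: \sum_i gxr k i.
Definition Rx k := n%:R^-1 *: \sum_i (tv k i - 1) *: gxr k i.
Definition Gxr k i := Gx i (xr k i) (yr k i).
Definition Gyr k i := Gy i (xr k i) (yr k i).
Definition Gxb k := n%:R^-1 *: \sum_i Gxr k i.
Definition exb k := gxb k - Gxb k.
Definition eyr k i := gyr k i - Gyr k i.
Definition dPhi x := gradPhi f (mean_field Gx) Y x.
Definition kap := 2 * L / mu.
Definition Dv := T ^+ 2 * Dm.
Definition r0 := c `^ (beta - alpha).

Lemma aa_gt0 : 0 < aa. Proof. by rewrite divr_gt0 ?powR_gt0 ?mulr_gt0. Qed.

Lemma th_gt0 k : 0 < th k. Proof. by rewrite divr_gt0 ?ub_gt0. Qed.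

Lemma aa_th k : aa * th k <= 1 / 2.
Proof.
have -> : aa * th k = c `^ beta / ub k / 2.
  by rewrite /aa /th; field; rewrite !gt_eqF ?ub_gt0.
rewrite ler_pM2r ?invr_gt0// ler_pdivrMr ?ub_gt0// mul1r.
by rewrite powR_le ?Um_ge// ltW.
Qed.

Lemma r0_gt0 : 0 < r0. Proof. exact: powR_gt0. Qed.

(** Time-scale separation: [Vm] dominates [Um] because [v] is a maximum, so the ratio of the x- to
    the y-stepsize decays as a power of [Vm]. *)
Lemma ub_vb_exp k : ub k / vb k <= Vm k `^ (beta - alpha).
Proof.
rewrite -(powR_sum_exp (a := beta) (b := - alpha) (Vm_gt0 k) erefl) powRN.
by rewrite ler_pM2r ?invr_gt0 ?vb_gt0// powR_le ?Um_le_Vm// ltW// Um_gt0.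
Qed.

Lemma ub_vb k : ub k / vb k <= r0.
Proof.
by rewrite (le_trans (ub_vb_exp k))// powR_le_oppr ?Vm_ge// subr_le0 ltW.
Qed.

Lemma ub_vbS k : ub k / vb k.+1 <= r0.
Proof.
apply: le_trans (ub_vb k); rewrite ler_pM2l ?ub_gt0// lef_pV2 ?posrE ?vb_gt0//.
exact: vb_mono.
Qed.

(** The relative price of replacing [vb k.+1], which contains the current sample, by [vb k]: as
    [alpha < 1], it is at most the relative increment of [Vm]. *)
Lemma vb_ratio k : 1 - vb k / vb k.+1 <= C ^+ 2 / Vm k.+1.
Proof.
have h := powR_ratio (ltW a1) (Vm_gt0 k) (Vm_mono k); rewrite -/(vb k) -/(vb k.+1) in h.
have V1 := Vm_gt0 k.+1; have v1 := vb_gt0 k.+1.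
have : Vm k / Vm k.+1 <= vb k / vb k.+1 by rewrite ler_pdivlMr// mulrAC ler_pdivrMr// mulrC.
have : 1 - C ^+ 2 / Vm k.+1 <= Vm k / Vm k.+1.
  rewrite lerBlDr -mulrDl ler_pdivlMr// mul1r; exact: VmS_le.
by lra.
Qed.

(** Largest factor by which an accumulator, at least [c], can grow in one step. *)
Definition Mr := 1 + C ^+ 2 / c.

Lemma ub_ratio k : ub k.+1 <= Mr * ub k.
Proof.
have h := powR_ratio (ltW b1) (Um_gt0 k) (Um_mono k); rewrite -/(ub k) -/(ub k.+1) in h.
rewrite -(ler_pM2r (Um_gt0 k)) (le_trans h)// -mulrA [leRHS]mulrCA ler_wpM2l ?(ltW (ub_gt0 k))//.
rewrite UmS mulrDl mul1r lerD2l (le_trans (hy_le k))//.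
by rewrite mulrAC ler_pdivlMr// ler_wpM2l ?sqr_ge0// Um_ge.
Qed.

Lemma xbS k : xb k.+1 = xb k - (gx / vb k.+1) *: Sx k.
Proof.
rewrite /xb (tr_st tr) [LHS]avg_row_stochastic// /avg_row.
under eq_bigr do rewrite linearB/= linearZ/= row_diag_powR.
rewrite sumrB scalerBr; congr (_ - _).
rewrite /Sx scalerA mulrC -scalerA; congr (_ *: _); rewrite scaler_sumr.
apply: eq_bigr => i _; rewrite !scalerA; congr (_ *: _).
by rewrite /tv (tr_st tr)/=; field; rewrite gt_eqF// vb_gt0.
Qed.

(** * One-step recursions under consistent stepsizes *)

Section Consistent.
Hypothesis sc : stepsize_consistent.
Let T1 : 1 <= T := tr_T sc.

Lemma tvP k i : [/\ 0 <= tv k i, tv k i <= T & (tv k i - 1) ^+ 2 <= Dv / (s * Vm k.+1)].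
Proof.
(* Consistency refers to [avg (st_v _)]; passing to the smaller [Vm] only enlarges the right-hand
   side. *)
have h : st_v (st k.+1) i 0 `^ (- alpha) <= T * Vm k.+1 `^ (- alpha).
  rewrite (le_trans (tr_zv sc k i))// ler_wpM2l ?(le_trans ler01 T1)//.
  by rewrite powR_le_oppr ?oppr_le0 ?(ltW a0) ?Vm_gt0 ?Vm_le_avg.
have [t0 tT tt] := stepsize_ratio (ltW a0) (ltW a1)
  (lt_le_trans c0 (st_v_ge k.+1 i)) (Vm_gt0 k.+1) T1 h.
split => //; rewrite (le_trans tt)// /Dv -mulrA ler_wpM2l ?sqr_ge0//.
by rewrite (div_mulA Dm) ler_wpM2r ?invr_ge0 ?(ltW (Vm_gt0 _)) ?v_dev.
Qed.

Lemma tuP k i : [/\ 0 <= tu k i, tu k i <= T & (tu k i - 1) ^+ 2 <= Dv / (s * Um k.+1)].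
Proof.
have h : st_u (st k.+1) i 0 `^ (- beta) <= T * Um k.+1 `^ (- beta) := tr_zu sc k i.
have [t0 tT tt] := stepsize_ratio (ltW b0) (ltW b1)
  (lt_le_trans c0 (st_u_ge k.+1 i)) (Um_gt0 k.+1) T1 h.
split => //; rewrite (le_trans tt)// /Dv -mulrA ler_wpM2l ?sqr_ge0//.
by rewrite (div_mulA Dm) ler_wpM2r ?invr_ge0 ?(ltW (Um_gt0 _)) ?my_dev.
Qed.

Lemma Sx_sq k : norm2 (Sx k) ^+ 2 <= T ^+ 2 * hx k.
Proof.
rewrite (le_trans (norm2_avg_sq _ n0))// /hx mulrCA ler_wpM2l ?(ltW nV0)//.
rewrite mulr_sumr; apply: ler_sum => i _; rewrite norm2Z_sq ler_wpM2r ?sqr_ge0//.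
by have [? ? _] := tvP k i; rewrite le_sqr.
Qed.

(** The inconsistency appears squared and divided by [Vm], so it sums to order [ln K / s] and does
    not change the power of K. *)
Lemma Rx_sq k : norm2 (Rx k) ^+ 2 <= Dv / (s * Vm k.+1) * hx k.
Proof.
rewrite (le_trans (norm2_avg_sq _ n0))// /hx mulrCA ler_wpM2l ?(ltW nV0)//.
rewrite mulr_sumr; apply: ler_sum => i _; rewrite norm2Z_sq ler_wpM2r ?sqr_ge0//.
by have [] := tvP k i.
Qed.

Lemma SxE k : Sx k = gxb k + Rx k.
Proof.
rewrite /Sx /gxb /Rx -scalerDr -big_split; congr (_ *: _).
by apply: eq_bigr => i _; rewrite scalerBl scale1r [RHS]addrC subrK.
Qed.

Lemma gxb_sq k : norm2 (gxb k) ^+ 2 <= hx k.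
Proof. exact: norm2_avg_sq. Qed.

Lemma Pk_step k : Pk k.+1 <= (1 - s) * Pk k +
  s^-1 * (gx ^+ 2 * T ^+ 2 * n%:R * (hx k / vb k.+1 ^+ 2)).
Proof.
rewrite /Pk {1}(tr_st tr)/= (le_trans (consensus_step _ _ n0 dW (tr_rho tr)))//.
rewrite lerD2l ler_wpM2l ?invr_ge0 ?(ltW s0)//.
have -> : gx ^+ 2 * T ^+ 2 * n%:R * (hx k / vb k.+1 ^+ 2) =
    \sum_i (gx * T / vb k.+1) ^+ 2 * norm2 (gxr k i) ^+ 2.
  by rewrite -mulr_sumr sum_hx expr_div_n exprMn; ring.
apply: ler_sum => i _; rewrite linearN linearZ/= row_diag_powR norm2N scalerA norm2Z_sq.
rewrite ler_wpM2r ?sqr_ge0//; have [t0 tT _] := tvP k i.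
have -> : colmax (W *m (st_mx (st k) + sq_row_norms (gX k)))
  (W *m (st_my (st k) + sq_row_norms (gY k))) i 0 = st_v (st k.+1) i 0.
  by rewrite (tr_st tr).
have -> : st_v (st k.+1) i 0 `^ (- alpha) = tv k i / vb k.+1.
  by rewrite /tv mulfK// gt_eqF// vb_gt0.
rewrite mulrA le_sqr//; first exact: divr_ge0 (mulr_ge0 (ltW gx0) t0) (ltW (vb_gt0 _)).
by rewrite ler_wpM2r ?invr_ge0 ?(ltW (vb_gt0 _))// ler_wpM2l// ltW.
Qed.

Lemma Qk_step k : Qk k.+1 <= (1 - s) * Qk k +
  s^-1 * (gy ^+ 2 * T ^+ 2 * n%:R * (hy k / ub k.+1 ^+ 2)).
Proof.
rewrite /Qk {1}(tr_st tr)/=.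
rewrite (le_trans (frob_dev_proj (A := W *m (st_y (st k) +
  gy *: (diag_powR (W *m (st_my (st k) + sq_row_norms (gY k))) (- beta) *m gY k)))
  (P := proj_on Y) n0 _ _))//.
- apply: proj_on_nonexpansive; [exact: mo_closed mo|exact: mo_convex mo| |].
    exact: mo_nonempty mo.
  exact: diam_Y mo.
- by move=> i; rewrite rowK.
rewrite (le_trans (consensus_step _ _ n0 dW (tr_rho tr)))//.
rewrite lerD2l ler_wpM2l ?invr_ge0 ?(ltW s0)//.
have -> : gy ^+ 2 * T ^+ 2 * n%:R * (hy k / ub k.+1 ^+ 2) =
    \sum_i (gy * T / ub k.+1) ^+ 2 * norm2 (gyr k i) ^+ 2.
  by rewrite -mulr_sumr sum_hy expr_div_n exprMn; ring.
apply: ler_sum => i _; rewrite linearZ/= row_diag_powR scalerA norm2Z_sq.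
rewrite ler_wpM2r ?sqr_ge0//; have [t0 tT _] := tuP k i.
have -> : (W *m (st_my (st k) + sq_row_norms (gY k))) i 0 = st_u (st k.+1) i 0.
  by rewrite (tr_st tr).
have -> : st_u (st k.+1) i 0 `^ (- beta) = tu k i / ub k.+1.
  by rewrite /tu mulfK// gt_eqF// ub_gt0.
rewrite mulrA le_sqr//; first exact: divr_ge0 (mulr_ge0 (ltW gy0) t0) (ltW (ub_gt0 _)).
by rewrite ler_wpM2r ?invr_ge0 ?(ltW (ub_gt0 _))// ler_wpM2l// ltW.
Qed.

(** At node [i] the gap splits into [xr - xb] (consensus), the tracking error [ee], and the move of
    the maximiser from [zz] to [xb], which is at most [kap * |ww|]. *)
Lemma dPhi_gap k : norm2 (dPhi (xb k) - Gxb k) ^+ 2 <=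
  L ^+ 2 * (n%:R^-1 * Pk k + 2 * (n%:R^-1 * Ek k) + 2 * kap ^+ 2 * Wk k).
Proof.
have -> : dPhi (xb k) - Gxb k =
    n%:R^-1 *: \sum_i (Gx i (xb k) (ystar (xb k)) - Gx i (xr k i) (yr k i)).
  by rewrite sumrB scalerBr.
rewrite (le_trans (norm2_avg_sq _ n0))//.
have -> : L ^+ 2 * (n%:R^-1 * Pk k + 2 * (n%:R^-1 * Ek k) + 2 * kap ^+ 2 * Wk k) =
    n%:R^-1 * (\sum_i L ^+ 2 * (norm2 (row i (dev (st_x (st k)))) ^+ 2 +
      (2 * norm2 (ee k i) ^+ 2 + 2 * (kap ^+ 2 * Wk k)))).
  move: (Wk k) => w; rewrite -mulr_sumr !big_split/= -mulr_sumr sum_n -/(Ek k).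
  rewrite -/(frob (dev (st_x (st k)))) -/(Pk k).
  by move: (Pk k) (Ek k) => P E; field; rewrite gt_eqF.
rewrite ler_wpM2l ?(ltW nV0)//; apply: ler_sum => i _.
have Yi := yr_in k i; have Ys := argmax_in mo (xb k); have Yz := argmax_in mo (zz k).
rewrite (le_trans (tr_lipx tr i _ _ Ys Yi))// ler_wpM2l ?sqr_ge0//.
rewrite lerD//; first by rewrite row_dev norm2BC.
have -> : argmax_on Y (f (xb k)) - yr k i =
  - (ee k i) + (ystar (xb k) - ystar (zz k)).
  by rewrite /ee/ystar; apply/rowP => j; rewrite !mxE; ring.
rewrite (le_trans (norm2D_sq_le _ _))// norm2N lerD2l ler_wpM2l//.
exact: (argmax_lipschitz_sq mo).
Qed.

(** The expansion of [Phi] is multiplied by [vb k.+1 / gx], so the error [exb] is paired with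
    [dPhi (xb k)], known before the sample. Of the [1 / 2] given by polarisation, Young's inequality
    on [Rx] takes [1 / 8]. *)
Lemma descent_step k :
  3 / 8 * norm2 (dPhi (xb k)) ^+ 2 <=
    vb k.+1 / gx * (Phi Y f (xb k) - Phi Y f (xb k.+1))
    + PhiL mu L * gx * T ^+ 2 * (hx k / vb k.+1) + 2 * (Dv / s) * (hx k / Vm k.+1)
    + 1 / 2 * norm2 (dPhi (xb k) - Gxb k) ^+ 2 - inner (dPhi (xb k)) (exb k).
Proof.
have vp := vb_gt0 k.+1; have Vp := Vm_gt0 k.+1.
set eta := gx / vb k.+1; have eta0 : 0 < eta by rewrite divr_gt0.
have := Phi_quad mo (xb k) (- (eta *: Sx k)).
rewrite -xbS innerNr innerZr norm2N norm2Z_sq ler_norml => /andP[_].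
rewrite -/(dPhi (xb k)) => key.
have SE : inner (dPhi (xb k)) (Sx k) = inner (dPhi (xb k)) (Gxb k) +
    inner (dPhi (xb k)) (exb k) + inner (dPhi (xb k)) (Rx k).
  rewrite -!innerDr SxE; congr (inner _ (_ + _)).
  by rewrite /exb [RHS]addrC subrK.
have q8 : 0 < 1 / 4 :> R by lra.
have yR := inner_youngN (dPhi (xb k)) (Rx k) q8.
have gE := norm2B_sq (dPhi (xb k)) (Gxb k).
have G0 := sqr_ge0 (norm2 (Gxb k)).
have R2 := Rx_sq k.
have S2 : PhiL mu L * eta * norm2 (Sx k) ^+ 2 <= PhiL mu L * gx * T ^+ 2 * (hx k / vb k.+1).
  have -> : PhiL mu L * gx * T ^+ 2 * (hx k / vb k.+1) = PhiL mu L * eta * (T ^+ 2 * hx k).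
    by rewrite /eta; ring.
  by rewrite ler_wpM2l ?Sx_sq// mulr_ge0 ?(PhiL_ge0 mo)// ltW.
have key2 : inner (dPhi (xb k)) (Sx k) <=
    vb k.+1 / gx * (Phi Y f (xb k) - Phi Y f (xb k.+1)) + PhiL mu L * eta * norm2 (Sx k) ^+ 2.
  have -> : vb k.+1 / gx = eta^-1 by rewrite /eta invf_div.
  rewrite -(ler_pM2l eta0) mulrDr mulVKf ?gt_eqF//.
  by move: key; rewrite expr2; lra.
have DE : Dv / (s * Vm k.+1) * hx k = Dv / s * (hx k / Vm k.+1).
  by rewrite div_mulA; ring.
rewrite DE in R2; move: yR; rewrite invf_div divr1 => yR.
by move: key2 S2 SE yR gE G0 R2; lra.
Qed.

Lemma ww_step k : ww k.+1 = (1 - aa * th k) *: ww k - (gx / vb k.+1) *: Sx k.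
Proof.
rewrite {1}/ww/= -/(zz k) xbS -/(ww k).
have -> : xb k = zz k + ww k by rewrite /ww addrC subrK.
by apply/rowP => j; rewrite !mxE; ring.
Qed.

(** The level at which the pull [aa * th k] towards [xb] balances the largest x-move, by
    [ub / vb <= r0]; hence invariant for [|ww k|]. *)
Definition wmax := gx * T * C * r0 / (aa * gy).

Lemma Sx_le k : norm2 (Sx k) <= T * C.
Proof.
have T0 : 0 <= T by rewrite (le_trans ler01).
rewrite -ler_sqr ?nnegrE ?norm2_ge0 ?mulr_ge0// exprMn.
by rewrite (le_trans (Sx_sq k))// ler_wpM2l ?sqr_ge0// hx_le.
Qed.

Lemma wmax_ge0 : 0 <= wmax.
Proof.
have T0 : 0 <= T by rewrite (le_trans ler01).
rewrite divr_ge0//; first by rewrite !mulr_ge0// ltW// r0_gt0.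
by rewrite mulr_ge0// ltW// aa_gt0.
Qed.

Lemma ww_le k : norm2 (ww k) <= wmax.
Proof.
elim: k => [|k IH]; first by rewrite /ww/= subrr norm20 wmax_ge0.
have h := aa_th k; have h0 : 0 < aa * th k by rewrite mulr_gt0 ?aa_gt0 ?th_gt0.
have vp := vb_gt0 k.+1; have up := ub_gt0 k; have ap := aa_gt0.
rewrite ww_step (le_trans (norm2B _ _))// (norm2Z (1 - aa * th k)) (norm2Z (gx / vb k.+1)).
rewrite ger0_norm ?subr_ge0; last by lra.
rewrite ger0_norm ?divr_ge0 ?(ltW gx0) ?(ltW vp)//.
have e1 : (1 - aa * th k) * norm2 (ww k) <= (1 - aa * th k) * wmax.
  by rewrite ler_wpM2l// subr_ge0; lra.
have e2 : gx / vb k.+1 * norm2 (Sx k) <= aa * th k * wmax.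
  have -> : aa * th k * wmax = gx * (r0 / ub k) * (T * C).
    by rewrite /wmax /th; field; rewrite !gt_eqF.
  apply: ler_pM; rewrite ?norm2_ge0 ?Sx_le//.
    exact: divr_ge0 (ltW gx0) (ltW vp).
  rewrite ler_pM2l// ler_pdivlMr// mulrC; exact: ub_vbS.
by lra.
Qed.

Lemma Wk_le k : Wk k <= wmax ^+ 2.
Proof. by rewrite le_sqr ?norm2_ge0 ?ww_le. Qed.

Lemma Wk_ge0 k : 0 <= Wk k. Proof. exact: sqr_ge0. Qed.

(** Equal to [(1 - aa * th k) / th k], the coefficient of the cross term once the recursion for [Wk]
    is divided by [th k]. *)
Definition bb k := (th k)^-1 - aa.
Definition K5 := 8 / aa * (gx / gy) ^+ 2.
Definition N5 k := 2 * (bb k * (gx / vb k)) * inner (ww k) (exb k).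

Lemma bb_bound k : 0 <= bb k /\ bb k <= ub k / gy.
Proof.
have h := aa_th k; have t0 := th_gt0 k; split; last first.
  by rewrite /bb /th invf_div gerBl ltW// aa_gt0.
rewrite subr_ge0 -[leRHS]mul1r ler_pdivlMr//; lra.
Qed.

(** After division by [th k], the pull contributes [aa * Wk]. Three Young inequalities of weight
    [aa / 8] leave at least [aa / 2], and their inverse weight is the [8 / aa] of [K5]. *)
Lemma averaging_step k :
  aa / 2 * Wk k <= ub k / gy * (Wk k - Wk k.+1)
    + K5 * ((ub k / vb k) ^+ 2 * norm2 (Gxb k) ^+ 2)
    + K5 * r0 ^+ 2 * (C ^+ 2 + Dv / s) * (hx k / Vm k.+1)
    + gx ^+ 2 / gy * T ^+ 2 * r0 * (hx k / vb k.+1) - N5 k.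
Proof.
have h := aa_th k; have h0 : 0 < aa * th k by rewrite mulr_gt0 ?aa_gt0 ?th_gt0.
have t0 := th_gt0 k; have vp := vb_gt0 k; have vp1 := vb_gt0 k.+1; have up := ub_gt0 k.
have ap := aa_gt0; have Vp := Vm_gt0 k.+1; have rp := r0_gt0.
have [bb0 bbu] := bb_bound k; have thE : (th k)^-1 = ub k / gy by rewrite /th invf_div.
have hx0 := hx_ge0 k.
(* The averaging error is split along [Sx k = Gxb k + exb k + Rx k]. *)
set S1 := (bb k * (gx / vb k)) *: Gxb k.
(* The correction from [vb k.+1] to [vb k]; it is what leaves [N5] with a coefficient known before
   the sample. *)
set S2 := (bb k * (gx * ((vb k)^-1 - (vb k.+1)^-1))) *: gxb k.
set S3 := (bb k * (gx / vb k.+1)) *: Rx k.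
have split_S : bb k * (gx / vb k.+1) * inner (ww k) (Sx k) =
    inner (ww k) S1 - inner (ww k) S2 + inner (ww k) S3 + N5 k / 2.
  rewrite /S1 /S2 /S3 /N5 SxE /exb.
  move: (gxb k) (Gxb k) (Rx k) => g G r; rewrite !innerE.
  by field; rewrite !gt_eqF.
have a8 : 0 < aa / 8 by lra.
have y1 := inner_youngN (ww k) S1 a8.
have y2 := inner_young (ww k) S2 a8.
have y3 := inner_youngN (ww k) S3 a8.
have a8V : (aa / 8)^-1 = 8 / aa by rewrite invf_div.
rewrite a8V in y1 y2 y3.
have coef1 : bb k * (gx / vb k) <= gx / gy * (ub k / vb k).
  have -> : gx / gy * (ub k / vb k) = ub k / gy * (gx / vb k) by ring.
  by rewrite ler_wpM2r// divr_ge0// ltW.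
have K50 : 0 <= 8 / aa by rewrite divr_ge0// ltW.
have n1 : 8 / aa * norm2 S1 ^+ 2 <= K5 * ((ub k / vb k) ^+ 2 * norm2 (Gxb k) ^+ 2).
  have -> : K5 * ((ub k / vb k) ^+ 2 * norm2 (Gxb k) ^+ 2) =
    8 / aa * ((gx / gy * (ub k / vb k)) ^+ 2 * norm2 (Gxb k) ^+ 2) by rewrite /K5; ring.
  rewrite ler_wpM2l// norm2Z_sq ler_wpM2r ?sqr_ge0//.
  by rewrite le_sqr// mulr_ge0// divr_ge0// ltW.
have n2 : 8 / aa * norm2 S2 ^+ 2 <= K5 * r0 ^+ 2 * C ^+ 2 * (hx k / Vm k.+1).
  have -> : K5 * r0 ^+ 2 * C ^+ 2 * (hx k / Vm k.+1) =
    8 / aa * ((gx / gy * r0) ^+ 2 * (C ^+ 2 / Vm k.+1) * hx k) by rewrite /K5; ring.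
  rewrite ler_wpM2l// norm2Z_sq; apply: ler_pM; rewrite ?sqr_ge0 ?gxb_sq//.
  set q := 1 - vb k / vb k.+1.
  have q0 : 0 <= q by rewrite subr_ge0 ler_pdivrMr// mul1r vb_mono.
  have q1 : q <= 1 by rewrite gerBl divr_ge0// ltW.
  have -> : bb k * (gx * ((vb k)^-1 - (vb k.+1)^-1)) = bb k * (gx / vb k) * q.
    by rewrite /q; field; rewrite !gt_eqF.
  rewrite exprMn; apply: ler_pM; rewrite ?sqr_ge0//.
    rewrite le_sqr//; first by rewrite mulr_ge0// divr_ge0// ltW.
    by rewrite (le_trans coef1)// ler_wpM2l ?ub_vb// divr_ge0// ltW.
  by apply: le_trans (vb_ratio k); rewrite -/q expr2 ler_piMl.
have n3 : 8 / aa * norm2 S3 ^+ 2 <= K5 * r0 ^+ 2 * (Dv / s) * (hx k / Vm k.+1).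
  have -> : K5 * r0 ^+ 2 * (Dv / s) * (hx k / Vm k.+1) =
    8 / aa * ((gx / gy * r0) ^+ 2 * (Dv / (s * Vm k.+1) * hx k)).
    by rewrite /K5 div_mulA; ring.
  rewrite ler_wpM2l// norm2Z_sq; apply: ler_pM; rewrite ?sqr_ge0 ?Rx_sq//.
  rewrite le_sqr//; first by rewrite mulr_ge0// divr_ge0// ltW.
  have -> : gx / gy * r0 = r0 * (gx / gy) by rewrite mulrC.
  apply: (@le_trans _ _ (ub k / gy * (gx / vb k.+1))).
    by rewrite ler_wpM2r// divr_ge0// ltW.
  have -> : ub k / gy * (gx / vb k.+1) = ub k / vb k.+1 * (gx / gy) by ring.
  by rewrite ler_wpM2r ?ub_vbS// divr_ge0// ltW.
have n4 : ub k / gy * ((gx / vb k.+1) ^+ 2 * norm2 (Sx k) ^+ 2) <=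
    gx ^+ 2 / gy * T ^+ 2 * r0 * (hx k / vb k.+1).
  have -> : ub k / gy * ((gx / vb k.+1) ^+ 2 * norm2 (Sx k) ^+ 2) =
    gx ^+ 2 / gy / vb k.+1 * (ub k / vb k.+1 * norm2 (Sx k) ^+ 2) by ring.
  have -> : gx ^+ 2 / gy * T ^+ 2 * r0 * (hx k / vb k.+1) =
    gx ^+ 2 / gy / vb k.+1 * (r0 * (T ^+ 2 * hx k)) by ring.
  rewrite ler_wpM2l ?divr_ge0 ?sqr_ge0 ?(ltW gy0) ?(ltW vp1)//.
  by apply: ler_pM; rewrite ?sqr_ge0 ?ub_vbS ?Sx_sq// divr_ge0// ltW.
have main : ub k / gy * Wk k.+1 <= ub k / gy * Wk k - aa * Wk k
    - 2 * (bb k * (gx / vb k.+1) * inner (ww k) (Sx k))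
    + ub k / gy * ((gx / vb k.+1) ^+ 2 * norm2 (Sx k) ^+ 2).
  rewrite /Wk ww_step norm2B_sq (norm2Z_sq (1 - aa * th k)) (norm2Z_sq (gx / vb k.+1)) innerZl innerZr.
  set q := norm2 (ww k) ^+ 2; have q0 : 0 <= q by exact: sqr_ge0.
  have e1 : (1 - aa * th k) ^+ 2 * q <= (1 - aa * th k) * q.
    by rewrite ler_wpM2r// expr2 ler_piMl//; lra.
  have u0 : 0 <= ub k / gy by rewrite divr_ge0// ltW.
  have := ler_wpM2l u0 e1.
  have -> : ub k / gy * ((1 - aa * th k) * q) = ub k / gy * q - aa * q.
    by rewrite /th; field; rewrite !gt_eqF.
  have E : ub k / gy * (2 * ((1 - aa * th k) * (gx / vb k.+1 * inner (ww k) (Sx k)))) =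
     2 * (bb k * (gx / vb k.+1) * inner (ww k) (Sx k)).
    by rewrite /bb /th; field; rewrite !gt_eqF.
  by rewrite [_ * (_ + _)]mulrDr mulrBr E; lra.
rewrite -/(Wk k) in y1 y2 y3.
have e : K5 * r0 ^+ 2 * (C ^+ 2 + Dv / s) * (hx k / Vm k.+1) =
  K5 * r0 ^+ 2 * C ^+ 2 * (hx k / Vm k.+1) + K5 * r0 ^+ 2 * (Dv / s) * (hx k / Vm k.+1) by ring.
have W0 := Wk_ge0 k; have aW : 0 <= aa * Wk k by rewrite mulr_ge0// ltW.
rewrite e; move: main; rewrite split_S mulrBr.
move: y1 y2 y3 n1 n2 n3 n4 aW.
move: (K5 * _) (K5 * r0 ^+ 2 * C ^+ 2 * _) (K5 * r0 ^+ 2 * (Dv / s) * _) => X1 X2 X3.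
move: (8 / aa * norm2 S1 ^+ 2) (8 / aa * norm2 S2 ^+ 2) (8 / aa * norm2 S3 ^+ 2) => Y1 Y2 Y3.
move: (ub k / gy * ((gx / vb k.+1) ^+ 2 * norm2 (Sx k) ^+ 2)) => Y4.
by lra.
Qed.

Definition DQ := n%:R * (2 * C / mu) ^+ 2.

Lemma Qk_le k : Qk k <= DQ.
Proof.
rewrite /DQ -sum_n; apply: ler_sum => i _; rewrite row_dev.
by rewrite le_sqr ?norm2_ge0// (diam_Y mo (yr_in k i) (yb_in k)).
Qed.

Lemma Ek_le k : Ek k <= DQ.
Proof.
rewrite /DQ -sum_n; apply: ler_sum => i _.
by rewrite le_sqr ?norm2_ge0// (diam_Y mo (yr_in k i) (argmax_in mo (zz k))).
Qed.

Lemma Ek_ge0 k : 0 <= Ek k.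
Proof. by apply: sumr_ge0 => i _; exact: sqr_ge0. Qed.

Lemma Pk_ge0 k : 0 <= Pk k. Proof. exact: frob_ge0. Qed.
Lemma Qk_ge0 k : 0 <= Qk k. Proof. exact: frob_ge0. Qed.

(** The weight [ub] cancels one power in [hy / ub^2]. Its increments multiply [Qk <= DQ] and
    telescope to order [K^beta]. *)
Lemma Qk_weighted_step k : ub k.+1 * Qk k.+1 <= (1 - s) * (ub k * Qk k) +
  (s^-1 * (gy ^+ 2 * T ^+ 2 * n%:R * (hy k / ub k.+1)) + DQ * (ub k.+1 - ub k)).
Proof.
have up := ub_gt0 k; have up1 := ub_gt0 k.+1; have um := ub_mono k.
have e1 : (ub k.+1 - ub k) * Qk k.+1 <= (ub k.+1 - ub k) * DQ.
  by rewrite ler_wpM2l ?subr_ge0// Qk_le.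
have e2 := ler_wpM2l (ltW up) (Qk_step k).
have e3 : ub k * (s^-1 * (gy ^+ 2 * T ^+ 2 * n%:R * (hy k / ub k.+1 ^+ 2))) <=
    s^-1 * (gy ^+ 2 * T ^+ 2 * n%:R * (hy k / ub k.+1)).
  have -> : ub k * (s^-1 * (gy ^+ 2 * T ^+ 2 * n%:R * (hy k / ub k.+1 ^+ 2))) =
     s^-1 * (gy ^+ 2 * T ^+ 2 * n%:R * (hy k / ub k.+1)) * (ub k / ub k.+1).
    by field; rewrite !gt_eqF.
  rewrite ler_piMr//; last by rewrite ler_pdivrMr// mul1r.
  have h0 := hy_ge0 k.
  apply: mulr_ge0; first by rewrite invr_ge0 ltW.
  by apply: mulr_ge0; [exact: mulr_ge0 (mulr_ge0 (sqr_ge0 _) (sqr_ge0 _)) (ltW nR0)|exact: divr_ge0 h0 (ltW up1)].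
by move: e1 e2 e3; rewrite mulrDr; lra.
Qed.

(** Consensus ascent gives [mu / 2] of contraction; the Young inequalities of the tracking step cost
    [3 * eps = mu / 4] and leave [mu / 4]. *)
Definition eps := mu / 12.
Definition cW := n%:R * kap ^+ 2 * (aa * Mr / 2 + aa ^+ 2 * Mr ^+ 2 / eps)
  + 4 * n%:R * L ^+ 2 / mu.
(** The first sum comes from the ascent direction, the second from replacing true gradient energy by
    observed energy in [gradient_energy]. *)
Definition N6 k := 2 * (\sum_i inner (eyr k i) (ee k i))
  - 2 * (s^-1 / ub k) * \sum_i inner (Gyr k i) (eyr k i).

Let mu0 : 0 < mu := mo_mu mo.
Let eps0 : 0 < eps.
Proof. by rewrite divr_gt0. Qed.

(** Neither the projection nor gossip increases the total squared distance to a fixed point of [Y].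
    For gossip this holds only after summing over the nodes, which is why [Ek] is such a sum. *)
Lemma projected_step k :
  \sum_i norm2 (yr k.+1 i - ystar (zz k)) ^+ 2 <=
  \sum_i norm2 (ee k i + (th k.+1 * tu k i) *: gyr k i) ^+ 2.
Proof.
have up := ub_gt0 k.+1; set A := st_y (st k) +
  gy *: (diag_powR (W *m (st_my (st k) + sq_row_norms (gY k))) (- beta) *m gY k).
apply: (@le_trans _ _ (\sum_i norm2 (row i (W *m A) - ystar (zz k)) ^+ 2)).
  apply: ler_sum => i _; rewrite le_sqr ?norm2_ge0// /yr (tr_st tr)/= rowK.
  apply: (proj_on_le (mo_closed mo) (mo_convex mo) (mo_nonempty mo) (diam_Y mo)).
  exact: argmax_in mo _.
rewrite (le_trans (stochastic_row_jensen _ _ dW))// le_eqVlt; apply/orP; left; apply/eqP.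
apply: eq_bigr => i _; congr (norm2 _ ^+ 2).
rewrite /A linearD/= linearZ/= row_diag_powR -/(yr k i) -/(gyr k i).
have -> : W *m (st_my (st k) + sq_row_norms (gY k)) = st_u (st k.+1) by rewrite (tr_st tr).
have -> : th k.+1 * tu k i = gy * st_u (st k.+1) i 0 `^ (- beta).
  by rewrite /th /tu; field; rewrite gt_eqF.
by rewrite /ee scalerA addrAC.
Qed.

(** Young's weight [eps * th k.+1] costs a bounded multiple of [eps] after division by [th k.+1].
    The target moves by [aa * th k * |ww|] at most times [kap], so the inverse weight still leaves a
    bounded multiple of [Wk]. *)
Lemma target_move k : Ek k.+1 <=
  (1 + eps * th k.+1) * \sum_i norm2 (yr k.+1 i - ystar (zz k)) ^+ 2
  + (1 + (eps * th k.+1)^-1) * (n%:R * (kap ^+ 2 * ((aa * th k) ^+ 2 * Wk k))).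
Proof.
have e0 : 0 < eps * th k.+1 by rewrite mulr_gt0// th_gt0.
rewrite -sum_n !mulr_sumr -big_split; apply: ler_sum => i _ /=.
have -> : ee k.+1 i = (yr k.+1 i - ystar (zz k)) + (ystar (zz k) - ystar (zz k.+1)).
  by rewrite subrKA.
rewrite (le_trans (norm2D_sq_eps _ _ e0))// lerD2l ler_wpM2l//.
  by rewrite addr_ge0 ?invr_ge0// ltW.
rewrite (le_trans (argmax_lipschitz_sq mo _ _))// ler_wpM2l ?sqr_ge0//.
rewrite /= opprD addrA subrr add0r norm2N norm2Z_sq.
by [].
Qed.

(** A single [f_i] need not ascend towards the common maximiser, only the mean does. All gradients
    are therefore compared with those at the common point [(zz k, yb k)], where [ascent_direction]
    applies. *)
Lemma consensus_gradient k :
  2 * \sum_i inner (Gyr k i) (yb k - ystar (zz k)) <=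
  - (mu / 2) * (Ek k - Qk k) + 2 * L ^+ 2 / mu * (2 * Pk k + 2 * (n%:R * Wk k) + Qk k).
Proof.
set v := yb k - ystar (zz k); set z := zz k.
have EE : Ek k = Qk k + n%:R * norm2 v ^+ 2 by rewrite -frob_dist.
have asc : inner (mean_field Gy z (yb k)) v <= - (mu / 2) * norm2 v ^+ 2.
  exact: (ascent_direction mo z (yb_in k)).
have mE : \sum_i inner (Gy i z (yb k)) v = n%:R * inner (mean_field Gy z (yb k)) v.
  by rewrite -inner_suml /mean_field innerZl mulrA divff ?mul1r// gt_eqF.
have m2 : 0 < mu / 4 by rewrite divr_gt0.
have dE : \sum_i 2 * inner (Gyr k i - Gy i z (yb k)) v <=
    n%:R * (mu / 2 * norm2 v ^+ 2) +
    2 * L ^+ 2 / mu * (2 * Pk k + 2 * (n%:R * Wk k) + Qk k).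
  have -> : n%:R * (mu / 2 * norm2 v ^+ 2) +
    2 * L ^+ 2 / mu * (2 * Pk k + 2 * (n%:R * Wk k) + Qk k) =
    \sum_i (mu / 2 * norm2 v ^+ 2 + 2 / mu * (L ^+ 2 *
      (2 * norm2 (row i (dev (st_x (st k)))) ^+ 2 + 2 * Wk k
       + norm2 (row i (dev (st_y (st k)))) ^+ 2))).
    move: (Wk k) => w; rewrite big_split/= sum_n; congr (_ + _).
    rewrite -!mulr_sumr !big_split/= -mulr_sumr sum_n.
    rewrite -/(frob (dev (st_x (st k)))) -/(Pk k) -/(frob (dev (st_y (st k)))) -/(Qk k).
    by move: (Pk k) (Qk k) => P Q; field; rewrite gt_eqF.
  apply: ler_sum => i _; rewrite innerC.
  have m20 : 0 < mu / 2 by rewrite divr_gt0.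
  rewrite (le_trans (inner_young _ _ m20))// lerD2l invf_div.
  rewrite ler_wpM2l ?divr_ge0 ?(ltW mu0)//.
  rewrite (le_trans (tr_lipy tr i _ _ (yr_in k i) (yb_in k)))// ler_wpM2l ?sqr_ge0//.
  rewrite !row_dev lerD2r.
  have -> : xr k i - z = (xr k i - xb k) + ww k by rewrite /ww subrKA.
  exact: norm2D_sq_le.
have GE : 2 * \sum_i inner (Gyr k i) v = 2 * \sum_i inner (Gy i z (yb k)) v +
    \sum_i 2 * inner (Gyr k i - Gy i z (yb k)) v.
  rewrite !mulr_sumr -big_split; apply: eq_bigr => i _ /=.
  by rewrite innerDl innerNl; ring.
have nasc := ler_wpM2l (ltW nR0) asc.
rewrite GE mE EE; move: dE nasc.
move: (Pk k) (Qk k) (Wk k) (\sum_i _) => P Q w X.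
move: (inner _ _) (norm2 v ^+ 2) (2 * L ^+ 2 / mu) => I q B.
by move: (mu) (n%:R : R) => m N; lra.
Qed.

(** The observed energy [hy] feeds the accumulator and is therefore summable against it; dropping
    the squared error leaves a centred term. *)
Lemma gradient_energy k : \sum_i norm2 (Gyr k i) ^+ 2 <=
  n%:R * hy k - 2 * \sum_i inner (Gyr k i) (eyr k i).
Proof.
rewrite -sum_hy mulr_sumr -sumrB; apply: ler_sum => i _.
have -> : gyr k i = Gyr k i + eyr k i by rewrite /eyr addrC subrK.
by rewrite norm2D_sq; have := sqr_ge0 (norm2 (eyr k i)); lra.
Qed.

(* Young's inequality with weight [ub k] keeps the linear consensus term at the
   order [K^(1 - beta) / s]. *)
Lemma gradient_product k :
  2 * \sum_i inner (Gyr k i) (ee k i) <=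
  s^-1 / ub k * (\sum_i norm2 (Gyr k i) ^+ 2) + s * (ub k * Qk k)
  + 2 * \sum_i inner (Gyr k i) (yb k - ystar (zz k)).
Proof.
have up := ub_gt0 k.
have q0 : 0 < s^-1 / ub k by rewrite divr_gt0 ?invr_gt0.
have -> : s * (ub k * Qk k) = \sum_i (s^-1 / ub k)^-1 * norm2 (row i (dev (st_y (st k)))) ^+ 2.
  by rewrite -mulr_sumr invf_div invrK mulrA (mulrC (ub k)).
rewrite !mulr_sumr -!big_split; apply: ler_sum => i _ /=.
have -> : ee k i = row i (dev (st_y (st k))) + (yb k - ystar (zz k)).
  by rewrite row_dev subrKA.
by rewrite innerDr mulrDr lerD2r inner_young.
Qed.

(** Dividing by [th k.+1] frees the ascent term from the current stepsize, so that [ee], [Gyr] and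
    [ub k], all known before the sample, are what multiplies the errors in [N6]. *)
Lemma tracking_step k :
  mu / 4 * Ek k <= ub k.+1 / gy * (Ek k - Ek k.+1) + cW * Wk k + 4 * L ^+ 2 / mu * Pk k
    + (mu / 2 + 2 * L ^+ 2 / mu) * Qk k + s * (ub k * Qk k)
    + (gy * T ^+ 2 * n%:R * (1 + eps / aa) + s^-1 * n%:R * Mr) * (hy k / ub k.+1)
    + n%:R / eps * (Dv / s) * (hy k / Um k.+1) + N6 k.
Proof.
have up := ub_gt0 k; have up1 := ub_gt0 k.+1; have ap := aa_gt0.
have t0 := th_gt0 k; have t1 := th_gt0 k.+1; have h0 := hy_ge0 k; have E0 := Ek_ge0 k.
have ath := aa_th k; have ath1 := aa_th k.+1.
set A := \sum_i tu k i * inner (gyr k i) (ee k i).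
set Et := \sum_i norm2 (ee k i + (th k.+1 * tu k i) *: gyr k i) ^+ 2.
set H := T ^+ 2 * (n%:R * hy k).
have H0 : 0 <= H by exact: mulr_ge0 (sqr_ge0 _) (mulr_ge0 (ltW nR0) h0).
have tg : \sum_i norm2 ((th k.+1 * tu k i) *: gyr k i) ^+ 2 <= th k.+1 ^+ 2 * H.
  rewrite /H -sum_hy !mulr_sumr; apply: ler_sum => i _.
  rewrite norm2Z_sq exprMn -mulrA ler_wpM2l ?sqr_ge0// ler_wpM2r ?sqr_ge0//.
  by have [? ? _] := tuP k i; rewrite le_sqr.
have EtE : Et <= Ek k + 2 * th k.+1 * A + th k.+1 ^+ 2 * H.
  rewrite (le_trans _ (lerD (lexx _) tg))// /Et /Ek /A !mulr_sumr -!big_split.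
  apply: ler_sum => i _ /=; rewrite norm2D_sq innerZr (innerC (ee k i)).
  by rewrite lerD2r lerD2l le_eqVlt; apply/orP; left; apply/eqP; ring.
have EtE2 : Et <= 2 * Ek k + 2 * (th k.+1 ^+ 2 * H).
  have tg2 : 2 * (\sum_i norm2 ((th k.+1 * tu k i) *: gyr k i) ^+ 2) <= 2 * (th k.+1 ^+ 2 * H).
    by rewrite ler_wpM2l.
  rewrite (le_trans _ (lerD (lexx _) tg2))// /Et /Ek !mulr_sumr -!big_split.
  by apply: ler_sum => i _ /=; exact: norm2D_sq_le.
(* Splits the scaled gradient into true gradient, error and inconsistency [tu - 1]; only the last is
   estimated here. *)
have Ap : 2 * A <= 2 * (\sum_i inner (Gyr k i) (ee k i)) + 2 * (\sum_i inner (eyr k i) (ee k i))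
    + eps * Ek k + n%:R / eps * (Dv / s) * (hy k / Um k.+1).
  have -> : n%:R / eps * (Dv / s) * (hy k / Um k.+1) =
      eps^-1 * (Dv / (s * Um k.+1) * (n%:R * hy k)) by rewrite div_mulA; ring.
  rewrite /A /Ek -sum_hy !mulr_sumr -!big_split; apply: ler_sum => i _ /=.
  have -> : tu k i * inner (gyr k i) (ee k i) = inner (Gyr k i) (ee k i) +
      inner (eyr k i) (ee k i) + inner (ee k i) ((tu k i - 1) *: gyr k i).
    rewrite -innerDl /eyr [Gyr k i + _]addrC subrK innerZr (innerC (ee k i)); ring.
  rewrite !mulrDr -addrA lerD2l (le_trans (inner_young _ _ eps0))// lerD2l.
  rewrite ler_wpM2l ?invr_ge0 ?(ltW eps0)// norm2Z_sq ler_wpM2r ?sqr_ge0//.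
  by have [] := tuP k i.
have tm := target_move k; have pj := projected_step k; rewrite -/Et in pj.
have q0 : 0 <= 1 + eps * th k.+1 by rewrite addr_ge0// mulr_ge0// ltW.
have := ler_wpM2l q0 pj => pj'.
have thM : th k <= Mr * th k.+1.
  rewrite /th mulrCA ler_pM2l// -[X in X <= _]mul1r ler_pdivrMr// mulrAC ler_pdivlMr// mul1r.
  exact: ub_ratio.
(* [th k / th k.+1 <= Mr] and [aa * th k <= 1 / 2] turn the drift cost into a constant multiple of
   [Wk]. *)
have w1 : (th k.+1)^-1 * ((1 + (eps * th k.+1)^-1) * (aa * th k) ^+ 2) <=
    aa * Mr / 2 + aa ^+ 2 * Mr ^+ 2 / eps.
  have -> : (th k.+1)^-1 * ((1 + (eps * th k.+1)^-1) * (aa * th k) ^+ 2) =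
     aa * (th k / th k.+1) * (aa * th k) + aa ^+ 2 * (th k / th k.+1) ^+ 2 / eps.
    by field; rewrite !gt_eqF.
  have r1 : th k / th k.+1 <= Mr by rewrite ler_pdivrMr.
  have r0' : 0 <= th k / th k.+1 by rewrite divr_ge0// ltW.
  apply: lerD.
    have -> : aa * Mr / 2 = aa * Mr * (1 / 2) by rewrite mul1r.
    apply: ler_pM => //; first exact: mulr_ge0 (ltW ap) r0'.
      exact: mulr_ge0 (ltW ap) (ltW t0).
    by rewrite ler_wpM2l// ltW.
  by rewrite ler_wpM2r ?invr_ge0 ?(ltW eps0)// ler_wpM2l ?sqr_ge0// le_sqr.
have w2 : (th k.+1)^-1 * ((1 + (eps * th k.+1)^-1) *
    (n%:R * (kap ^+ 2 * ((aa * th k) ^+ 2 * Wk k)))) <=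
    n%:R * kap ^+ 2 * (aa * Mr / 2 + aa ^+ 2 * Mr ^+ 2 / eps) * Wk k.
  have nk : 0 <= n%:R * kap ^+ 2 * Wk k by exact: mulr_ge0 (mulr_ge0 (ltW nR0) (sqr_ge0 _)) (Wk_ge0 k).
  have := ler_wpM2l nk w1; move: (Wk k) => w; lra.
have hH : th k.+1 * H * (1 + 2 * eps * th k.+1) <=
    gy * T ^+ 2 * n%:R * (1 + eps / aa) * (hy k / ub k.+1).
  have -> : gy * T ^+ 2 * n%:R * (1 + eps / aa) * (hy k / ub k.+1) =
    th k.+1 * H * (1 + eps / aa) by rewrite /th /H; field; rewrite !gt_eqF.
  rewrite ler_wpM2l//; first exact: mulr_ge0 (ltW t1) H0.
  rewrite lerD2l (mulrC 2) -mulrA ler_wpM2l ?(ltW eps0)//.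
  by rewrite -[leRHS]mul1r ler_pdivlMr//; lra.
have sV0 : 0 < s^-1 by rewrite invr_gt0.
(* The noise coefficient requires [ub k], the logarithmic summation requires [ub k.+1]; they differ
   by at most the factor [Mr]. *)
have hM : s^-1 / ub k * (n%:R * hy k) <= s^-1 * n%:R * Mr * (hy k / ub k.+1).
  have -> : s^-1 / ub k * (n%:R * hy k) = s^-1 * n%:R * hy k * (ub k)^-1 by ring.
  have -> : s^-1 * n%:R * Mr * (hy k / ub k.+1) = s^-1 * n%:R * hy k * (Mr / ub k.+1) by ring.
  rewrite ler_wpM2l//; first exact: mulr_ge0 (mulr_ge0 (ltW sV0) (ltW nR0)) h0.
  by rewrite -[leLHS]mul1r ler_pdivrMr// mulrAC ler_pdivlMr// mul1r ub_ratio.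
have ge := ler_wpM2l (ltW (divr_gt0 (ltr01 : 0 < 1 :> R) (mulr_gt0 s0 up))) (gradient_energy k).
have sE : 1 / (s * ub k) = s^-1 / ub k by rewrite div_mulA div1r.
rewrite sE mulrBr in ge.
have gp := gradient_product k; have cg := consensus_gradient k.
have tV0 : 0 <= (th k.+1)^-1 by rewrite invr_ge0 ltW.
have EtE' := ler_wpM2l tV0 EtE.
have c1 : (th k.+1)^-1 * (Ek k + 2 * th k.+1 * A + th k.+1 ^+ 2 * H) =
   (th k.+1)^-1 * Ek k + 2 * A + th k.+1 * H by field; rewrite gt_eqF.
have c2 : (th k.+1)^-1 * ((1 + eps * th k.+1) * Et) = (th k.+1)^-1 * Et + eps * Et.
  by field; rewrite gt_eqF.
have tm' := ler_wpM2l tV0 (le_trans tm (lerD pj' (lexx _))).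
rewrite mulrDr c2 in tm'; rewrite c1 in EtE'.
have EtE2' := ler_wpM2l (ltW eps0) EtE2.
have tVE : (th k.+1)^-1 = ub k.+1 / gy by rewrite /th invf_div.
rewrite tVE in tm' EtE' w2.
have cWE : cW * Wk k = n%:R * kap ^+ 2 * (aa * Mr / 2 + aa ^+ 2 * Mr ^+ 2 / eps) * Wk k
  + 4 * n%:R * L ^+ 2 / mu * Wk k by rewrite /cW mulrDl.
have cgE : 2 * L ^+ 2 / mu * (2 * Pk k + 2 * (n%:R * Wk k) + Qk k) =
   4 * L ^+ 2 / mu * Pk k + 4 * n%:R * L ^+ 2 / mu * Wk k + 2 * L ^+ 2 / mu * Qk k by ring.
have hHE : th k.+1 * H * (1 + 2 * eps * th k.+1) = th k.+1 * H + eps * (2 * (th k.+1 ^+ 2 * H)).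
  by ring.
rewrite cgE in cg; rewrite hHE in hH; rewrite cWE /N6.
have muE : mu = 12 * eps by rewrite /eps; field.
have -> : (gy * T ^+ 2 * n%:R * (1 + eps / aa) + s^-1 * n%:R * Mr) * (hy k / ub k.+1) =
  gy * T ^+ 2 * n%:R * (1 + eps / aa) * (hy k / ub k.+1)
  + s^-1 * n%:R * Mr * (hy k / ub k.+1) by rewrite mulrDl.
rewrite mulrBr.
move: Ap w2 hH hM ge gp cg EtE' tm' EtE2'.
move: (ub k.+1 / gy * Ek k) (ub k.+1 / gy * Ek k.+1) (ub k.+1 / gy * Et) => B1 B2 B3.
move: (ub k.+1 / gy * _) (n%:R * kap ^+ 2 * _ * Wk k) => B4 B5.
move: (4 * L ^+ 2 / mu * Pk k) (4 * n%:R * L ^+ 2 / mu * Wk k) (2 * L ^+ 2 / mu) => B6 B7 B8.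
move: (gy * T ^+ 2 * n%:R * (1 + eps / aa) * _) (s^-1 * n%:R * Mr * _) => B9 B10.
move: (n%:R / eps * (Dv / s) * _) (s * (ub k * Qk k)) => B11 B12.
move: (s^-1 / ub k * (n%:R * hy k)) (s^-1 / ub k * \sum_i norm2 (Gyr k i) ^+ 2) => B13 B14.
have -> : 2 * (s^-1 / ub k) * (\sum_i inner (Gyr k i) (eyr k i)) =
  s^-1 / ub k * (2 * \sum_i inner (Gyr k i) (eyr k i)) by ring.
move: (s^-1 / ub k * (2 * _)) => B15.
move: (th k.+1 * H) (th k.+1 ^+ 2 * H) => B16 B17.
rewrite muE.
move: (\sum_i inner (Gyr k i) (ee k i)) (\sum_i inner (eyr k i) (ee k i)) => B18 B19.
move: (\sum_i inner (Gyr k i) (yb k - ystar (zz k))) => B20.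
generalize A (Ek k) (Qk k) Et eps => A' E Q Et' e.
by lra.
Qed.

(** * Summation over the horizon *)

Section Horizon.
Variables (K : nat) (m Delta e M : R).
Hypotheses (PhiB : forall x, m <= Phi Y f x <= m + Delta).
Hypotheses (e0 : 0 <= e) (M0 : 0 <= M).
Hypothesis eM : forall V, c <= V -> (V `^ (beta - alpha)) ^+ 2 <= e + M / V.

(** [K.+1] rather than [K]: the Abel summations with weights [vb k.+1] and [ub k.+1] end at index
    [K.+1]. *)
Definition Bmax := c + C ^+ 2 * K.+1%:R.
Definition Lg := ln Bmax - ln c.
Definition E2 := c `^ (1 - 2 * beta) + Bmax `^ (1 - 2 * beta).

Let c_le_Bmax : c <= Bmax.
Proof. by rewrite lerDl mulr_ge0 ?sqr_ge0. Qed.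

Let Bmax_gt0 : 0 < Bmax.
Proof. exact: lt_le_trans c0 c_le_Bmax. Qed.

Lemma Vm_Bmax k : (k <= K.+1)%N -> Vm k <= Bmax.
Proof.
by move=> kK; rewrite (le_trans (Vm_upper k))// lerD2l ler_wpM2l ?sqr_ge0// ler_nat.
Qed.

Lemma ub_Bmax k : (k <= K.+1)%N -> ub k <= Bmax `^ beta.
Proof.
move=> kK; rewrite powR_le ?(ltW b0) ?(ltW (Um_gt0 k))//.
exact: le_trans (Um_le_Vm k) (Vm_Bmax kK).
Qed.

Lemma vb_Bmax k : (k <= K.+1)%N -> vb k <= Bmax `^ alpha.
Proof. by move=> kK; rewrite powR_le ?(ltW a0) ?(ltW (Vm_gt0 k)) ?Vm_Bmax. Qed.

Lemma sum_lx : \sum_(k < K) hx k / Xm k.+1 <= Lg.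
Proof.
have h : 0 < Xm 0 by exact: Xm_gt0.
rewrite (le_trans (sum_log K h hx_ge0 XmS))// Xm0 lerD2r ler_ln ?posrE ?Xm_gt0//.
by rewrite (le_trans (Xm_le_Vm _))// Vm_Bmax.
Qed.

Lemma sum_ly : \sum_(k < K) hy k / Um k.+1 <= Lg.
Proof.
have h : 0 < Um 0 by exact: Um_gt0.
rewrite (le_trans (sum_log K h hy_ge0 UmS))// Um0 lerD2r ler_ln ?posrE ?Um_gt0//.
by rewrite (le_trans (Um_le_Vm _))// Vm_Bmax.
Qed.

Lemma hx_Vm k : hx k / Vm k.+1 <= hx k / Xm k.+1.
Proof. by rewrite ler_wpM2l ?hx_ge0// lef_pV2 ?posrE ?Vm_gt0 ?Xm_gt0// Xm_le_Vm. Qed.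

Lemma sum_weighted (h l w : nat -> R) q : 0 <= q ->
  (forall k, (k < K)%N -> h k * w k <= q * l k) ->
  \sum_(k < K) l k <= Lg -> \sum_(k < K) h k * w k <= q * Lg.
Proof.
move=> q0 hw lL; apply: (@le_trans _ _ (\sum_(k < K) q * l k)).
  by apply: ler_sum => k _; exact: hw.
by rewrite -mulr_sumr ler_wpM2l.
Qed.

Lemma sum_hx_vb : \sum_(k < K) hx k / vb k.+1 <= Bmax `^ (1 - alpha) * Lg.
Proof.
apply: (sum_weighted (l := fun k => hx k / Xm k.+1) (w := fun k => (vb k.+1)^-1) _ _ sum_lx); rewrite ?powR_ge0// => k kK.
have V0 := Vm_gt0 k.+1; apply: le_trans (ler_wpM2l (powR_ge0 _ _) (hx_Vm k)).
rewrite mulrCA ler_wpM2l ?hx_ge0// -powRN.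
rewrite -(powR_sum_exp (a := 1 - alpha) (b := -1) V0); last by ring.
rewrite (powR_inv1 (ltW V0)) ler_wpM2r ?invr_ge0 ?(ltW V0)//.
by rewrite powR_le ?(Vm_Bmax (leqW kK)) ?(ltW V0)// subr_ge0 ltW.
Qed.

Lemma E2_ge0 : 0 <= E2. Proof. by rewrite addr_ge0 ?powR_ge0. Qed.

(** [vb^(-2)] is [(Vm^(beta - alpha))^2 * Vm^(1 - 2 * beta) / Vm], whose first factor is at most
    [r0^2]; so the same [E2] serves the x- and the y-consensus. *)
Lemma sum_hx_vb2 : \sum_(k < K) hx k / vb k.+1 ^+ 2 <= r0 ^+ 2 * E2 * Lg.
Proof.
have r2 : 0 <= r0 ^+ 2 * E2 by rewrite mulr_ge0 ?sqr_ge0 ?E2_ge0.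
apply: (sum_weighted (l := fun k => hx k / Xm k.+1) (w := fun k => (vb k.+1 ^+ 2)^-1) r2 _ sum_lx) => k kK.
have V0 := Vm_gt0 k.+1; apply: le_trans (ler_wpM2l r2 (hx_Vm k)).
rewrite /= [leRHS]mulrCA ler_wpM2l ?hx_ge0//.
have -> : (vb k.+1 ^+ 2)^-1 =
    (Vm k.+1 `^ (beta - alpha)) ^+ 2 * Vm k.+1 `^ (1 - 2 * beta) / Vm k.+1.
  rewrite -!powR_mulrn ?powR_ge0// -!powRrM -(powR_inv1 (ltW V0)) -powRN.
  by rewrite (powR_sum_exp V0 erefl) (powR_sum_exp V0 erefl); congr (_ `^ _); ring.
rewrite ler_wpM2r ?invr_ge0 ?(ltW V0)//; apply: ler_pM; rewrite ?sqr_ge0 ?powR_ge0//.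
  by rewrite le_sqr ?powR_ge0// powR_le_oppr ?Vm_ge// subr_le0 ltW.
by rewrite powR_between ?Vm_ge// Vm_Bmax// leqW.
Qed.

Lemma sum_hy_ub : \sum_(k < K) hy k / ub k.+1 <= Bmax `^ (1 - beta) * Lg.
Proof.
apply: (sum_weighted (l := fun k => hy k / Um k.+1) (w := fun k => (ub k.+1)^-1) _ _ sum_ly); rewrite ?powR_ge0// => k kK.
have V0 := Um_gt0 k.+1; rewrite /= [leRHS]mulrCA ler_wpM2l ?hy_ge0// -powRN.
rewrite -(powR_sum_exp (a := 1 - beta) (b := -1) V0); last by ring.
rewrite (powR_inv1 (ltW V0)) ler_wpM2r ?invr_ge0 ?(ltW V0)//.
rewrite powR_le ?(ltW V0) ?subr_ge0 ?(ltW b1)//.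
exact: le_trans (Um_le_Vm _) (Vm_Bmax (leqW kK)).
Qed.

Lemma sum_hy_ub2 : \sum_(k < K) hy k / ub k.+1 ^+ 2 <= E2 * Lg.
Proof.
apply: (sum_weighted (l := fun k => hy k / Um k.+1) (w := fun k => (ub k.+1 ^+ 2)^-1) E2_ge0 _ sum_ly) => k kK.
have V0 := Um_gt0 k.+1; rewrite /= [leRHS]mulrCA ler_wpM2l ?hy_ge0//.
have -> : (ub k.+1 ^+ 2)^-1 = Um k.+1 `^ (1 - 2 * beta) / Um k.+1.
  rewrite -!powR_mulrn ?powR_ge0// -!powRrM -(powR_inv1 (ltW V0)) -powRN.
  by rewrite (powR_sum_exp V0 erefl); congr (_ `^ _); ring.
rewrite ler_wpM2r ?invr_ge0 ?(ltW V0)// powR_between ?Um_ge//.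
exact: le_trans (Um_le_Vm _) (Vm_Bmax (leqW kK)).
Qed.

Definition SP := \sum_(k < K) Pk k.
Definition SQ := \sum_(k < K) Qk k.
Definition SU := \sum_(k < K) ub k * Qk k.
Definition SE := \sum_(k < K) Ek k.
Definition SW := \sum_(k < K) Wk k.
Definition SG := \sum_(k < K) norm2 (dPhi (xb k)) ^+ 2.
Definition Gam := \sum_(k < K) norm2 (dPhi (xb k) - Gxb k) ^+ 2.
Definition N4 k := inner (dPhi (xb k)) (exb k).
Definition N7 k := 2 * inner (Gxb k) (exb k) / Vm k.

Definition cT := T ^+ 2 * n%:R.
Let cT0 : 0 <= cT.
Proof. exact: mulr_ge0 (sqr_ge0 _) (ltW nR0). Qed.
Let sV0 : 0 <= s^-1.
Proof. by rewrite invr_ge0 ltW. Qed.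

Definition BP := frob (dev (st_x (st 0))) / s + gx ^+ 2 * cT * r0 ^+ 2 * (s^-1 ^+ 2 * E2 * Lg).

Lemma SP_le : SP <= BP.
Proof.
have := sum_contraction K Pk_ge0 Pk_step; rewrite -mulr_sumr -mulr_sumr -/SP => h.
have h2 : s^-1 * (gx ^+ 2 * T ^+ 2 * n%:R * \sum_(k < K) hx k / vb k.+1 ^+ 2) <=
    s^-1 * (gx ^+ 2 * cT * (r0 ^+ 2 * E2 * Lg)).
  rewrite -(mulrA (gx ^+ 2)) -/cT ler_wpM2l// ler_wpM2l ?(mulr_ge0 (sqr_ge0 gx) cT0)//.
  exact: sum_hx_vb2.
have := le_trans h (lerD (lexx _) h2); rewrite mulrC -ler_pdivlMr// => /le_trans; apply.
rewrite /BP mulrDl lerD2l le_eqVlt; apply/orP; left; apply/eqP.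
by move: Lg E2 r0 cT => l e2 r t; field; rewrite gt_eqF.
Qed.

Definition BQ := DQ / s + gy ^+ 2 * cT * (s^-1 ^+ 2 * E2 * Lg).

Lemma SQ_le : SQ <= BQ.
Proof.
have := sum_contraction K Qk_ge0 Qk_step; rewrite -mulr_sumr -mulr_sumr -/SQ => h.
have h2 : s^-1 * (gy ^+ 2 * T ^+ 2 * n%:R * \sum_(k < K) hy k / ub k.+1 ^+ 2) <=
    s^-1 * (gy ^+ 2 * cT * (E2 * Lg)).
  rewrite -(mulrA (gy ^+ 2)) -/cT ler_wpM2l// ler_wpM2l ?(mulr_ge0 (sqr_ge0 gy) cT0)//.
  exact: sum_hy_ub2.
have := le_trans h (lerD (Qk_le 0) h2); rewrite mulrC -ler_pdivlMr// => /le_trans; apply.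
rewrite /BQ mulrDl lerD2l le_eqVlt; apply/orP; left; apply/eqP.
by move: Lg E2 cT => l e2 t; field; rewrite gt_eqF.
Qed.

Definition BU := DQ * Bmax `^ beta + gy ^+ 2 * cT * (s^-1 * Bmax `^ (1 - beta) * Lg).

Lemma SU_le : s * SU <= BU.
Proof.
have u0 k : 0 <= ub k * Qk k by rewrite mulr_ge0 ?Qk_ge0// ltW// ub_gt0.
have := sum_contraction K u0 Qk_weighted_step.
rewrite big_split/= -!mulr_sumr -/SU.
have -> : \sum_(k < K) (ub k.+1 - ub k) = ub K - ub 0.
  elim: K => [|k IH]; first by rewrite big_ord0 subrr.
  by rewrite big_ord_recr/= IH addrC addrA subrK.
move=> /le_trans; apply.
have h1 : ub 0 * Qk 0 <= ub 0 * DQ by rewrite ler_wpM2l ?Qk_le// ltW// ub_gt0.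
have h2 : DQ * ub K <= DQ * Bmax `^ beta.
  by rewrite ler_wpM2l ?ub_Bmax// (le_trans (Qk_ge0 0) (Qk_le 0)).
have h3 : s^-1 * (gy ^+ 2 * T ^+ 2 * n%:R * \sum_(k < K) hy k / ub k.+1) <=
    gy ^+ 2 * cT * (s^-1 * Bmax `^ (1 - beta) * Lg).
  have -> : gy ^+ 2 * cT * (s^-1 * Bmax `^ (1 - beta) * Lg) =
    s^-1 * (gy ^+ 2 * cT * (Bmax `^ (1 - beta) * Lg)).
    by move: Lg cT (Bmax `^ _) => l t b; ring.
  rewrite -(mulrA (gy ^+ 2)) -/cT ler_wpM2l// ler_wpM2l ?(mulr_ge0 (sqr_ge0 gy) cT0)//.
  exact: sum_hy_ub.
by move: h1 h2 h3; rewrite /BU mulrBr; move: DQ => D; lra.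
Qed.

Lemma Gam_le : Gam <= L ^+ 2 / n%:R * SP + 2 * (L ^+ 2 / n%:R) * SE + 2 * (L ^+ 2 * kap ^+ 2) * SW.
Proof.
rewrite /SP /SE /SW !mulr_sumr -!big_split; apply: ler_sum => k _ /=.
rewrite (le_trans (dPhi_gap k))//.
by move: (Pk k) (Ek k) (Wk k) => P E w; rewrite le_eqVlt; apply/orP; left; apply/eqP; ring.
Qed.

Definition D4 := Delta / gx * Bmax `^ alpha
  + PhiL mu L * gx * T ^+ 2 * (Bmax `^ (1 - alpha) * Lg) + 2 * Dv * (s^-1 * Lg).

Lemma Dv_ge0 : 0 <= Dv.
Proof. exact: mulr_ge0 (sqr_ge0 _) (mulr_ge0 (ltW nR0) (sqr_ge0 _)). Qed.

Let Dvs0 : 0 <= Dv / s.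
Proof. exact: mulr_ge0 Dv_ge0 sV0. Qed.

Lemma sum_hx_Vm : \sum_(k < K) hx k / Vm k.+1 <= Lg.
Proof. by apply: le_trans sum_lx; apply: ler_sum => k _; exact: hx_Vm. Qed.

Lemma SG_le : 3 / 8 * SG <= D4 + 1 / 2 * Gam - \sum_(k < K) N4 k.
Proof.
(* [Phi] is shifted by its lower bound [m], since Abel summation asks for values between 0 and
   [Delta]. *)
have h : 3 / 8 * SG <= (gx^-1 * \sum_(k < K) vb k.+1 * (Phi Y f (xb k) - m - (Phi Y f (xb k.+1) - m)))
   + PhiL mu L * gx * T ^+ 2 * (\sum_(k < K) hx k / vb k.+1)
   + 2 * (Dv / s) * (\sum_(k < K) hx k / Vm k.+1) + 1 / 2 * Gam - \sum_(k < K) N4 k.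
  rewrite /SG /Gam !mulr_sumr -!big_split -sumrB; apply: ler_sum => k _ /=.
  have := descent_step k; rewrite /N4 => /le_trans; apply.
  by rewrite le_eqVlt; apply/orP; left; apply/eqP; ring.
rewrite (le_trans h)// !lerD2r /D4; apply: lerD; first apply: lerD.
- rewrite [Delta / gx]mulrC -mulrA ler_wpM2l ?invr_ge0 ?(ltW gx0)//.
  apply: le_trans (@sum_abel _ (fun k => vb k.+1) (fun k => Phi Y f (xb k) - m) Delta K _ _ _ _) _.
  + by move=> k; rewrite ltW// vb_gt0.
  + by move=> k; exact: vb_mono.
  + by move=> k; rewrite subr_ge0; have /andP[] := PhiB (xb k).
  + by move=> k; rewrite lerBlDl; have /andP[] := PhiB (xb k).
  rewrite ler_wpM2l ?vb_Bmax//.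
  by have /andP[h1 h2] := PhiB 0; have := le_trans h1 h2; rewrite lerDl.
- rewrite ler_wpM2l ?sum_hx_vb//.
  exact: mulr_ge0 (mulr_ge0 (PhiL_ge0 mo) (ltW gx0)) (sqr_ge0 _).
have -> : 2 * Dv * (s^-1 * Lg) = 2 * (Dv / s) * Lg by move: Dv Lg => D l; ring.
by rewrite ler_wpM2l ?sum_hx_Vm// mulr_ge0.
Qed.

Definition D5 := wmax ^+ 2 / gy * Bmax `^ beta + K5 * (M * Mr * Lg)
  + K5 * r0 ^+ 2 * (C ^+ 2 * Lg + Dv * (s^-1 * Lg))
  + gx ^+ 2 / gy * T ^+ 2 * r0 * (Bmax `^ (1 - alpha) * Lg).
Definition N57 k := K5 * M * N7 k + N5 k.

Lemma K5_ge0 : 0 <= K5.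
Proof. by rewrite mulr_ge0 ?sqr_ge0// divr_ge0// ltW// aa_gt0. Qed.

(** The two parts of [e + M / Vm] are used differently: the [e]-part keeps the true gradient, to be
    absorbed by the descent; the [M / Vm]-part passes to the observed [hx / Vm], summable to a
    logarithm, plus the centred term [N7]. *)
Lemma weighted_gradient k : (ub k / vb k) ^+ 2 * norm2 (Gxb k) ^+ 2 <=
  e * (2 * norm2 (dPhi (xb k)) ^+ 2 + 2 * norm2 (dPhi (xb k) - Gxb k) ^+ 2)
  + M * Mr * (hx k / Vm k.+1) - M * N7 k.
Proof.
have V0 := Vm_gt0 k; have V1 := Vm_gt0 k.+1.
have h1 : (ub k / vb k) ^+ 2 <= e + M / Vm k.
  apply: le_trans (eM (Vm_ge k)); rewrite le_sqr ?ub_vb_exp//.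
  by rewrite divr_ge0// ltW ?ub_gt0 ?vb_gt0.
have h2 : norm2 (Gxb k) ^+ 2 <= 2 * norm2 (dPhi (xb k)) ^+ 2 + 2 * norm2 (dPhi (xb k) - Gxb k) ^+ 2.
  have -> : Gxb k = dPhi (xb k) - (dPhi (xb k) - Gxb k) by rewrite opprB addrC subrK.
  rewrite opprB (addrC (dPhi _) (Gxb k - _)) subrK.
  by have := norm2D_sq_le (dPhi (xb k)) (- (dPhi (xb k) - Gxb k)); rewrite norm2N opprB addrC subrK.
have h3 : norm2 (Gxb k) ^+ 2 <= hx k - 2 * inner (Gxb k) (exb k).
  have := gxb_sq k; have -> : gxb k = Gxb k + exb k by rewrite /exb addrC subrK.
  by rewrite norm2D_sq; have := sqr_ge0 (norm2 (exb k)); lra.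
have h4 : hx k / Vm k <= Mr * (hx k / Vm k.+1).
  rewrite mulrCA ler_wpM2l ?hx_ge0// -[leLHS]mul1r ler_pdivrMr// mulrAC ler_pdivlMr// mul1r.
  rewrite (le_trans (VmS_le k))// mulrDl mul1r lerD2l mulrAC ler_pdivlMr//.
  by rewrite ler_wpM2l ?sqr_ge0// Vm_ge.
have := ler_wpM2r (sqr_ge0 (norm2 (Gxb k))) h1.
rewrite mulrDl => h5.
have h6 := ler_wpM2l e0 h2.
have h7 : M / Vm k * norm2 (Gxb k) ^+ 2 <= M * (hx k / Vm k) - M * N7 k.
  have MV : 0 <= M / Vm k by rewrite divr_ge0// ltW.
  rewrite (le_trans (ler_wpM2l MV h3))// /N7 le_eqVlt; apply/orP; left; apply/eqP.
  by move: (hx k) (inner _ _) => x y; ring.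
have h8 := ler_wpM2l M0 h4.
by move: h5 h6 h7 h8; move: (hx k / _) (hx k / _) => x y; lra.
Qed.

Lemma SW_le : aa / 2 * SW <= K5 * (e * (2 * SG + 2 * Gam)) + D5 - \sum_(k < K) N57 k.
Proof.
have h : aa / 2 * SW <= gy^-1 * (\sum_(k < K) ub k * (Wk k - Wk k.+1))
   + K5 * (e * (2 * SG + 2 * Gam)) + K5 * (M * Mr * \sum_(k < K) hx k / Vm k.+1)
   + K5 * r0 ^+ 2 * (C ^+ 2 + Dv / s) * (\sum_(k < K) hx k / Vm k.+1)
   + gx ^+ 2 / gy * T ^+ 2 * r0 * (\sum_(k < K) hx k / vb k.+1) - \sum_(k < K) N57 k.
  rewrite /SG /SW /Gam !mulr_sumr -!big_split/= !mulr_sumr -!big_split -sumrB.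
  apply: ler_sum => k _ /=.
  have := ler_wpM2l K5_ge0 (weighted_gradient k); have := averaging_step k.
  rewrite /N57; move: (K5) (_ ^+ 2 * norm2 (Gxb k) ^+ 2) => k5 X.
  move: (hx k / Vm k.+1) (hx k / vb k.+1) (N7 k) (N5 k) => x1 x2 x3 x4.
  move: (norm2 (dPhi (xb k)) ^+ 2) (norm2 (dPhi (xb k) - Gxb k) ^+ 2) => x5 x6.
  have -> : gy^-1 * (ub k * (Wk k - Wk k.+1)) = ub k / gy * (Wk k - Wk k.+1).
    by move: (Wk k) (Wk k.+1) (ub k) => *; ring.
  move: (ub k / gy * _) => x7; move: (Wk k) => x8.
  move: (gx ^+ 2 / gy * T ^+ 2 * r0 * x2) => x9.
  move: (k5 * r0 ^+ 2 * (C ^+ 2 + Dv / s) * x1) => x10; move: Mr => mr; move: aa => a.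
  by lra.
rewrite (le_trans h)// lerD2r.
have h1 : gy^-1 * (\sum_(k < K) ub k * (Wk k - Wk k.+1)) <= wmax ^+ 2 / gy * Bmax `^ beta.
  rewrite [wmax ^+ 2 / gy]mulrC -mulrA ler_wpM2l ?invr_ge0 ?(ltW gy0)//.
  apply: le_trans (sum_abel K _ ub_mono Wk_ge0 Wk_le) _; first by move=> k; rewrite ltW// ub_gt0.
  by rewrite ler_wpM2l ?sqr_ge0// ub_Bmax.
have Mr0 : 0 <= Mr by rewrite addr_ge0// divr_ge0 ?sqr_ge0 ?(ltW c0).
have h2 : K5 * (M * Mr * \sum_(k < K) hx k / Vm k.+1) <= K5 * (M * Mr * Lg).
  by rewrite ler_wpM2l ?K5_ge0// ler_wpM2l ?sum_hx_Vm// mulr_ge0.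
have h3 : K5 * r0 ^+ 2 * (C ^+ 2 + Dv / s) * (\sum_(k < K) hx k / Vm k.+1) <=
   K5 * r0 ^+ 2 * (C ^+ 2 * Lg + Dv * (s^-1 * Lg)).
  have -> : K5 * r0 ^+ 2 * (C ^+ 2 * Lg + Dv * (s^-1 * Lg)) =
    K5 * r0 ^+ 2 * (C ^+ 2 + Dv / s) * Lg by move: K5 r0 Dv Lg => *; ring.
  rewrite ler_wpM2l ?sum_hx_Vm//.
  exact: mulr_ge0 (mulr_ge0 K5_ge0 (sqr_ge0 _)) (addr_ge0 (sqr_ge0 _) Dvs0).
have h4 : gx ^+ 2 / gy * T ^+ 2 * r0 * (\sum_(k < K) hx k / vb k.+1) <=
   gx ^+ 2 / gy * T ^+ 2 * r0 * (Bmax `^ (1 - alpha) * Lg).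
  rewrite ler_wpM2l ?sum_hx_vb//.
  exact: mulr_ge0 (mulr_ge0 (divr_ge0 (sqr_ge0 _) (ltW gy0)) (sqr_ge0 _)) (ltW r0_gt0).
rewrite /D5; move: h1 h2 h3 h4.
move: (gy^-1 * _) => x1; move: (K5 * (e * _)) => x2.
move: (K5 * (M * Mr * \sum_(k < K) hx k / Vm k.+1)) => x3; move: (K5 * (M * Mr * Lg)) => x4.
move: (K5 * r0 ^+ 2 * _ * _) => x5; move: (K5 * r0 ^+ 2 * _) => x6.
by lra.
Qed.

Definition D6 := DQ / gy * Bmax `^ beta + 4 * L ^+ 2 / mu * BP
  + (mu / 2 + 2 * L ^+ 2 / mu) * BQ + BU
  + gy * T ^+ 2 * n%:R * (1 + eps / aa) * (Bmax `^ (1 - beta) * Lg)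
  + n%:R * Mr * (s^-1 * Bmax `^ (1 - beta) * Lg) + n%:R / eps * Dv * (s^-1 * Lg).

Lemma SE_le : mu / 4 * SE <= cW * SW + D6 + \sum_(k < K) N6 k.
Proof.
have ap := aa_gt0.
have h : mu / 4 * SE <= gy^-1 * (\sum_(k < K) ub k.+1 * (Ek k - Ek k.+1))
   + cW * SW + 4 * L ^+ 2 / mu * SP + (mu / 2 + 2 * L ^+ 2 / mu) * SQ + s * SU
   + (gy * T ^+ 2 * n%:R * (1 + eps / aa) + s^-1 * n%:R * Mr) * (\sum_(k < K) hy k / ub k.+1)
   + n%:R / eps * (Dv / s) * (\sum_(k < K) hy k / Um k.+1) + \sum_(k < K) N6 k.
  rewrite /SE /SW /SP /SQ /SU !mulr_sumr -!big_split; apply: ler_sum => k _ /=.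
  rewrite (le_trans (tracking_step k))//.
  have -> : gy^-1 * (ub k.+1 * (Ek k - Ek k.+1)) = ub k.+1 / gy * (Ek k - Ek k.+1).
    by move: (Ek k) (Ek k.+1) (ub k.+1) => *; ring.
  exact: lexx.
rewrite (le_trans h)// lerD2r.
have DQ0 : 0 <= DQ by exact: le_trans (Qk_ge0 0) (Qk_le 0).
have h1 : gy^-1 * (\sum_(k < K) ub k.+1 * (Ek k - Ek k.+1)) <= DQ / gy * Bmax `^ beta.
  rewrite [DQ / gy]mulrC -mulrA ler_wpM2l ?invr_ge0 ?(ltW gy0)//.
  apply: le_trans (@sum_abel _ (fun k => ub k.+1) Ek DQ K _ _ Ek_ge0 Ek_le) _.
  - by move=> k; rewrite ltW// ub_gt0.
  - by move=> k; exact: ub_mono.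
  by rewrite ler_wpM2l ?ub_Bmax.
have mL : 0 <= L ^+ 2 / mu by rewrite divr_ge0 ?sqr_ge0// ltW.
have h2 : 4 * L ^+ 2 / mu * SP <= 4 * L ^+ 2 / mu * BP.
  by rewrite ler_wpM2l ?SP_le//; lra.
have h3 : (mu / 2 + 2 * L ^+ 2 / mu) * SQ <= (mu / 2 + 2 * L ^+ 2 / mu) * BQ.
  by rewrite ler_wpM2l ?SQ_le//; have := mu0; lra.
have h4 := SU_le.
have Mr0 : 0 <= Mr by rewrite addr_ge0// divr_ge0 ?sqr_ge0 ?(ltW c0).
have g5 : 0 <= gy * T ^+ 2 * n%:R * (1 + eps / aa) + s^-1 * n%:R * Mr.
  apply: addr_ge0; last exact: mulr_ge0 (mulr_ge0 sV0 (ltW nR0)) Mr0.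
  apply: mulr_ge0; first exact: mulr_ge0 (mulr_ge0 (ltW gy0) (sqr_ge0 _)) (ltW nR0).
  exact: addr_ge0 ler01 (divr_ge0 (ltW eps0) (ltW ap)).
have h5 := ler_wpM2l g5 sum_hy_ub.
have g6 : 0 <= n%:R / eps * (Dv / s).
  exact: mulr_ge0 (divr_ge0 (ltW nR0) (ltW eps0)) Dvs0.
have h6 := ler_wpM2l g6 sum_ly.
have e5 : (gy * T ^+ 2 * n%:R * (1 + eps / aa) + s^-1 * n%:R * Mr) * (Bmax `^ (1 - beta) * Lg) =
  gy * T ^+ 2 * n%:R * (1 + eps / aa) * (Bmax `^ (1 - beta) * Lg)
  + n%:R * Mr * (s^-1 * Bmax `^ (1 - beta) * Lg).
  by move: eps aa Mr Lg (Bmax `^ _) => *; ring.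
have e6 : n%:R / eps * (Dv / s) * Lg = n%:R / eps * Dv * (s^-1 * Lg).
  by move: eps Dv Lg => *; ring.
rewrite e5 in h5; rewrite e6 in h6; rewrite /D6.
move: h1 h2 h3 h4 h5 h6.
move: (gy^-1 * _) (4 * L ^+ 2 / mu * SP) (_ * SQ) (s * SU) => x1 x2 x3 x4.
move: (_ * (\sum_(k < K) hy k / ub k.+1)) (_ * (\sum_(k < K) hy k / Um k.+1)) => x5 x6.
move: (DQ / gy * _) (4 * L ^+ 2 / mu * BP) (_ * BQ) BU => x7 x8 x9 x10.
move: (gy * T ^+ 2 * n%:R * (1 + eps / aa) * _) (n%:R * Mr * _) (n%:R / eps * Dv * _) => x11 x12 x13.
by move: (cW * SW) => x14; lra.
Qed.

(* [R4], [R5], [R6] and [R7] weight the descent, averaging, tracking and consensus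
   inequalities, whose right-hand sides are [D4], [D5], [D6] and [BP], in the
   combination that leaves only the squared gradients of [Phi]. *)
Definition gam := 2 * (L ^+ 2 / n%:R) * (4 / mu * cW) + 2 * (L ^+ 2 * kap ^+ 2).
Definition dd := (10 * (gam + 1))^-1.
Definition R4 := 8 / 3 + 128 / 9 * (gam * dd).
Definition R5 := 8 / 3 * gam * (2 / aa).
Definition R6 := 4 / 3 * (1 + 28 / 3 * (gam * dd)) * (2 * (L ^+ 2 / n%:R)) * (4 / mu).
Definition R7 := 4 / 3 * (1 + 28 / 3 * (gam * dd)) * (L ^+ 2 / n%:R).
Definition noise k := - R4 * N4 k - R5 * N57 k + R6 * N6 k.

Let Ln0 : 0 <= L ^+ 2 / n%:R.
Proof. by rewrite divr_ge0 ?sqr_ge0// ltW. Qed.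

Lemma Mr_ge0 : 0 <= Mr.
Proof. by rewrite addr_ge0// divr_ge0 ?sqr_ge0 ?(ltW c0). Qed.

Lemma cW_ge0 : 0 <= cW.
Proof.
have ap := aa_gt0; apply: addr_ge0.
  apply: mulr_ge0; first exact: mulr_ge0 (ltW nR0) (sqr_ge0 _).
  apply: addr_ge0; first exact: divr_ge0 (mulr_ge0 (ltW ap) Mr_ge0) (ler0n _ 2).
  exact: divr_ge0 (mulr_ge0 (sqr_ge0 _) (sqr_ge0 _)) (ltW eps0).
exact: divr_ge0 (mulr_ge0 (mulr_ge0 (ler0n _ 4) (ltW nR0)) (sqr_ge0 _)) (ltW mu0).
Qed.

Let mcW0 : 0 <= 4 / mu * cW.
Proof. exact: mulr_ge0 (divr_ge0 (ler0n _ 4) (ltW mu0)) cW_ge0. Qed.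

Lemma gam_ge0 : 0 <= gam.
Proof.
apply: addr_ge0; first exact: mulr_ge0 (mulr_ge0 (ler0n _ 2) Ln0) mcW0.
exact: mulr_ge0 (ler0n _ 2) (mulr_ge0 (sqr_ge0 _) (sqr_ge0 _)).
Qed.

Lemma dd_ge0 : 0 <= dd.
Proof. by rewrite invr_ge0; have := gam_ge0; move: gam => g; lra. Qed.

Let gd0 : 0 <= gam * dd.
Proof. exact: mulr_ge0 gam_ge0 dd_ge0. Qed.

Let gd1 : 0 <= 4 / 3 * (1 + 28 / 3 * (gam * dd)).
Proof. by have := gd0; move: (gam * dd) => g; lra. Qed.

Lemma R4_ge0 : 0 <= R4. Proof. by have := gd0; rewrite /R4; move: (gam * dd) => g; lra. Qed.
Lemma R5_ge0 : 0 <= R5.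
Proof.
apply: mulr_ge0; first by have := gam_ge0; move: gam => g; lra.
exact: divr_ge0 (ler0n _ 2) (ltW aa_gt0).
Qed.
Lemma R6_ge0 : 0 <= R6.
Proof.
apply: mulr_ge0; last exact: divr_ge0 (ler0n _ 4) (ltW mu0).
exact: mulr_ge0 gd1 (mulr_ge0 (ler0n _ 2) Ln0).
Qed.
Lemma R7_ge0 : 0 <= R7. Proof. exact: mulr_ge0 gd1 Ln0. Qed.

Hypothesis eE : 2 / aa * K5 * e = dd.

(** By [eE], dividing [SW_le] by [aa / 2] gives the squared gradients exactly the coefficient [dd]
    that [absorb] tolerates. *)
Lemma path_total : SG <= R4 * D4 + R5 * D5 + R6 * D6 + R7 * BP + \sum_(k < K) noise k.
Proof.
have ap := aa_gt0; have m0 := mu0.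
have SW0 : 0 <= SW by apply: sumr_ge0 => k _; exact: Wk_ge0.
have dE : dd * (10 * (gam + 1)) = 1.
  by rewrite mulVf// gt_eqF//; have := gam_ge0; move: gam => g; lra.
have g30 : 0 <= 2 * (L ^+ 2 * kap ^+ 2).
  exact: mulr_ge0 (ler0n _ 2) (mulr_ge0 (sqr_ge0 _) (sqr_ge0 _)).
have h4 : SG <= 8 / 3 * (1 / 2 * Gam + (D4 - \sum_(k < K) N4 k)).
  by have := SG_le; lra.
have h6 : SE <= 4 / mu * cW * SW + 4 / mu * (D6 + \sum_(k < K) N6 k).
  have := SE_le; have -> : 4 / mu * cW * SW + 4 / mu * (D6 + \sum_(k < K) N6 k) =
     4 / mu * (cW * SW + D6 + \sum_(k < K) N6 k) by ring.
  rewrite -(ler_pM2l (divr_gt0 (ltr0n R 4) m0)).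
  suff -> : 4 / mu * (mu / 4 * SE) = SE by [].
  by move: SE => x; field; rewrite gt_eqF.
have h5 : SW <= dd * (2 * SG + 2 * Gam) + 2 / aa * (D5 - \sum_(k < K) N57 k).
  have := SW_le; have -> : dd * (2 * SG + 2 * Gam) + 2 / aa * (D5 - \sum_(k < K) N57 k) =
     2 / aa * (K5 * (e * (2 * SG + 2 * Gam)) + D5 - \sum_(k < K) N57 k).
    by rewrite -eE; move: K5 => k5; ring.
  rewrite -(ler_pM2l (divr_gt0 (ltr0n R 2) ap)).
  suff -> : 2 / aa * (aa / 2 * SW) = SW by [].
  by move: SW => x; field; rewrite gt_eqF.
have h := absorb (g := gam) erefl Ln0 (mulr_ge0 (ler0n R 2) Ln0) g30 mcW0 SW0 dd_ge0 dE Gam_le h4 h6 h5.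
rewrite (le_trans h)// sum_combination.
have := ler_wpM2l R7_ge0 SP_le; rewrite /R4 /R5 /R6.
have -> : 4 / 3 * (1 + 28 / 3 * (gam * dd)) * (L ^+ 2 / n%:R) * SP = R7 * SP by [].
move: (R7 * SP) (R7 * BP) => x1 x2.
move: (\sum_(k < K) N4 k) (\sum_(k < K) N57 k) (\sum_(k < K) N6 k) => x3 x4 x5.
move: (8 / 3 + _) => r4; move: (4 / 3 * _ * _) => r6.
by move: D4 D5 D6 gam => x6 x7 x8 g; lra.
Qed.

(** From here to [ktot], each bound is stripped of its factors in K and in the gap. The trajectory
    enters [ktot] only through the initial x, so the constant is uniform in K and [W]. *)
Definition k4 := Delta / gx + PhiL mu L * gx * T ^+ 2 + 2 * Dv.
Definition k5 := wmax ^+ 2 / gy + K5 * (M * Mr) + K5 * r0 ^+ 2 * (C ^+ 2 + Dv)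
  + gx ^+ 2 / gy * T ^+ 2 * r0.
Definition kP := frob (dev (st_x (st 0))) + gx ^+ 2 * cT * r0 ^+ 2.
Definition kQ := DQ + gy ^+ 2 * cT.
Definition k6 := DQ / gy + 4 * L ^+ 2 / mu * kP + (mu / 2 + 2 * L ^+ 2 / mu) * kQ + kQ
  + gy * T ^+ 2 * n%:R * (1 + eps / aa) + n%:R * Mr + n%:R / eps * Dv.
Definition ktot := R4 * k4 + R5 * k5 + R6 * k6 + R7 * kP.

Lemma ktot_bound w : 0 <= w ->
  [/\ Bmax `^ alpha <= w, Bmax `^ beta <= w, Bmax `^ (1 - alpha) * Lg <= w,
      Bmax `^ (1 - beta) * Lg <= w & Lg <= w] ->
  [/\ s^-1 <= w, s^-1 * Lg <= w, s^-1 * Bmax `^ (1 - beta) * Lg <= w &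
      s^-1 ^+ 2 * E2 * Lg <= w] ->
  R4 * D4 + R5 * D5 + R6 * D6 + R7 * BP <= ktot * w.
Proof.
move=> w0 [w1 w2 w3 w4 w5] [w6 w7 w8 w9].
have ap := aa_gt0; have m0 := mu0; have Mp := Mr_ge0.
have D0 : 0 <= Delta by have /andP[h1 h2] := PhiB 0; have := le_trans h1 h2; rewrite lerDl.
have DQ0 : 0 <= DQ by exact: le_trans (Qk_ge0 0) (Qk_le 0).
have M' (a x : R) : 0 <= a -> x <= w -> a * x <= a * w by move=> ? ?; rewrite ler_wpM2l.
have bP : BP <= kP * w.
  rewrite /BP /kP mulrDl lerD// M' ?frob_ge0//.
  exact: mulr_ge0 (mulr_ge0 (sqr_ge0 _) cT0) (sqr_ge0 _).
have bQ : BQ <= kQ * w.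
  by rewrite /BQ /kQ mulrDl lerD// M'//; exact: mulr_ge0 (sqr_ge0 _) cT0.
have bU : BU <= kQ * w.
  by rewrite /BU /kQ mulrDl lerD// M'//; exact: mulr_ge0 (sqr_ge0 _) cT0.
have b4 : D4 <= k4 * w.
  have -> : k4 * w = Delta / gx * w + PhiL mu L * gx * T ^+ 2 * w + 2 * Dv * w.
    by rewrite /k4; move: (PhiL mu L) Dv => *; ring.
  apply: lerD; first apply: lerD; apply: M' => //.
  - exact: divr_ge0 D0 (ltW gx0).
  - exact: mulr_ge0 (mulr_ge0 (PhiL_ge0 mo) (ltW gx0)) (sqr_ge0 _).
  - exact: mulr_ge0 (ler0n _ 2) Dv_ge0.
have b5 : D5 <= k5 * w.
  have -> : k5 * w = wmax ^+ 2 / gy * w + K5 * (M * Mr * w)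
     + K5 * r0 ^+ 2 * (C ^+ 2 * w + Dv * w) + gx ^+ 2 / gy * T ^+ 2 * r0 * w.
    by rewrite /k5; move: wmax K5 r0 Mr Dv => *; ring.
  apply: lerD; first apply: lerD; first apply: lerD.
  - exact: M' (divr_ge0 (sqr_ge0 _) (ltW gy0)) w2.
  - by rewrite ler_wpM2l ?K5_ge0// M'// mulr_ge0.
  - apply: ler_wpM2l; first exact: mulr_ge0 K5_ge0 (sqr_ge0 _).
    by apply: lerD; apply: M' => //; [exact: sqr_ge0|exact: Dv_ge0].
  apply: M' w3; exact: mulr_ge0 (mulr_ge0 (divr_ge0 (sqr_ge0 _) (ltW gy0)) (sqr_ge0 _)) (ltW r0_gt0).
have mL : 0 <= L ^+ 2 / mu by rewrite divr_ge0 ?sqr_ge0// ltW.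
have b6 : D6 <= k6 * w.
  have -> : k6 * w = DQ / gy * w + 4 * L ^+ 2 / mu * (kP * w)
     + (mu / 2 + 2 * L ^+ 2 / mu) * (kQ * w) + kQ * w
     + gy * T ^+ 2 * n%:R * (1 + eps / aa) * w + n%:R * Mr * w + n%:R / eps * Dv * w.
    by rewrite /k6; move: DQ kP kQ Mr Dv eps aa => *; ring.
  apply: lerD; first (apply: lerD; first (apply: lerD; first (apply: lerD; first
    (apply: lerD; first apply: lerD)))) => //.
  - exact: M' (divr_ge0 DQ0 (ltW gy0)) w2.
  - by rewrite ler_wpM2l//; lra.
  - by rewrite ler_wpM2l//; lra.
  - apply: M' w4; apply: mulr_ge0; first exact: mulr_ge0 (mulr_ge0 (ltW gy0) (sqr_ge0 _)) (ltW nR0).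
    exact: addr_ge0 ler01 (divr_ge0 (ltW eps0) (ltW ap)).
  - exact: M' (mulr_ge0 (ltW nR0) Mp) w8.
  - exact: M' (mulr_ge0 (divr_ge0 (ltW nR0) (ltW eps0)) Dv_ge0) w7.
have -> : ktot * w = R4 * (k4 * w) + R5 * (k5 * w) + R6 * (k6 * w) + R7 * (kP * w).
  by rewrite /ktot; move: R4 R5 R6 R7 k4 k5 k6 kP => *; ring.
apply: lerD; first (apply: lerD; first apply: lerD); apply: ler_wpM2l => //.
- exact: R4_ge0.
- exact: R5_ge0.
- exact: R6_ge0.
- exact: R7_ge0.
Qed.

(** Together with [coefy], all factors of the gradient errors; both are built from the state at time
    [k] and from exact gradients there. *)
Definition coefx k : 'rV[R]_p := n%:R^-1 *:
  (- R4 *: dPhi (xb k) - (R5 * (K5 * M * (2 / Vm k))) *: Gxb k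
   - (R5 * (2 * (bb k * (gx / vb k)))) *: ww k).
Definition coefy k i : 'rV[R]_d := R6 *: (2 *: ee k i - (2 * (s^-1 / ub k)) *: Gyr k i).

Lemma noiseE k : noise k = \sum_i inner (coefx k) (gxr k i - Gxr k i)
  + \sum_i inner (coefy k i) (gyr k i - Gyr k i).
Proof.
rewrite -inner_sumr /coefx.
set v := (- R4 *: _ - _ - _).
have -> : inner (n%:R^-1 *: v) (\sum_i (gxr k i - Gxr k i)) = inner v (exb k).
  rewrite innerZl -innerZr /exb /gxb /Gxb; congr (inner _ _).
  by rewrite sumrB scalerBr.
have -> : \sum_i inner (coefy k i) (gyr k i - Gyr k i) = R6 * N6 k.
  rewrite /N6 !mulr_sumr -sumrB mulr_sumr; apply: eq_bigr => i _.
  rewrite -/(eyr k i) /coefy (innerC (eyr k i)).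
  by move: (ee k i) (Gyr k i) (eyr k i) R6 => e' G' h r; rewrite !innerE; ring.
rewrite /v /noise /N57 /N7 /N5 /N4.
move: (dPhi (xb k)) (Gxb k) (ww k) (exb k) R4 R5 R6 K5 => x1 x2 x3 x4 r4 r5 r6 k5'.
by rewrite !innerE; move: (N6 k) (Vm k) (bb k) (vb k) => *; ring.
Qed.

End Horizon.
End Consistent.
End Trajectory.

(** * Rates *)

(** Here [t] stands for [1 / (1 - rho)] and [sV] for [1 / gap]. The horizon condition
    [t^2 <= K^beta] tames the quadratic consensus cost: [t^2] alone is below [K^alpha], and
    [t^2 * K^(1 - 2 * beta)] is below [t * K^(1 - beta)]. *)
Lemma rate_bounds (R : realType) (c C alpha beta : R) : 0 < c -> 0 < beta ->
  beta < alpha -> alpha < 1 ->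
  exists2 w : R, 0 < w & forall (K : nat) (t sV : R), (0 < K)%N -> 1 <= t ->
    t ^+ 2 <= K%:R `^ beta -> 0 <= sV -> sV <= 2 * t ->
    let B := c + C ^+ 2 * K.+1%:R in
    let l := ln B - ln c in
    let Z := (1 + ln K%:R) * (K%:R `^ alpha + t * K%:R `^ (1 - beta)) in
    [/\ B `^ alpha <= w * Z, B `^ beta <= w * Z, B `^ (1 - alpha) * l <= w * Z,
        B `^ (1 - beta) * l <= w * Z & l <= w * Z] /\
    [/\ sV <= w * Z, sV * l <= w * Z, sV * B `^ (1 - beta) * l <= w * Z &
        sV ^+ 2 * (c `^ (1 - 2 * beta) + B `^ (1 - 2 * beta)) * l <= w * Z].
Proof.
move=> c0 b0 ba a1; have a0 : 0 < alpha by exact: lt_trans ba.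
have b1 : beta < 1 by exact: lt_trans a1.
(* Since [K.+1 <= 2 * K], this gives [B <= B0 * K]. *)
set B0 := c + 2 * C ^+ 2; have cB0 : c <= B0 by rewrite lerDl mulr_ge0 ?sqr_ge0.
have B0p : 0 < B0 by exact: lt_le_trans cB0.
set la := 1 + (ln B0 - ln c).
have la1 : 1 <= la by rewrite lerDl subr_ge0 ler_ln ?posrE.
set P := fun a : R => B0 `^ a.
have P0 a : 0 < P a by exact: powR_gt0.
set c' := c `^ (1 - 2 * beta); have c'0 : 0 < c' by exact: powR_gt0.
(* One summand for each of the nine bounds, in the order of the statement. *)
set w := P alpha + P beta + (la * P (1 - alpha) + la * P (1 - beta) + la)
  + (2 + 2 * la + 2 * (la * P (1 - beta)) + 4 * (la * (2 * c' + P (1 - 2 * beta)))).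
have la0 : 0 < la by exact: lt_le_trans la1.
have laP a : 0 < la * P a by exact: mulr_gt0 la0 (P0 a).
have lac : 0 < la * (2 * c' + P (1 - 2 * beta)).
  exact: mulr_gt0 la0 (addr_gt0 (mulr_gt0 (ltr0n R 2) c'0) (P0 _)).
exists w.
  by have := P0 alpha; have := P0 beta; have := laP (1 - alpha); have := laP (1 - beta);
    rewrite /w; lra.
move=> K t sV K0 t1 tK sV0 sVt B l Z.
have K1 : 1 <= K%:R :> R by rewrite ler1n.
have Kp : 0 < K%:R :> R by rewrite ltr0n.
have lK : 0 <= ln K%:R :> R by rewrite ln_ge0.
have t0 : 0 < t by rewrite (lt_le_trans ltr01).
have cB : c <= B by rewrite lerDl mulr_ge0 ?sqr_ge0.
have Bp : 0 < B by exact: lt_le_trans cB.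
have BK : B <= B0 * K%:R.
  rewrite /B /B0 -natr1; have := sqr_ge0 C; move: (C ^+ 2) => q q0.
  have : q * 1 <= q * K%:R by rewrite ler_wpM2l.
  have : c * 1 <= c * K%:R by rewrite ler_wpM2l// ltW.
  by lra.
have l0 : 0 <= l by rewrite subr_ge0 ler_ln ?posrE.
have ll : l <= la * (1 + ln K%:R).
  have : ln B <= ln B0 + ln K%:R.
    by rewrite -lnM ?posrE// ler_ln ?posrE// mulr_gt0.
  rewrite /l; move: la1 lK; rewrite /la; move: (ln B) (ln B0) (ln c) (ln K%:R) => x1 x2 x3 x4.
  by move=> h1 h2 h3; nra.
set Th := K%:R `^ alpha + t * K%:R `^ (1 - beta) in Z *.
have lam1 : 1 <= 1 + ln K%:R :> R by rewrite lerDl.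
have Pk a : 0 < K%:R `^ a :> R by exact: powR_gt0.
have Kle a b : a <= b -> K%:R `^ a <= K%:R `^ b :> R by exact: ler_powR.
have tKb : t * K%:R `^ (1 - beta) <= Th by rewrite lerDr powR_ge0.
have KbT a : a <= 1 - beta -> K%:R `^ a <= Th.
  move=> ab; apply: le_trans tKb; rewrite (le_trans (Kle _ _ ab))//.
  by rewrite -[leLHS]mul1r ler_wpM2r// powR_ge0.
have KaT a : a <= alpha -> K%:R `^ a <= Th.
  by move=> ab; rewrite (le_trans (Kle _ _ ab))// lerDl mulr_ge0 ?powR_ge0// ltW.
have T1 : 1 <= Th by rewrite (le_trans _ (KaT 0 (ltW a0)))// powRr0.
have T0 : 0 < Th by exact: lt_le_trans T1.
have ThZ : Th <= Z by rewrite /Z -[leLHS]mul1r ler_wpM2r// ltW.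
have Z0 : 0 < Z by exact: lt_le_trans ThZ.
have lX x : 0 <= x -> x <= Th -> x * l <= la * Z.
  move=> x0 xT; have -> : la * Z = Th * (la * (1 + ln K%:R)) by rewrite /Z; ring.
  exact: ler_pM.
have Bpow a : 0 <= a -> B `^ a <= P a * K%:R `^ a.
  by move=> a0'; rewrite -powRM ?(ltW B0p)// powR_le// ltW.
have tT : t <= Th.
  apply: le_trans tKb; rewrite -[leLHS]mulr1 ler_wpM2l ?(ltW t0)//.
  by rewrite -[leLHS](powRr0 (K%:R : R)); apply: Kle; lra.
have tb : t <= K%:R `^ beta by rewrite (le_trans _ tK)// expr2 ler_peMl// ltW.
have W x y : x <= y * Z -> y <= w -> x <= w * Z.
  by move=> xy yw; rewrite (le_trans xy)// ler_wpM2r// ltW.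
have wge : [/\ P alpha <= w, P beta <= w, la * P (1 - alpha) <= w, la * P (1 - beta) <= w &
    la <= w] /\ [/\ 2 <= w, 2 * la <= w, 2 * (la * P (1 - beta)) <= w &
    4 * (la * (2 * c' + P (1 - 2 * beta))) <= w].
  have := P0 alpha; have := P0 beta; have := laP (1 - alpha); have := laP (1 - beta).
  by rewrite /w; do ?split; lra.
have {}wge := wge; case: wge => [[w1 w2 w3 w4 w5] [w6 w7 w8 w9]].
have sT : 0 <= sV * l by rewrite mulr_ge0.
do ?split.
- apply: W w1; rewrite (le_trans (Bpow _ (ltW a0)))// ler_wpM2l ?(ltW (P0 _))//.
  exact: le_trans (KaT _ (lexx _)) ThZ.
- apply: W w2; rewrite (le_trans (Bpow _ (ltW b0)))// ler_wpM2l ?(ltW (P0 _))//.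
  exact: le_trans (KaT _ (ltW ba)) ThZ.
- apply: W w3; have a10 : 0 <= 1 - alpha by lra.
  have h : B `^ (1 - alpha) * l <= P (1 - alpha) * (K%:R `^ (1 - alpha) * l).
    by rewrite mulrA ler_wpM2r// Bpow.
  rewrite (le_trans h)//; have -> : la * P (1 - alpha) * Z = P (1 - alpha) * (la * Z) by ring.
  by rewrite ler_wpM2l ?(ltW (P0 _))// lX ?powR_ge0//; apply: KbT; lra.
- apply: W w4; have a10 : 0 <= 1 - beta by lra.
  have h : B `^ (1 - beta) * l <= P (1 - beta) * (K%:R `^ (1 - beta) * l).
    by rewrite mulrA ler_wpM2r// Bpow.
  rewrite (le_trans h)//; have -> : la * P (1 - beta) * Z = P (1 - beta) * (la * Z) by ring.
  by rewrite ler_wpM2l ?(ltW (P0 _))// lX ?powR_ge0//; apply: KbT; lra.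
- by apply: W w5; rewrite -[l]mul1r lX.
- apply: W w6; rewrite (le_trans sVt)// ler_wpM2l//; exact: le_trans tT ThZ.
- apply: W w7; rewrite -mulrA (le_trans (ler_wpM2r l0 sVt))// -mulrA ler_wpM2l// lX ?(ltW t0)//.
- apply: W w8; have a10 : 0 <= 1 - beta by rewrite subr_ge0 ltW.
  apply: (@le_trans _ _ (2 * t * (P (1 - beta) * K%:R `^ (1 - beta)) * l)).
    by rewrite ler_wpM2r//; apply: ler_pM; rewrite ?powR_ge0 ?Bpow.
  have -> : 2 * t * (P (1 - beta) * K%:R `^ (1 - beta)) * l =
    2 * (P (1 - beta) * (t * K%:R `^ (1 - beta) * l)) by ring.
  have -> : 2 * (la * P (1 - beta)) * Z = 2 * (P (1 - beta) * (la * Z)) by ring.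
  by rewrite ler_wpM2l// ler_wpM2l ?(ltW (P0 _))// lX// mulr_ge0 ?powR_ge0// ltW.
apply: W w9.
have e1 : c `^ (1 - 2 * beta) + B `^ (1 - 2 * beta) <=
    2 * c' + P (1 - 2 * beta) * K%:R `^ (1 - 2 * beta).
  have := powR_between (1 - 2 * beta) c0 cB BK.
  by rewrite powRM ?(ltW B0p)// -/c' -/(P _); lra.
have e2 : sV ^+ 2 <= 4 * t ^+ 2.
  by have := le_sqr sV0 sVt; rewrite exprMn; lra.
apply: (@le_trans _ _ (4 * t ^+ 2 * (2 * c' + P (1 - 2 * beta) * K%:R `^ (1 - 2 * beta)) * l)).
  by rewrite ler_wpM2r//; apply: ler_pM; rewrite ?sqr_ge0 ?addr_ge0 ?powR_ge0.
have -> : 4 * t ^+ 2 * (2 * c' + P (1 - 2 * beta) * K%:R `^ (1 - 2 * beta)) * l =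
  4 * (2 * c' * (t ^+ 2 * l) + P (1 - 2 * beta) * (t ^+ 2 * K%:R `^ (1 - 2 * beta) * l)) by ring.
have -> : 4 * (la * (2 * c' + P (1 - 2 * beta))) * Z =
  4 * (2 * c' * (la * Z) + P (1 - 2 * beta) * (la * Z)) by ring.
rewrite ler_wpM2l//; apply: lerD.
  rewrite ler_wpM2l ?mulr_ge0 ?(ltW c'0)// lX ?sqr_ge0//.
  exact: le_trans tK (KaT _ (ltW ba)).
rewrite ler_wpM2l ?(ltW (P0 _))// lX ?(mulr_ge0 (sqr_ge0 t) (powR_ge0 _ _))//.
rewrite (le_trans _ tKb)// expr2 -mulrA ler_wpM2l ?(ltW t0)//.
apply: (@le_trans _ _ (K%:R `^ beta * K%:R `^ (1 - 2 * beta))).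
  by rewrite ler_wpM2r ?powR_ge0.
by rewrite (powR_sum_exp Kp erefl) Kle//; lra.
Qed.

(** * Independence of the past and measurability *)

Section Independence.
Context {R : realType} {dO : measure_display} {Omega : measurableType dO}.
Variable P : probability Omega R.
Context {J : eqType} {dE : J -> measure_display} {E : forall j, measurableType (dE j)}.
Variable X : forall j, Omega -> E j.
Hypothesis mX : forall j, measurable_fun setT (X j).
Hypothesis indep : mutually_independent P X.

(** A pi-system generating the past: finitely many past samples are constrained, each by a
    measurable set. *)
Definition cylinders (past : pred J) : set (set Omega) :=
  [set A | exists s : seq J, exists B : forall j, set (E j),
    [/\ uniq s, all past s, (forall j, measurable (B j)) &
        A = \big[setI/setT]_(j <- s) (X j @^-1` B j)]].

Lemma cylinder_in (s : seq J) (B : forall j, set (E j)) w :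
  (\big[setI/setT]_(j <- s) (X j @^-1` B j)) w <-> forall j, j \in s -> B j (X j w).
Proof.
elim: s => [|i s IH]; first by rewrite big_nil; split.
rewrite big_cons; split => [[Bi /IH Bs] j|Bs].
  by rewrite inE => /predU1P[->|/Bs].
split; first by apply: Bs; rewrite mem_head.
by apply/IH => j js; apply: Bs; rewrite inE js orbT.
Qed.

Lemma measurable_cylinder past A : cylinders past A -> measurable A.
Proof.
move=> [s [B [_ _ mB ->]]]; elim/big_ind: _ => //; first exact: measurableI.
by move=> j _; rewrite -[X in measurable X]setTI; exact: mX.
Qed.

Lemma cylinders_setI past : setI_closed (cylinders past).
Proof.
move=> _ _ [s1 [B1 [u1 p1 m1 ->]]] [s2 [B2 [u2 p2 m2 ->]]].
exists (undup (s1 ++ s2)).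
exists (fun j => (if j \in s1 then B1 j else setT) `&` (if j \in s2 then B2 j else setT)).
split; first exact: undup_uniq.
- by apply/allP => j; rewrite mem_undup mem_cat => /orP[/(allP p1)|/(allP p2)].
- by move=> j; apply: measurableI; case: ifP.
apply/seteqP; split => w.
  move=> [/cylinder_in w1 /cylinder_in w2].
  apply/cylinder_in => j _; split.
    by case: ifPn => // js; exact: w1.
  by case: ifPn => // js; exact: w2.
move=> /cylinder_in w12; split; apply/cylinder_in => j js.
  by have := w12 j; rewrite mem_undup mem_cat js => /(_ isT) [].
by have := w12 j; rewrite mem_undup mem_cat js orbT => /(_ isT) [].
Qed.

Lemma cylindersT past : cylinders past setT.
Proof. by exists [::], (fun=> setT); split => //; rewrite big_nil. Qed.

(* [Omega] with only the events determined by the observations in [past]. *)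
Definition history past := g_sigma_algebraType (cylinders past).

Lemma history_sub past (A : set (history past)) :
  measurable A -> measurable (A : set Omega).
Proof.
apply: smallest_sub => [|B /measurable_cylinder//].
split => [|B mB|F mF]; [exact: measurable0| |exact: bigcup_measurable].
by apply: measurableD.
Qed.

Lemma history_mono past past' : {subset past <= past'} ->
  forall A : set (history past), measurable A -> measurable (A : set (history past')).
Proof.
move=> pp A; apply: smallest_sub.
  split => [|B mB|F mF]; [exact: measurable0| |exact: bigcup_measurable].
  by apply: measurableD.
move=> B [s [G [us ps mG ->]]]; apply: sub_sigma_algebra.
by exists s, G; split => //; apply/allP => j /(allP ps) /pp.
Qed.

Lemma measurable_history past past' d (T : measurableType d) (f : Omega -> T) :
  {subset past <= past'} ->
  measurable_fun setT (f : history past -> T) -> measurable_fun setT (f : history past' -> T).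
Proof.
move=> pp mf _ B mB; rewrite setTI; apply: (history_mono pp).
by rewrite -[X in measurable X]setTI; exact: mf.
Qed.

Lemma measurable_history_base past d (T : measurableType d) (f : Omega -> T) :
  measurable_fun setT (f : history past -> T) -> measurable_fun setT f.
Proof.
move=> mf _ B mB; rewrite setTI; apply: (@history_sub past).
by rewrite -[X in measurable X]setTI; exact: mf.
Qed.

Lemma measurable_observed (past : pred J) j : past j -> measurable_fun setT (X j : history past -> E j).
Proof.
move=> pj _ B mB; rewrite setTI; apply: sub_sigma_algebra.
(* The sets form a family over dependent types, so [B] is inserted at [j] by overwriting the trivial
   family. *)
exists [:: j], (eqtype.dfwith (fun j : J => [set: E j]) B); split => //=; first by rewrite pj.
  by move=> i; case: (eqtype.dfwithP (fun j : J => [set: E j]) B i) => //.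
by rewrite big_seq1 dfwith_in.
Qed.

Section Fresh.
Variables (past : pred J) (j0 : J) (D : probability (E j0) R).
Hypothesis j0_fresh : ~~ past j0.
Hypothesis XD : forall B, measurable B -> P (X j0 @^-1` B) = D B.

(** The identity into the coarser sigma-algebra; pushing [P] forward along it restricts [P] to the
    past. *)
Let idH : Omega -> history past := id.
Let m_idH : measurable_fun setT idH.
Proof. by apply: (@measurable_history_base past); exact: measurable_id. Qed.

(** Both sides, as functions of [A], are finite measures on the past. They agree on cylinders by
    mutual independence of [j0 :: s], hence everywhere by uniqueness on a pi-system. *)
Lemma fresh_independent (A : set (history past)) (B : set (E j0)) :
  measurable A -> measurable B ->
  P ((A : set Omega) `&` X j0 @^-1` B) = (P A * D B)%E.
Proof.
move=> mA mB; have mXB : measurable (X j0 @^-1` B).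
  by rewrite -[X in measurable X]setTI; exact: mX.
pose PB : {measure set Omega -> \bar R} := mrestr P mXB.
pose m1 : {measure set (history past) -> \bar R} :=
  measure_function_pushforward__canonical__measure_function_Measure PB m_idH.
have DB0 : (0 <= fine (D B))%R by rewrite fine_ge0.
pose PH : {measure set (history past) -> \bar R} :=
  measure_function_pushforward__canonical__measure_function_Measure P m_idH.
pose m2 : {measure set (history past) -> \bar R} := mscale (NngNum DB0) PH.
have m2E A' : m2 A' = (P A' * D B)%E.
  by rewrite /m2 /= /mscale/= fineK ?fin_num_measure// muleC.
have -> : P ((A : set Omega) `&` X j0 @^-1` B) = m1 A by [].
rewrite -m2E; refine (@measure_unique _ R (history past) (cylinders past) (fun=> setT) erefl _ _ _ m1 m2 _ _ A mA).
- exact: cylinders_setI.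
- by move=> _; exact: cylindersT.
- by rewrite bigcup_const//; exists 0%N.
- move=> _ [s [G [us ps mG ->]]]; rewrite m2E.
  have j0s : j0 \notin s by apply: contra j0_fresh => /(allP ps).
  have := indep (s := j0 :: s) (B := eqtype.dfwith G B).
  rewrite /= j0s us => /(_ isT) h.
  have mG' j : measurable (eqtype.dfwith G B j) by case: eqtype.dfwithP.
  have {h} := h mG'; rewrite !big_cons dfwith_in.
  have E1 : \big[setI/setT]_(j <- s) (X j @^-1` eqtype.dfwith G B j) =
      \big[setI/setT]_(j <- s) (X j @^-1` G j).
    rewrite big_seq [RHS]big_seq; apply: eq_bigr => j js.
    by rewrite dfwith_out//; apply: contraNneq j0s => ->.
  have E2 : (\prod_(j <- s) P (X j @^-1` eqtype.dfwith G B j) = \prod_(j <- s) P (X j @^-1` G j))%E.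
    rewrite big_seq [RHS]big_seq; apply: eq_bigr => j js.
    by rewrite dfwith_out//; apply: contraNneq j0s => ->.
  rewrite E1 E2 -(indep us mG) XD// setIC muleC => <-.
  by [].
move=> _; rewrite /m1/= /pushforward /PB/= /mrestr.
by apply: le_lt_trans (probability_le1 P _) (ltry 1); rewrite setTI.
Qed.

Let XH w : history past * E j0 := (idH w, X j0 w).
Let m_XH : measurable_fun setT XH.
Proof. by apply/measurable_fun_pairP; split. Qed.

(** Takes the place of a conditional expectation: the joint law of the past and the fresh sample is
    a product, so Fubini integrates the sample first with the past frozen. *)
Lemma integral_fresh_eq0 (phi : history past * E j0 -> R) (M : R) :
  measurable_fun setT phi -> (forall z, `|phi z| <= M) ->
  (forall w, (\int[D]_s (phi (w, s))%:E = 0)%E) ->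
  (\int[P]_w (phi (w, X j0 w))%:E = 0)%E.
Proof.
move=> mphi bphi phi0.
pose idm : {mfun Omega >-> history past} :=
  MeasurableFun.Pack (MeasurableFun.Class (isMeasurableFun.Build _ _ _ _ _ m_idH)).
pose XHm : {mfun Omega >-> (history past * E j0)%type} :=
  MeasurableFun.Pack (MeasurableFun.Class (isMeasurableFun.Build _ _ _ _ _ m_XH)).
pose PH : probability (history past) R := distribution P idm.
pose PX : probability (history past * E j0)%type R := distribution P XHm.
have /measurable_EFinP mE := mphi.
have prodE (A : set (history past * E j0)) : measurable A -> (PH \x D)%E A = PX A.
  move=> mA; apply: (product_measure_unique (m' := PX)) => // A' B' mA' mB'.
  exact: fresh_independent.
have iP : P.-integrable setT (EFin \o (phi \o XH)).
  apply: measurable_bounded_integrable => //.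
  - by rewrite -ge0_fin_numE// fin_num_measure.
  - exact: measurableT_comp.
  by exists M; split; [exact: num_real|move=> r Mr w _ /=; rewrite (le_trans (bphi _))// ltW].
have -> : (\int[P]_w (phi (w, X j0 w))%:E = \int[PX]_z (phi z)%:E)%E.
  rewrite (@integral_pushforward _ _ _ _ _ XH m_XH P setT (EFin \o phi))//.
have -> : (\int[PX]_z (phi z)%:E = \int[PH \x D]_z (phi z)%:E)%E.
  by apply: eq_measure_integral => A mA _; exact: (esym (prodE A mA)).
have iPD : (PH \x D)%E.-integrable setT (EFin \o phi).
  apply: measurable_bounded_integrable => //.
  - have h : (PX setT < +oo)%E by exact: le_lt_trans (probability_le1 PX measurableT) (ltry 1).
    exact: (eq_ind_r (fun x => x < +oo)%E h (prodE setT measurableT)).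
  by exists M; split; [exact: num_real|move=> r Mr w _ /=; rewrite (le_trans (bphi _))// ltW].
rewrite -(integral12_prod_meas1 iPD).
by under eq_integral do rewrite /fubini_F phi0; rewrite integral0.
Qed.

End Fresh.
End Independence.

(** * Borel measurability of pairs of vectors from their coordinates *)

Section RationalBoxes.
Context {R : realType} {p d : nat}.
Local Notation idx := ({ffun 'I_p -> rat} * {ffun 'I_d -> rat} * rat)%type.

Definition box (q : idx) : set ('rV[R]_p * 'rV[R]_d) :=
  [set z : 'rV[R]_p * 'rV[R]_d | (forall i, `|z.1 0 i - ratr (q.1.1 i)| < ratr q.2) /\
           (forall i, `|z.2 0 i - ratr (q.1.2 i)| < ratr q.2)].

Lemma rational_approx k (x : 'rV[R]_k) (r : R) : 0 < r ->
  exists q : {ffun 'I_k -> rat}, forall i, `|x 0 i - ratr (q i)| < r.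
Proof.
move=> r0; have H i : exists q : rat, `|x 0 i - ratr q| < r.
  have [q] : exists q : rat, (ratr q : R) \in `]x 0 i - r, x 0 i[.
    by apply: rat_in_itvoo; rewrite gtrBl.
  rewrite in_itv/= => /andP[q1 q2]; exists q.
  by rewrite ger0_norm ?subr_ge0 ?(ltW q2)//; lra.
have [q qP] := choice H.
by exists [ffun i => q i] => i; rewrite ffunE.
Qed.

Lemma open_box_cover (U : set ('rV[R]_p * 'rV[R]_d)) : open U ->
  U = \bigcup_q (box q `&` [set z : 'rV[R]_p * 'rV[R]_d | box q `<=` U]).
Proof.
move=> oU; apply/seteqP; split => [z Uz|z [q _ [qz qU]]]; last exact: qU.
have /nbhs_ballP[e /= e0 eU] : nbhs z U by exact: open_nbhs_nbhs.
(* [z] and any point of the box are both within [r] of its centre, so [2 * r < e] keeps the box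
   inside the ball. *)
have [r] : exists r : rat, (ratr r : R) \in `]e / 4, e / 2[.
  by apply: rat_in_itvoo; lra.
rewrite in_itv/= => /andP[r1 r2].
have r0 : 0 < ratr r :> R by lra.
have [q1 q1P] := rational_approx z.1 r0; have [q2 q2P] := rational_approx z.2 r0.
exists (q1, q2, r) => //; split; first by split.
move=> z' [z1 z2]; apply: eU; split.
  split=> // i j; rewrite (ord1 i) /ball/=; have := z1 j; have := q1P j => /=.
  by rewrite !ltr_norml => /andP[? ?] /andP[? ?]; apply/andP; split; lra.
split=> // i j; rewrite (ord1 i) /ball/=; have := z2 j; have := q2P j => /=.
by rewrite !ltr_norml => /andP[? ?] /andP[? ?]; apply/andP; split; lra.
Qed.

Context {dT : measure_display} {T : measurableType dT}.

Lemma measurable_pair_borel (f : T -> 'rV[R]_p) (h : T -> 'rV[R]_d) :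
  (forall i, measurable_fun setT (fun w => f w 0 i)) ->
  (forall i, measurable_fun setT (fun w => h w 0 i)) ->
  measurable_fun setT ((fun w => (f w, h w)) : T -> borel ('rV[R]_p * 'rV[R]_d)%type).
Proof.
move=> mf mh; refine (@measurability _ _ _ (borel ('rV[R]_p * 'rV[R]_d)%type) setT _ (@open ('rV[R]_p * 'rV[R]_d)%type) erefl _).
move=> _ [U oU <-]; rewrite setTI (open_box_cover oU) preimage_bigcup.
apply: countable_bigcupT_measurable => [|q]; first exact: countableP.
have [qU|qU] := pselect (box q `<=` U); last first.
  rewrite (_ : _ @^-1` _ = set0)//; apply/seteqP; split => // w [_ /= h']; exact: qU.
rewrite (_ : _ @^-1` _ =
  (\bigcap_i (fun w => f w 0 i) @^-1` `](ratr (q.1.1 i) - ratr q.2 : R), ratr (q.1.1 i) + ratr q.2[%classic) `&`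
  (\bigcap_i (fun w => h w 0 i) @^-1` `](ratr (q.1.2 i) - ratr q.2 : R), ratr (q.1.2 i) + ratr q.2[%classic)).
  apply: measurableI.
    by apply: fin_bigcap_measurable => // i _; rewrite -[X in measurable X]setTI; exact: mf.
  by apply: fin_bigcap_measurable => // i _; rewrite -[X in measurable X]setTI; exact: mh.
apply/seteqP; split => w /=.
  move=> [[q1 q2] _]; split => i _ /=; rewrite in_itv/=.
    by have := q1 i; rewrite ltr_norml => /andP[? ?]; apply/andP; split; lra.
  by have := q2 i; rewrite ltr_norml => /andP[? ?]; apply/andP; split; lra.
move=> [q1 q2]; split => //; split => i /=.
  have := q1 i I; rewrite /= in_itv/= => /andP[? ?].
  by rewrite ltr_norml; apply/andP; split; lra.
have := q2 i I; rewrite /= in_itv/= => /andP[? ?].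
by rewrite ltr_norml; apply/andP; split; lra.
Qed.

Lemma measurable_continuous_pair (g : 'rV[R]_p * 'rV[R]_d -> R)
    (f : T -> 'rV[R]_p) (h : T -> 'rV[R]_d) :
  continuous g ->
  (forall i, measurable_fun setT (fun w => f w 0 i)) ->
  (forall i, measurable_fun setT (fun w => h w 0 i)) ->
  measurable_fun setT (fun w => g (f w, h w)).
Proof.
move=> cg mf mh.
have mg : measurable_fun setT (g : borel ('rV[R]_p * 'rV[R]_d)%type -> R).
  refine (@measurability _ _ (borel ('rV[R]_p * 'rV[R]_d)%type) _ setT _ (@RGenOInfty.G R) (RGenOInfty.measurableE R) _).
  move=> _ [_ [a ->] <-]; rewrite setTI; apply: sub_sigma_algebra.
  by move/continuousP : cg; apply; exact: interval_open.
exact: (measurableT_comp mg (measurable_pair_borel mf mh)).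
Qed.

End RationalBoxes.

(** * Calculus of bounded measurable functions *)

Section BoundedMeasurable.
Context {R : realType} {dT : measure_display} {T : measurableType dT}.
Implicit Types f g : T -> R.

(** Boundedness is carried along because the pair is stable under products and implies integrability
    for every probability. *)
Definition bmeas f := measurable_fun setT f /\ exists M, forall w, `|f w| <= M.

Lemma bmeas_cst a : bmeas (fun=> a).
Proof. by split; [exact: measurable_cst|exists `|a|]. Qed.

Lemma bmeasD f g : bmeas f -> bmeas g -> bmeas (fun w => f w + g w).
Proof.
move=> [mf [M bf]] [mg [N bg]]; split; first exact: measurable_funD.
by exists (M + N) => w; rewrite (le_trans (ler_normD _ _))// lerD.
Qed.

Lemma bmeasN f : bmeas f -> bmeas (fun w => - f w).
Proof.
move=> [mf [M bf]]; split; first exact: measurableT_comp.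
by exists M => w; rewrite normrN.
Qed.

Lemma bmeasB f g : bmeas f -> bmeas g -> bmeas (fun w => f w - g w).
Proof. by move=> bf bg; apply: bmeasD => //; exact: bmeasN. Qed.

Lemma bmeasM f g : bmeas f -> bmeas g -> bmeas (fun w => f w * g w).
Proof.
move=> [mf [M bf]] [mg [N bg]]; split; first exact: measurable_funM.
by exists (M * N) => w; rewrite normrM ler_pM.
Qed.

Lemma bmeas_sum (I : Type) (s : seq I) (f : I -> T -> R) :
  (forall i, bmeas (f i)) -> bmeas (fun w => \sum_(i <- s) f i w).
Proof.
move=> bf; elim: s => [|i s IH].
  by under eq_fun do rewrite big_nil; exact: bmeas_cst.
by under eq_fun do rewrite big_cons; exact: bmeasD.
Qed.

Lemma bmeas_powR f (c a : R) : 0 < c -> (forall w, c <= f w) -> bmeas f ->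
  bmeas (fun w => f w `^ a).
Proof.
move=> c0 cf [mf [M bf]]; split.
  by apply: (measurableT_comp (measurable_powR a)).
exists (c `^ a + M `^ a) => w; rewrite ger0_norm ?powR_ge0//.
by rewrite powR_between// (le_trans (ler_norm _) (bf w)).
Qed.

Lemma bmeasV f (c : R) : 0 < c -> (forall w, c <= f w) -> bmeas f ->
  bmeas (fun w => (f w)^-1).
Proof.
move=> c0 cf bf; have -> : (fun w => (f w)^-1) = (fun w => f w `^ (-1)).
  by apply/funext => w; rewrite powR_inv1// (le_trans (ltW c0)).
exact: bmeas_powR c0 cf bf.
Qed.

Lemma bmeas_max f g : bmeas f -> bmeas g -> bmeas (fun w => Num.max (f w) (g w)).
Proof.
move=> [mf [M bf]] [mg [N bg]]; split; first exact: measurable_maxr.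
exists (`|M| + `|N|) => w; have fM := bf w; have gN := bg w.
rewrite /Num.max; case: ifP => _.
  by rewrite (le_trans gN)// (le_trans (ler_norm _))// lerDr.
by rewrite (le_trans fM)// (le_trans (ler_norm _))// lerDl.
Qed.

Definition bmeas_mx m n (A : T -> 'M[R]_(m, n)) := forall i j, bmeas (fun w => A w i j).

Lemma bmeas_row m n (A : T -> 'M[R]_(m, n)) i : bmeas_mx A -> bmeas_mx (fun w => row i (A w)).
Proof. by move=> bA k j; under eq_fun do rewrite mxE. Qed.

Lemma eq_bmeas f g : f =1 g -> bmeas f -> bmeas g.
Proof. by move=> /funext ->. Qed.

Lemma bmeas_rows m n (A : T -> 'M[R]_(m, n)) (r : 'I_m -> T -> 'rV[R]_n) :
  (forall i w, row i (A w) = r i w) -> (forall i, bmeas_mx (r i)) -> bmeas_mx A.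
Proof.
move=> rA br i j; apply: eq_bmeas (br i 0 j) => w.
by rewrite -rA mxE.
Qed.

Lemma bmeas_mxD m n (A B : T -> 'M[R]_(m, n)) :
  bmeas_mx A -> bmeas_mx B -> bmeas_mx (fun w => A w + B w).
Proof. by move=> bA bB i j; under eq_fun do rewrite mxE; exact: bmeasD. Qed.

Lemma bmeas_mxN m n (A : T -> 'M[R]_(m, n)) :
  bmeas_mx A -> bmeas_mx (fun w => - A w).
Proof. by move=> bA i j; under eq_fun do rewrite mxE; exact: bmeasN. Qed.

Lemma bmeas_mxB m n (A B : T -> 'M[R]_(m, n)) :
  bmeas_mx A -> bmeas_mx B -> bmeas_mx (fun w => A w - B w).
Proof. by move=> bA bB; apply: bmeas_mxD => //; exact: bmeas_mxN. Qed.

Lemma bmeas_mxZ m n (a : T -> R) (A : T -> 'M[R]_(m, n)) :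
  bmeas a -> bmeas_mx A -> bmeas_mx (fun w => a w *: A w).
Proof. by move=> ba bA i j; under eq_fun do rewrite mxE; exact: bmeasM. Qed.

Lemma bmeas_mulmx m n k (A : T -> 'M[R]_(m, n)) (B : T -> 'M[R]_(n, k)) :
  bmeas_mx A -> bmeas_mx B -> bmeas_mx (fun w => A w *m B w).
Proof.
move=> bA bB i j; under eq_fun do rewrite mxE.
by apply: bmeas_sum => l; exact: bmeasM.
Qed.

Lemma bmeas_mx_cst m n (A : 'M[R]_(m, n)) : bmeas_mx (fun=> A).
Proof. by move=> i j; exact: bmeas_cst. Qed.

Lemma bmeas_mx_sum m n (I : finType) (A : I -> T -> 'M[R]_(m, n)) :
  (forall i, bmeas_mx (A i)) -> bmeas_mx (fun w => \sum_i A i w).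
Proof. by move=> bA i j; under eq_fun do rewrite summxE; apply: bmeas_sum => l; exact: bA. Qed.

Lemma bmeas_avg_row m n (A : T -> 'M[R]_(m, n)) :
  bmeas_mx A -> bmeas_mx (fun w => avg_row (A w)).
Proof.
move=> bA; apply: bmeas_mxZ; first exact: bmeas_cst.
by apply: bmeas_mx_sum => i; exact: bmeas_row.
Qed.

Lemma bmeas_inner n (u v : T -> 'rV[R]_n) :
  bmeas_mx u -> bmeas_mx v -> bmeas (fun w => inner (u w) (v w)).
Proof. by move=> bu bv; apply: bmeas_sum => j; exact: bmeasM. Qed.

Lemma lipschitz_continuous p d k (g : 'rV[R]_p * 'rV[R]_d -> 'rV[R]_k) (M : R) j :
  (forall z z', norm2 (g z - g z') <= M * (norm2 (z.1 - z'.1) + norm2 (z.2 - z'.2))) ->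
  continuous (fun z => g z 0 j).
Proof.
move=> gL z; apply/cvgrPdist_lt => e e0.
have M1 : 0 < `|M| * (p%:R + d%:R) + 1 by rewrite ltr_wpDl ?mulr_ge0 ?addr_ge0.
near=> t.
have h : `|z - t| < e / (`|M| * (p%:R + d%:R) + 1).
  by near: t; apply: cvgr_dist_lt; [exact: cvg_id|rewrite divr_gt0].
have z1 : `|z.1 - t.1| <= `|z - t| by rewrite /Num.norm/= le_max lexx.
have z2 : `|z.2 - t.2| <= `|z - t| by rewrite /Num.norm/= le_max lexx orbT.
have -> : g z 0 j - g t 0 j = (g z - g t) 0 j by rewrite !mxE.
rewrite (le_lt_trans (coord_norm2 _ _))// (le_lt_trans (gL _ _))//.
have n1 := norm2_le_norm (z.1 - t.1); have n2 := norm2_le_norm (z.2 - t.2).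
have m1 : p%:R * `|z.1 - t.1| <= p%:R * `|z - t| by rewrite ler_wpM2l.
have m2 : d%:R * `|z.2 - t.2| <= d%:R * `|z - t| by rewrite ler_wpM2l.
have s0 : 0 <= norm2 (z.1 - t.1) + norm2 (z.2 - t.2) by rewrite addr_ge0 ?norm2_ge0.
have h1 : M * (norm2 (z.1 - t.1) + norm2 (z.2 - t.2)) <=
    `|M| * ((p%:R + d%:R) * `|z - t|).
  rewrite (le_trans (ler_wpM2r s0 (ler_norm M)))// ler_wpM2l// mulrDl.
  by rewrite lerD// (le_trans n1, le_trans n2).
have zt0 : 0 <= `|z - t| by [].
move: h; rewrite ltr_pdivlMr// mulrDr mulr1 => h.
rewrite (le_lt_trans h1)// (le_lt_trans _ h)//.
by rewrite [`|z - t| * _]mulrC -mulrA lerDl.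
Unshelve. all: by end_near. Qed.

(** Projections, maximisers and gradient fields have no formula to compose; their measurability
    comes from a global Lipschitz bound. *)
Lemma bmeas_lipschitz p d k (g : 'rV[R]_p * 'rV[R]_d -> 'rV[R]_k) (L M : R)
    (f : T -> 'rV[R]_p) (h : T -> 'rV[R]_d) :
  (forall z z', norm2 (g z - g z') <= L * (norm2 (z.1 - z'.1) + norm2 (z.2 - z'.2))) ->
  (forall z, norm2 (g z) <= M) -> bmeas_mx f -> bmeas_mx h ->
  bmeas_mx (fun w => g (f w, h w)).
Proof.
move=> gL gM bf bh i j; rewrite (ord1 i); split; last first.
  by exists M => w; rewrite (le_trans (coord_norm2 _ _)).
apply: (measurable_continuous_pair (g := fun z => g z 0 j)).
- exact: lipschitz_continuous gL.
- by move=> l; have [] := bf 0 l.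
- by move=> l; have [] := bh 0 l.
Qed.

End BoundedMeasurable.

(** * From the sampling model of one node to its exact gradients *)

Section Node.
Context {R : realType} {p d : nat} {dS : measure_display} {S : measurableType dS}.
Variables (Y : set 'rV[R]_d) (D : probability S R) (F : 'rV[R]_p -> 'rV[R]_d -> S -> R).
Variables (L C : R).
Hypothesis cY : closed Y.
Hypothesis smF : smooth L Y (expected_obj D F).
Hypothesis sgF : stochastic_gradients C Y D F.

Local Notation f := (expected_obj D F).
Local Notation Fs s := (fun x y => F x y s).

Lemma is_derive_expected_obj x h y (t : R) : Y y ->
  is_derive t (1 : R) (fun s : R => f (x + s *: h) y) (inner (gradx f (x + t *: h) y) h).
Proof.
move=> Yy; apply: (is_derive_line (g := fun x' => f x' y)).
have [td _ _ _ _] := smF; have [/nbhs_singleton/= dz _] := td (x + t *: h) y Yy.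
apply: (@differentiable_comp _ _ _ _ (fun x' : 'rV[R]_p => (x', y)) (fun z => f z.1 z.2)).
  exact: differentiable_pair.
exact: dz.
Qed.

Definition feasible : set (borel ('rV[R]_p * 'rV[R]_d)%type * S) := [set t | Y t.1.2].

Lemma measurable_feasible : measurable feasible.
Proof.
have oY : open [set z : 'rV[R]_p * 'rV[R]_d | ~ Y z.2].
  have -> : [set z : 'rV[R]_p * 'rV[R]_d | ~ Y z.2] = snd @^-1` (~` Y) by [].
  apply: open_comp; last by rewrite openC.
  by move=> z _; exact: cvg_snd.
have mY : measurable ([set z | Y z.2] : set (borel ('rV[R]_p * 'rV[R]_d)%type)).
  rewrite -[X in measurable X]setCK; apply: measurableC.
  exact: sub_sigma_algebra.
have := @measurable_fst _ _ (borel ('rV[R]_p * 'rV[R]_d)%type) S measurableT _ mY.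
by rewrite setTI.
Qed.

Section Composition.
Context {dT : measure_display} {T : measurableType dT}.
Variables (u : T -> borel ('rV[R]_p * 'rV[R]_d)%type) (xi : T -> S).
Hypotheses (mu_ : measurable_fun setT u) (mxi : measurable_fun setT xi).
Hypothesis uY : forall w, Y (u w).2.

Let mpair : measurable_fun setT (fun w => (u w, xi w)).
Proof. by apply/measurable_fun_pairP; split. Qed.

Lemma measurable_gradx_comp a :
  measurable_fun setT (fun w => gradx (Fs (xi w)) (u w).1 (u w).2 0 a).
Proof.
have [_ _ [mx _] _ _] := sgF.
apply: (measurable_comp measurable_feasible _ (mx a) mpair).
by move=> _ [w _ <-]; exact: uY.
Qed.

Lemma measurable_grady_comp a :
  measurable_fun setT (fun w => grady (Fs (xi w)) (u w).1 (u w).2 0 a).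
Proof.
have [_ _ [_ my] _ _] := sgF.
apply: (measurable_comp measurable_feasible _ (my a) mpair).
by move=> _ [w _ <-]; exact: uY.
Qed.

End Composition.

Lemma measurable_gradx x y a : Y y -> measurable_fun setT (fun s => gradx (Fs s) x y 0 a).
Proof.
move=> Yy; apply: (@measurable_gradx_comp _ S (fun=> (x, y)) id) => //.
Qed.

Lemma measurable_grady x y a : Y y -> measurable_fun setT (fun s => grady (Fs s) x y 0 a).
Proof.
move=> Yy; apply: (@measurable_grady_comp _ S (fun=> (x, y)) id) => //.
Qed.

Lemma expectation_bound (h : S -> R) (e M : R) : measurable_fun setT h ->
  (forall s, `|h s| <= M) -> ('E_D[h] = e%:E)%E -> `|e| <= M.
Proof.
move=> mh hM; rewrite unlock => hE.
have mE : measurable_fun setT (fun s => (h s)%:E) by move/measurable_EFinP : mh.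
rewrite -lee_fin -abse_EFin -hE (le_trans (le_abse_integral _ measurableT mE))//.
have -> : M%:E = (\int[D]_(s in setT) M%:E)%E.
  rewrite integral_cst; last exact: measurableT.
  exact: (esym (etrans (congr1 (fun x => M%:E * x)%E (probability_setT D)) (mule1 _))).
apply: ge0_le_integral => //.
- exact: measurableT_comp.
- by move=> s _; rewrite abse_EFin lee_fin.
Qed.

Lemma norm2_coord_le k (v : 'rV[R]_k) (M : R) : 0 <= M ->
  (forall a, `|v 0 a| <= M) -> norm2 v <= k%:R * M.
Proof.
move=> M0 vM; rewrite (le_trans (norm2_le_norm v))// ler_wpM2l//.
rewrite [leLHS]/Num.norm/= mx_normrE (bigmax_le _ M0)// => -[i j] _ /=.
by rewrite (ord1 i) vM.
Qed.

(** Expectations are available coordinate by coordinate, so the bound [C] passes to the exact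
    gradients with a factor [p] or [d]. *)
Lemma gradient_bounds x y : Y y -> 0 <= C ->
  norm2 (gradx f x y) <= p%:R * C /\ norm2 (grady f x y) <= d%:R * C.
Proof.
move=> Yy C0; have [_ _ _ un bd] := sgF; have [ux uy] := un x y Yy.
split; apply: norm2_coord_le => // a.
  apply: (expectation_bound (measurable_gradx x a Yy)) (ux a) => s.
  by rewrite (le_trans (coord_norm2 _ _))//; have [] := bd x y s Yy.
apply: (expectation_bound (measurable_grady x a Yy)) (uy a) => s.
by rewrite (le_trans (coord_norm2 _ _))//; have [] := bd x y s Yy.
Qed.

Lemma stochastic_C_ge0 y : Y y -> 0 <= C.
Proof.
move=> Yy; have [_ _ _ _ bd] := sgF.
by have [h _] := bd 0 y point Yy; exact: le_trans (norm2_ge0 _) h.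
Qed.

End Node.

Section Network.
Context {R : realType} {n p d : nat} {dS : 'I_n -> measure_display}.
Context {S : forall i, measurableType (dS i)}.
Variables (Y : set 'rV[R]_d) (D : forall i, probability (S i) R).
Variables (F : forall i : 'I_n, 'rV[R]_p -> 'rV[R]_d -> S i -> R) (mu L C : R).
Hypotheses (n0 : (0 < n)%N) (mu0 : 0 < mu) (cY : closed Y) (vY : convex_set Y) (Y0 : Y !=set0).

Local Notation fi i := (expected_obj (D i) (@F i)).
Local Notation f := (fun x y => n%:R^-1 * \sum_i fi i x y).

Hypothesis sc : forall i, strongly_concave mu Y (fi i).
Hypothesis sm : forall i, smooth L Y (fi i).
Hypothesis sg : forall i, stochastic_gradients C Y (D i) (@F i).

(** One bound for stochastic and exact gradients in x and y. The absolute value makes it nonnegative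
    already when the constants of the theorem are fixed, before [0 <= C] can be derived; [|L|] is
    used likewise. *)
Definition Cbar := (p + d).+1%:R * `|C|.

Let C0 : 0 <= C.
Proof.
have [y Yy] := Y0; have i : 'I_n by exact: Ordinal n0.
exact: stochastic_C_ge0 (sg i) y Yy.
Qed.

Lemma C_le_Cbar : C <= Cbar.
Proof. by rewrite /Cbar ger0_norm// ler_peMl// ler1n. Qed.

Lemma gradx_Cbar i x y : Y y -> norm2 (gradx (fi i) x y) <= Cbar.
Proof.
move=> Yy; have [h _] := gradient_bounds cY (sg i) x Yy C0.
by rewrite (le_trans h)// /Cbar (ger0_norm C0) ler_wpM2r// ler_nat leqW// leq_addr.
Qed.

Lemma grady_Cbar i x y : Y y -> norm2 (grady (fi i) x y) <= Cbar.
Proof.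
move=> Yy; have [_ h] := gradient_bounds cY (sg i) x Yy C0.
by rewrite (le_trans h)// /Cbar (ger0_norm C0) ler_wpM2r// ler_nat leqW// leq_addl.
Qed.

Lemma gradx_lip i x x' y y' : Y y -> Y y' ->
  norm2 (gradx (fi i) x y - gradx (fi i) x' y') ^+ 2 <=
  `|L| ^+ 2 * (norm2 (x - x') ^+ 2 + norm2 (y - y') ^+ 2).
Proof. by move=> Yy Yy'; rewrite real_normK ?num_real//; have [_ + _ _ _] := sm i; apply. Qed.

Lemma grady_lip i x x' y y' : Y y -> Y y' ->
  norm2 (grady (fi i) x y - grady (fi i) x' y') ^+ 2 <=
  `|L| ^+ 2 * (norm2 (x - x') ^+ 2 + norm2 (y - y') ^+ 2).
Proof. by move=> Yy Yy'; rewrite real_normK ?num_real//; have [_ _ + _ _] := sm i; apply. Qed.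

Let nR0 : 0 < n%:R :> R.
Proof. by rewrite ltr0n. Qed.

Let avg_cst (a : R) : n%:R^-1 * \sum_(i < n) a = a.
Proof. by rewrite sumr_const card_ord -[X in _ * X]mulr_natl mulKf// gt_eqF. Qed.

Let avg_bound m (v : 'I_n -> 'rV[R]_m) (M : R) : 0 <= M ->
  (forall i, norm2 (v i) <= M) -> norm2 (n%:R^-1 *: \sum_i v i) <= M.
Proof.
move=> M0 vM; rewrite -ler_sqr ?nnegrE ?norm2_ge0// (le_trans (norm2_avg_sq _ n0))//.
rewrite -[leRHS]avg_cst ler_wpM2l ?invr_ge0//; apply: ler_sum => i _.
by rewrite le_sqr ?norm2_ge0.
Qed.

Lemma network_objective : minimax_objective f
  (mean_field (fun i => gradx (fi i))) (mean_field (fun i => grady (fi i))) Y mu `|L| Cbar.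
Proof.
have Cb0 : 0 <= Cbar by rewrite mulr_ge0.
split => //.
- move=> x y y' Yy Yy'.
  rewrite -mulrBr -sumrB /mean_field innerZl inner_suml.
  rewrite -[mu / 2 * _]avg_cst -mulrDr ler_wpM2l ?invr_ge0// -big_split.
  by apply: ler_sum => i _; exact: sc.
- move=> x x' y y' Yy Yy'; rewrite /mean_field -scalerBr -sumrB.
  rewrite (le_trans (norm2_avg_sq _ n0))// -[leRHS]avg_cst ler_wpM2l ?invr_ge0//.
  by apply: ler_sum => i _; exact: gradx_lip.
- move=> x h y t Yy; rewrite /mean_field innerZl inner_suml.
  have dsum : is_derive t (1 : R) (\sum_i (fun s : R => fi i (x + s *: h) y))
      (\sum_i inner (gradx (fi i) (x + t *: h) y) h).
    by apply: is_derive_sum => i; exact: (is_derive_expected_obj (sm i)).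
  have -> : (fun s : R => n%:R^-1 * \sum_i fi i (x + s *: h) y) =
      n%:R^-1 *: \sum_i (fun s : R => fi i (x + s *: h) y).
    by apply/funext => s; rewrite fctE fct_sumE.
  exact: is_deriveZ.
- by move=> x y Yy; apply: avg_bound => // i; exact: gradx_Cbar.
- by move=> x y Yy; apply: avg_bound => // i; exact: grady_Cbar.
Qed.

End Network.

(** * The random run *)

Lemma bounded_integrable (R : realType) (dT : measure_display) (T : measurableType dT)
    (P : probability T R) (f : T -> R) : bmeas f -> P.-integrable setT (EFin \o f).
Proof.
move=> [mf [M bf]]; apply: measurable_bounded_integrable => //.
  by rewrite -ge0_fin_numE// fin_num_measure.
by exists M; split; [exact: num_real|move=> r Mr w _ /=; rewrite (le_trans (bf _))// ltW].
Qed.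

Lemma integral_centered (R : realType) (dS : measure_display) (S : measurableType dS)
    (D : probability S R) (h : S -> R) (a e : R) : bmeas h ->
  ('E_D[h] = e%:E)%E -> (\int[D]_s (a * (h s - e))%:E = 0)%E.
Proof.
move=> bh; rewrite unlock => he; have ih := bounded_integrable D bh.
have ie := bounded_integrable D (bmeas_cst e).
under eq_integral do rewrite EFinM EFinB.
rewrite integralZl//; last exact: integrableB.
rewrite (integralB measurableT ih ie) he integral_cst//.
refine (etrans (congr1 (fun x => a%:E * (e%:E - e%:E * x))%E (probability_setT D)) _).
by rewrite mule1 -EFinB subrr mule0.
Qed.

Lemma integral_bmeas_sum (R : realType) (dT : measure_display) (T : measurableType dT)
    (P : probability T R) (I : Type) (s : seq I) (f : I -> T -> R) :
  (forall i, bmeas (f i)) ->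
  (\int[P]_w (\sum_(i <- s) f i w)%:E = \sum_(i <- s) \int[P]_w (f i w)%:E)%E.
Proof.
move=> bf; under eq_integral do rewrite -sumEFin.
rewrite integral_sum// => i; exact: bounded_integrable.
Qed.

Lemma integral_ae_le (R : realType) (dT : measure_display) (T : measurableType dT)
    (P : probability T R) (f N : T -> R) (B : R) : bmeas f -> bmeas N ->
  (\int[P]_w (N w)%:E = 0)%E -> {ae P, forall w, f w <= B + N w} ->
  (\int[P]_w (f w)%:E <= B%:E)%E.
Proof.
move=> bf bN N0 fBN.
pose h w := B + N w - f w.
have bBN : bmeas (fun w => B + N w) by apply: bmeasD => //; exact: bmeas_cst.
have bh : bmeas h by exact: bmeasB.
have : (0 <= \int[P]_w (h w)%:E)%E.
  (* The pathwise bound holds almost everywhere, where [h] equals its positive part; the latter has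
     a nonnegative integral. *)
  have bm : bmeas (fun w => Num.max (h w) 0) by apply: bmeas_max => //; exact: bmeas_cst.
  rewrite (@ae_eq_integral _ _ _ P setT (fun w => (Num.max (h w) 0)%:E))//.
  - by apply: integral_ge0 => w _; rewrite lee_fin le_max lexx orbT.
  - by have [mh _] := bh; exact/measurable_EFinP.
  - by have [mm _] := bm; exact/measurable_EFinP.
  by apply: filterS fBN => w fw _; rewrite /h max_l// subr_ge0.
have -> : (\int[P]_w (h w)%:E = B%:E - \int[P]_w (f w)%:E)%E.
  rewrite /h; under eq_integral do rewrite EFinB EFinD.
  have ib := bounded_integrable P (bmeas_cst B).
  have iN := bounded_integrable P bN.
  rewrite integralB//; [|exact: integrableD|exact: bounded_integrable bf].
  rewrite integralD// N0 adde0 integral_cst//.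
  refine (etrans (congr1 (fun x => B%:E * x - \int[P]_w (f w)%:E)%E (probability_setT P)) _).
  by rewrite mule1.
have iff : (\int[P]_w (f w)%:E)%E \is a fin_num.
  by apply: integrable_fin_num => //; exact: bounded_integrable bf.
by rewrite sube_ge0// iff orbT.
Qed.

Lemma path_zeta_le (R : realType) n (a c z : R) (w : nat -> 'cV[R]_n) :
  (0 < n)%N -> 0 < c -> (forall k i, c <= w k i 0) ->
  (path_zeta_sq a w <= (z ^+ 2)%:E)%E ->
  forall k i, w k.+1 i 0 `^ (- a) <= (1 + `|z|) * avg (w k.+1) `^ (- a).
Proof.
move=> n0 c0 cw wz k i.
have cavg : c <= avg (w k.+1).
  by rewrite -(avg_const c n0); apply: avg_le => j; rewrite mxE.
have b0 : 0 < avg (w k.+1) `^ (- a) by rewrite powR_gt0// (lt_le_trans c0).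
have := le_trans (ereal_sup_ubound _) wz; move=> /(_ _ (ex_intro2 _ _ k.+1 isT (ex_intro2 _ _ i I erefl))).
rewrite lee_fin ler_pdivrMr ?exprn_gt0//; move: (_ `^ _) (_ `^ _) b0 => x b b0 h.
have : x - b <= `|z| * b.
  rewrite (le_trans (ler_norm _))// -ler_sqr ?nnegrE ?mulr_ge0 ?(ltW b0)//.
  by rewrite real_normK ?num_real// exprMn real_normK ?num_real.
by rewrite lerBlDr => h2; rewrite (le_trans h2)//; lra.
Qed.

(** * Measurability of the run and centred noise *)

Section Run.
Context {R : realType} {n p d : nat}.
Variables (mu L C c alpha beta gx gy : R) (x0 : 'M[R]_(n, p)) (y0 : 'M[R]_(n, d)).
Hypotheses (n0 : (0 < n)%N) (mu0 : 0 < mu) (c0 : 0 < c) (beta0 : 0 < beta)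
  (beta_alpha : beta < alpha) (alpha1 : alpha < 1) (gx0 : 0 < gx) (gy0 : 0 < gy).
Context {Y : set 'rV[R]_d} {dS : 'I_n -> measure_display}.
Context {S : forall i, measurableType (dS i)} {D : forall i, probability (S i) R}.
Variables (F : forall i, 'rV[R]_p -> 'rV[R]_d -> S i -> R) (W : 'M[R]_n).
Context {dO : measure_display} {Omega : measurableType dO} {P : probability Omega R}.
Variables (xix xiy : forall i : 'I_n, nat -> {RV P >-> S i}).

Local Notation fi i := (expected_obj (D i) (@F i)).
Local Notation f := (fun x y => n%:R^-1 * \sum_i fi i x y).
Local Notation Gx := (fun i => gradx (fi i)).
Local Notation Gy := (fun i => grady (fi i)).
Local Notation Cb := (@Cbar R p d C).

Hypotheses (cY : closed Y) (vY : convex_set Y) (y0Y : forall i, Y (row i y0)).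
Hypothesis sc : forall i, strongly_concave mu Y (fi i).
Hypothesis sm : forall i, smooth L Y (fi i).
Hypothesis sg : forall i, stochastic_gradients C Y (D i) (@F i).
Hypotheses (dW : doubly_stochastic W) (rW : rhoW W < 1).
Hypothesis samples : forall i k B, measurable B ->
  distribution P (xix i k) B = D i B /\ distribution P (xiy i k) B = D i B.

Local Notation J := (bool * 'I_n * nat)%type.
Local Notation sample := (fun (j : J) (w : Omega) =>
  (if j.1.1 then xix j.1.2 j.2 else xiy j.1.2 j.2) w).
Hypothesis indep : mutually_independent P sample.

Definition run (w : Omega) : nat -> state :=
  dadast F W Y alpha beta gx gy c x0 y0 (fun i k => xix i k w) (fun i k => xiy i k w).
Definition gX (w : Omega) k := stoch_gradx F (run w k) (fun i => xix i k w).
Definition gY (w : Omega) k := stoch_grady F (run w k) (fun i => xiy i k w).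

Let Y0 : Y !=set0.
Proof. by exists (row (Ordinal n0) y0). Qed.

Let mo := network_objective n0 mu0 cY vY Y0 sc sm sg.

Lemma run_y_in w k i : Y (row i (st_y (run w k))).
Proof.
case: k => [|k]; first exact: y0Y.
by rewrite /= rowK; apply: (proj_on_in cY Y0 (diam_Y mo)).
Qed.

Lemma run_path w :
  dadast_path f Gx Gy Y mu `|L| Cb W alpha beta gx gy c (run w) (gX w) (gY w).
Proof.
have CC := C_le_Cbar n0 Y0 sg.
split => //.
- by move=> i x x' y y' Yy Yy'; exact: (gradx_lip sm).
- by move=> i x x' y y' Yy Yy'; exact: (grady_lip sm).
- move=> k i; rewrite rowK (le_trans _ CC)//.
  by have [_ _ _ _ b] := sg i; have [] := b (row i (st_x (run w k))) _ (xix i k w) (run_y_in w k i).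
- move=> k i; rewrite rowK (le_trans _ CC)//.
  by have [_ _ _ _ b] := sg i; have [] := b (row i (st_x (run w k))) _ (xiy i k w) (run_y_in w k i).
Qed.

(** State [k] is determined by samples of times below [k]; the gradients of step [k] belong to
    [hist k.+1]. *)
Definition past k : pred J := fun j => (j.2 < k)%N.
Local Notation hist k := (history sample (past k)).

Let msample j : measurable_fun setT (sample j).
Proof. by case: j => [[[] i] k]/=. Qed.

Let past_sub k : {subset past k <= past k.+1}.
Proof. by move=> j; rewrite !unfold_in; exact: leqW. Qed.

Let bmeas_next k (g : Omega -> R) : bmeas (g : hist k -> R) -> bmeas (g : hist k.+1 -> R).
Proof. by move=> [mg bg]; split => //; exact: (measurable_history (@past_sub k)). Qed.

Let bmeas_mx_next k m q (A : Omega -> 'M[R]_(m, q)) :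
  bmeas_mx (A : hist k -> 'M[R]_(m, q)) -> bmeas_mx (A : hist k.+1 -> 'M[R]_(m, q)).
Proof. by move=> bA i j; exact: bmeas_next. Qed.

Definition state_bmeas k : Prop :=
  [/\ bmeas_mx (fun w : hist k => st_x (run w k)), bmeas_mx (fun w : hist k => st_y (run w k)),
      bmeas_mx (fun w : hist k => st_mx (run w k)) & bmeas_mx (fun w : hist k => st_my (run w k))].

Lemma gX_bmeas k : state_bmeas k -> bmeas_mx (fun w : hist k.+1 => gX w k).
Proof.
move=> [bx by_ _ _].
apply: (bmeas_rows (r := fun i (w : hist k.+1) => gradx (fun x y => F x y (xix i k w))
    (row i (st_x (run w k))) (row i (st_y (run w k))))) => [i w|i z a]; first exact: rowK.
rewrite (ord1 z); split; last first.
  exists C => w; rewrite (le_trans (coord_norm2 _ _))//.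
  by have [_ _ _ _ b] := sg i; have [] := b (row i (st_x (run w k))) _ (xix i k w) (run_y_in w k i).
apply: (measurable_gradx_comp cY (sg i) (T := hist k.+1)
  (u := fun w => (row i (st_x (run w k)), row i (st_y (run w k)))) (xi := xix i k)).
- apply: measurable_pair_borel => b.
    by have [] := bmeas_row i (bmeas_mx_next bx) 0 b.
  by have [] := bmeas_row i (bmeas_mx_next by_) 0 b.
- exact: (@measurable_observed _ _ _ (fun j : J => dS j.1.2) (fun j : J => S j.1.2) sample
    (past k.+1) (true, i, k) (ltnSn k)).
- by move=> w; exact: run_y_in.
Qed.

Lemma gY_bmeas k : state_bmeas k -> bmeas_mx (fun w : hist k.+1 => gY w k).
Proof.
move=> [bx by_ _ _].
apply: (bmeas_rows (r := fun i (w : hist k.+1) => grady (fun x y => F x y (xiy i k w))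
    (row i (st_x (run w k))) (row i (st_y (run w k))))) => [i w|i z a]; first exact: rowK.
rewrite (ord1 z); split; last first.
  exists C => w; rewrite (le_trans (coord_norm2 _ _))//.
  by have [_ _ _ _ b] := sg i; have [] := b (row i (st_x (run w k))) _ (xiy i k w) (run_y_in w k i).
apply: (measurable_grady_comp cY (sg i) (T := hist k.+1)
  (u := fun w => (row i (st_x (run w k)), row i (st_y (run w k)))) (xi := xiy i k)).
- apply: measurable_pair_borel => b.
    by have [] := bmeas_row i (bmeas_mx_next bx) 0 b.
  by have [] := bmeas_row i (bmeas_mx_next by_) 0 b.
- exact: (@measurable_observed _ _ _ (fun j : J => dS j.1.2) (fun j : J => S j.1.2) sample
    (past k.+1) (false, i, k) (ltnSn k)).
- by move=> w; exact: run_y_in.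
Qed.

Section Building.
Context {dT : measure_display} {T : measurableType dT}.

Lemma bmeas_sq_row_norms m (G : T -> 'M[R]_(n, m)) :
  bmeas_mx G -> bmeas_mx (fun w => sq_row_norms (G w)).
Proof.
move=> bG i j; under eq_fun do rewrite mxE norm2_sq.
by apply: bmeas_inner; exact: bmeas_row.
Qed.

Lemma bmeas_diag_powR m (v : T -> 'cV[R]_n) (a : R) (G : T -> 'M[R]_(n, m)) :
  (forall w i, c <= v w i 0) -> bmeas_mx v -> bmeas_mx G ->
  bmeas_mx (fun w => diag_powR (v w) a *m G w).
Proof.
move=> cv bv bG i j; under eq_fun do rewrite /diag_powR mul_diag_mx !mxE.
by apply: bmeasM => //; exact: bmeas_powR c0 (cv^~ i) (bv i 0).
Qed.

Let ref : 'rV[R]_d := row (Ordinal n0) y0.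

Let in_Y_bound y : Y y -> norm2 y <= norm2 ref + 2 * Cb / mu.
Proof.
move=> Yy; have -> : y = ref + (y - ref) by rewrite addrC subrK.
by rewrite (le_trans (norm2D _ _))// lerD2l (diam_Y mo Yy (y0Y _)).
Qed.

Lemma bmeas_proj_on (h : T -> 'rV[R]_d) : bmeas_mx h -> bmeas_mx (fun w => proj_on Y (h w)).
Proof.
move=> bh; apply: (@bmeas_lipschitz _ _ _ d d d (fun z => proj_on Y z.2) 1 _ h h) => //.
  move=> z z'; rewrite mul1r (le_trans (proj_on_nonexpansive cY vY Y0 (diam_Y mo) _ _))//.
  by rewrite lerDr norm2_ge0.
by move=> z; apply: in_Y_bound; exact: (proj_on_in cY Y0 (diam_Y mo)).
Qed.

Lemma bmeas_argmax (h : T -> 'rV[R]_p) : bmeas_mx h ->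
  bmeas_mx (fun w => argmax_on Y (f (h w))).
Proof.
move=> bh; apply: (@bmeas_lipschitz _ _ _ p p d (fun z => argmax_on Y (f z.1))
  (2 * `|L| / mu) _ h h) => //.
  move=> z z'; rewrite (le_trans (argmax_lipschitz mo _ _))// ler_wpM2l//.
    by rewrite divr_ge0 ?mulr_ge0// ltW.
  by rewrite lerDl norm2_ge0.
by move=> z; apply: in_Y_bound; exact: (argmax_in mo).
Qed.

Lemma bmeas_gradPhi (h : T -> 'rV[R]_p) : bmeas_mx h ->
  bmeas_mx (fun w => dPhi f Gx Y (h w)).
Proof.
move=> bh; apply: (@bmeas_lipschitz _ _ _ p p p (fun z => dPhi f Gx Y z.1)
  (`|L| * (1 + 2 * `|L| / mu)) Cb h h) => //.
  move=> z z'; rewrite (le_trans (gradPhi_lipschitz mo _ _))// ler_wpM2l//.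
    by rewrite mulr_ge0// addr_ge0// divr_ge0 ?mulr_ge0// ltW.
  by rewrite lerDl norm2_ge0.
by move=> z; exact: (gradPhi_bound mo).
Qed.

(** The gradients are Lipschitz only over [Y]. Composing with the projection makes them Lipschitz
    everywhere and changes nothing at feasible points. *)
Let proj_lipschitz m (G : 'rV[R]_p -> 'rV[R]_d -> 'rV[R]_m) :
  (forall x x' y y', Y y -> Y y' -> norm2 (G x y - G x' y') ^+ 2 <=
    `|L| ^+ 2 * (norm2 (x - x') ^+ 2 + norm2 (y - y') ^+ 2)) ->
  forall z z' : 'rV[R]_p * 'rV[R]_d,
  norm2 (G z.1 (proj_on Y z.2) - G z'.1 (proj_on Y z'.2)) <=
  `|L| * (norm2 (z.1 - z'.1) + norm2 (z.2 - z'.2)).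
Proof.
move=> GL z z'; have YP := proj_on_in cY Y0 (diam_Y mo).
have s0 : 0 <= norm2 (z.1 - z'.1) + norm2 (z.2 - z'.2) by rewrite addr_ge0 ?norm2_ge0.
rewrite -ler_sqr ?nnegrE ?norm2_ge0 ?mulr_ge0//.
rewrite (le_trans (GL _ _ _ _ (YP _) (YP _)))// exprMn ler_wpM2l ?sqr_ge0//.
have := le_sqr (norm2_ge0 _) (proj_on_nonexpansive cY vY Y0 (diam_Y mo) z.2 z'.2).
have := mulr_ge0 (norm2_ge0 (z.1 - z'.1)) (norm2_ge0 (z.2 - z'.2)).
by rewrite sqrrD; lra.
Qed.

Lemma bmeas_gradx_field i (u : T -> 'rV[R]_p) (v : T -> 'rV[R]_d) :
  (forall w, Y (v w)) -> bmeas_mx u -> bmeas_mx v ->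
  bmeas_mx (fun w => gradx (fi i) (u w) (v w)).
Proof.
move=> vY' bu bv; have -> : (fun w => gradx (fi i) (u w) (v w)) =
    (fun w => gradx (fi i) (u w, v w).1 (proj_on Y (u w, v w).2)).
  by apply/funext => w /=; rewrite (proj_on_id cY Y0 (diam_Y mo) (vY' w)).
apply: (@bmeas_lipschitz _ _ _ p d p (fun z => gradx (fi i) z.1 (proj_on Y z.2)) `|L| Cb) => //.
  by apply: proj_lipschitz => *; exact: (gradx_lip sm).
by move=> z; apply: (gradx_Cbar n0 cY Y0 sg); exact: (proj_on_in cY Y0 (diam_Y mo)).
Qed.

Lemma bmeas_grady_field i (u : T -> 'rV[R]_p) (v : T -> 'rV[R]_d) :
  (forall w, Y (v w)) -> bmeas_mx u -> bmeas_mx v ->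
  bmeas_mx (fun w => grady (fi i) (u w) (v w)).
Proof.
move=> vY' bu bv; have -> : (fun w => grady (fi i) (u w) (v w)) =
    (fun w => grady (fi i) (u w, v w).1 (proj_on Y (u w, v w).2)).
  by apply/funext => w /=; rewrite (proj_on_id cY Y0 (diam_Y mo) (vY' w)).
apply: (@bmeas_lipschitz _ _ _ p d d (fun z => grady (fi i) z.1 (proj_on Y z.2)) `|L| Cb) => //.
  by apply: proj_lipschitz => *; exact: (grady_lip sm).
by move=> z; apply: (grady_Cbar n0 cY Y0 sg); exact: (proj_on_in cY Y0 (diam_Y mo)).
Qed.

End Building.

Lemma run_bmeas k : state_bmeas k.
Proof.
elim: k => [|k IH]; first by split; exact: bmeas_mx_cst.
have [bx by_ bmx bmy] := IH.
have bX := gX_bmeas IH; have bY := gY_bmeas IH.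
have bmx' : bmeas_mx (fun w : hist k.+1 => st_mx (run w k.+1)).
  apply: bmeas_mulmx; first exact: bmeas_mx_cst.
  by apply: bmeas_mxD; [exact: bmeas_mx_next|exact: bmeas_sq_row_norms].
have bmy' : bmeas_mx (fun w : hist k.+1 => st_my (run w k.+1)).
  apply: bmeas_mulmx; first exact: bmeas_mx_cst.
  by apply: bmeas_mxD; [exact: bmeas_mx_next|exact: bmeas_sq_row_norms].
have cv w i : c <= st_v (run w k.+1) i 0 by exact: (st_v_ge (run_path w) k.+1 i).
have cu w i : c <= st_my (run w k.+1) i 0 by exact: (st_u_ge (run_path w) k.+1 i).
split => //.
  apply: bmeas_mulmx; first exact: bmeas_mx_cst.
  apply: bmeas_mxB; first exact: bmeas_mx_next.
  apply: bmeas_mxZ; first exact: bmeas_cst.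
  apply: (@bmeas_diag_powR _ (hist k.+1) _ (fun w => st_v (run w k.+1)) (- alpha)
    (fun w => gX w k) cv) => //.
  move=> i j; rewrite (ord1 j); apply: (eq_bmeas _ (bmeas_max (bmx' i 0) (bmy' i 0))) => w.
  by rewrite /st_v [RHS]mxE.
apply: (bmeas_rows (r := fun i (w : hist k.+1) => proj_on Y (row i (W *m
    (st_y (run w k) + gy *: (diag_powR (st_my (run w k.+1)) (- beta) *m gY w k)))))) => [i w|i].
  exact: rowK.
apply: bmeas_proj_on; apply: bmeas_row.
apply: bmeas_mulmx; first exact: bmeas_mx_cst.
apply: bmeas_mxD; first exact: bmeas_mx_next.
apply: bmeas_mxZ; first exact: bmeas_cst.
apply: (@bmeas_diag_powR _ (hist k.+1) _ (fun w => st_my (run w k.+1)) (- beta) (fun w => gY w k) cu).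
exact: bmy'.
exact: bY.
Qed.

Local Notation z w := (zz beta gy c (run w)).

Let Um_bmeas k : bmeas (fun w : hist k => Um (run w) k).
Proof. 
have [_ _ _ bmy] := run_bmeas k.
by apply: bmeasM; [exact: bmeas_cst|apply: bmeas_sum => i; exact: bmy].
Qed.

Let Vm_bmeas k : bmeas (fun w : hist k => Vm (run w) k).
Proof.
have [_ _ bmx _] := run_bmeas k; apply: bmeas_max (Um_bmeas k).
by apply: bmeasM; [exact: bmeas_cst|apply: bmeas_sum => i; exact: bmx].
Qed.

Let cU k w : c <= Um (run w) k := Um_ge (run_path w) k.
Let cV k w : c <= Vm (run w) k := Vm_ge (run_path w) k.

Let c_powR_gt0 a : 0 < c `^ a.
Proof. exact: powR_gt0. Qed.

Let ub_bmeas k : bmeas (fun w : hist k => ub beta (run w) k).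
Proof. by apply: (bmeas_powR _ c0 _ (Um_bmeas k)) => w; exact: cU. Qed.

Let vb_bmeas k : bmeas (fun w : hist k => vb alpha (run w) k).
Proof. by apply: (bmeas_powR _ c0 _ (Vm_bmeas k)) => w; exact: cV. Qed.

Let ubV_bmeas k : bmeas (fun w : hist k => (ub beta (run w) k)^-1).
Proof.
apply: (bmeasV (c_powR_gt0 beta) _ (ub_bmeas k)) => w.
by rewrite powR_le ?(ltW beta0) ?(ltW c0).
Qed.

Let vbV_bmeas k : bmeas (fun w : hist k => (vb alpha (run w) k)^-1).
Proof.
apply: (bmeasV (c_powR_gt0 alpha) _ (vb_bmeas k)) => w.
by rewrite powR_le ?(ltW (lt_trans beta0 beta_alpha)) ?(ltW c0).
Qed.

Let VmV_bmeas k : bmeas (fun w : hist k => (Vm (run w) k)^-1).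
Proof. by apply: (bmeasV c0 _ (Vm_bmeas k)) => w; exact: cV. Qed.

Let xb_bmeas k : bmeas_mx (fun w : hist k => xb (run w) k).
Proof. by have [bx _ _ _] := run_bmeas k; exact: bmeas_avg_row. Qed.

Let zz_bmeas k : bmeas_mx (fun w : hist k => z w k).
Proof.
elim: k => [|k IH]; first exact: xb_bmeas.
apply: bmeas_mxD; first exact: bmeas_mx_next.
apply: bmeas_mxZ; last by apply: bmeas_mx_next; apply: bmeas_mxB => //; exact: xb_bmeas.
apply: bmeas_next; apply: bmeasM; first exact: bmeas_cst.
by apply: bmeasM (ubV_bmeas k); exact: bmeas_cst.
Qed.

Let row_x_bmeas k i : bmeas_mx (fun w : hist k => row i (st_x (run w k))).
Proof. by have [bx _ _ _] := run_bmeas k; exact: bmeas_row. Qed.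

Let row_y_bmeas k i : bmeas_mx (fun w : hist k => row i (st_y (run w k))).
Proof. by have [_ by_ _ _] := run_bmeas k; exact: bmeas_row. Qed.

Let Gxr_bmeas k i : bmeas_mx (fun w : hist k => Gxr Gx (run w) k i).
Proof. exact: (bmeas_gradx_field i (fun w : hist k => run_y_in w k i) (row_x_bmeas k i) (row_y_bmeas k i)). Qed.

Let Gyr_bmeas k i : bmeas_mx (fun w : hist k => Gyr Gy (run w) k i).
Proof. exact: (bmeas_grady_field i (fun w : hist k => run_y_in w k i) (row_x_bmeas k i) (row_y_bmeas k i)). Qed.

Lemma coefx_bmeas M k :
  bmeas_mx (fun w : hist k => coefx f Gx Y mu `|L| Cb alpha beta gx gy c (run w) M k).
Proof.
apply: bmeas_mxZ; first exact: bmeas_cst.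
apply: bmeas_mxB.
  apply: bmeas_mxB; apply: bmeas_mxZ.
  - exact: bmeas_cst.
  - by apply: bmeas_gradPhi; exact: xb_bmeas.
  - apply: bmeasM; first exact: bmeas_cst.
    apply: bmeasM; first exact: bmeas_cst.
    by apply: bmeasM (VmV_bmeas k); exact: bmeas_cst.
  by apply: bmeas_mxZ; [exact: bmeas_cst|exact: bmeas_mx_sum].
apply: bmeas_mxZ; last by apply: bmeas_mxB => //; exact: xb_bmeas.
apply: bmeasM; first exact: bmeas_cst.
apply: bmeasM; first exact: bmeas_cst.
apply: bmeasM; last by apply: bmeasM (vbV_bmeas k); exact: bmeas_cst.
apply: bmeasB; last exact: bmeas_cst.
apply: (eq_bmeas _ (bmeasM (bmeas_cst gy^-1) (ub_bmeas k))) => w.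
by rewrite /th invf_div mulrC.
Qed.

Lemma coefy_bmeas k i :
  bmeas_mx (fun w : hist k => coefy f Gy Y mu `|L| Cb W beta gy c (run w) k i).
Proof.
apply: bmeas_mxZ; first exact: bmeas_cst.
apply: bmeas_mxB; apply: bmeas_mxZ => //; first exact: bmeas_cst.
  by apply: bmeas_mxB; [exact: row_y_bmeas|apply: bmeas_argmax; exact: zz_bmeas].
apply: bmeasM; first exact: bmeas_cst.
by apply: bmeasM (ubV_bmeas k); exact: bmeas_cst.
Qed.

Let bmeas_fst (dT : measure_display) (T : measurableType dT) k (A : Omega -> R) :
  bmeas (A : hist k -> R) -> bmeas (fun t : hist k * T => A t.1).
Proof.
move=> [mA [M bA]]; split; last by exists M => t.
exact: (measurableT_comp mA measurable_fst).
Qed.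

Let bmeas_mx_fst (dT : measure_display) (T : measurableType dT) k m q (A : Omega -> 'M[R]_(m, q)) :
  bmeas_mx (A : hist k -> 'M[R]_(m, q)) -> bmeas_mx (fun t : hist k * T => A t.1).
Proof. by move=> bA i j; exact: (@bmeas_fst _ T k (fun w => A w i j) (bA i j)). Qed.

(** With the past frozen, the integrand is a multiple of a stochastic gradient coordinate minus its
    mean, which vanishes under the law of the fresh sample [(true, i, k)]. *)
Lemma gradient_noise_x (A : Omega -> R) i k a : bmeas (A : hist k -> R) ->
  (\int[P]_w (A w * (gxr (gX w) k i 0 a - Gxr Gx (run w) k i 0 a))%:E = 0)%E.
Proof.
move=> bA; under eq_integral do rewrite /gxr rowK.
pose phi (t : hist k * S i) := A t.1 * (gradx (fun x y => F x y t.2)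
  (row i (st_x (run t.1 k))) (row i (st_y (run t.1 k))) 0 a - Gxr Gx (run t.1) k i 0 a).
have [_ _ _ un bd] := sg i.
have [bx by_ _ _] := run_bmeas k.
have bphi : bmeas phi.
  apply: bmeasM; first exact: bmeas_fst.
  apply: bmeasB; last exact: (bmeas_mx_fst (S i) (Gxr_bmeas k i)).
  split; last first.
    exists C => t; rewrite (le_trans (coord_norm2 _ _))//.
    by have [] := bd (row i (st_x (run t.1 k))) _ t.2 (run_y_in t.1 k i).
  apply: (measurable_gradx_comp cY (sg i) (T := (hist k * S i)%type)
    (u := fun t => (row i (st_x (run t.1 k)), row i (st_y (run t.1 k)))) (xi := snd)).
  - apply: measurable_pair_borel => b.
      by have [] := bmeas_mx_fst (S i) (bmeas_row i bx) 0 b.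
    by have [] := bmeas_mx_fst (S i) (bmeas_row i by_) 0 b.
  - exact: measurable_snd.
  - by move=> t; exact: run_y_in.
have [mphi [M Mphi]] := bphi.
apply: (@integral_fresh_eq0 _ _ _ P _ (fun j : J => dS j.1.2) (fun j : J => S j.1.2) sample
  msample indep (past k) (true, i, k) (D i) _ _ phi M) => //.
- by rewrite /past/= ltnn.
- by move=> B mB; have [] := @samples i k B mB.
move=> w; have Yw := run_y_in w k i.
have [un1 _] := un (row i (st_x (run w k))) _ Yw.
apply: (integral_centered (A w) _ (un1 a)); split; last first.
  exists C => s; rewrite (le_trans (coord_norm2 _ _))//.
  by have [] := bd (row i (st_x (run w k))) _ s Yw.
exact: (measurable_gradx cY (sg i)).
Qed.

Lemma gradient_noise_y (A : Omega -> R) i k a : bmeas (A : hist k -> R) ->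
  (\int[P]_w (A w * (gyr (gY w) k i 0 a - Gyr Gy (run w) k i 0 a))%:E = 0)%E.
Proof.
move=> bA; under eq_integral do rewrite /gyr rowK.
pose phi (t : hist k * S i) := A t.1 * (grady (fun x y => F x y t.2)
  (row i (st_x (run t.1 k))) (row i (st_y (run t.1 k))) 0 a - Gyr Gy (run t.1) k i 0 a).
have [_ _ _ un bd] := sg i.
have [bx by_ _ _] := run_bmeas k.
have bphi : bmeas phi.
  apply: bmeasM; first exact: bmeas_fst.
  apply: bmeasB; last exact: (bmeas_mx_fst (S i) (Gyr_bmeas k i)).
  split; last first.
    exists C => t; rewrite (le_trans (coord_norm2 _ _))//.
    by have [_] := bd (row i (st_x (run t.1 k))) _ t.2 (run_y_in t.1 k i).
  apply: (measurable_grady_comp cY (sg i) (T := (hist k * S i)%type)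
    (u := fun t => (row i (st_x (run t.1 k)), row i (st_y (run t.1 k)))) (xi := snd)).
  - apply: measurable_pair_borel => b.
      by have [] := bmeas_mx_fst (S i) (bmeas_row i bx) 0 b.
    by have [] := bmeas_mx_fst (S i) (bmeas_row i by_) 0 b.
  - exact: measurable_snd.
  - by move=> t; exact: run_y_in.
have [mphi [M Mphi]] := bphi.
apply: (@integral_fresh_eq0 _ _ _ P _ (fun j : J => dS j.1.2) (fun j : J => S j.1.2) sample
  msample indep (past k) (false, i, k) (D i) _ _ phi M) => //.
- by rewrite /past/= ltnn.
- by move=> B mB; have [_] := @samples i k B mB.
move=> w; have Yw := run_y_in w k i.
have [_ un1] := un (row i (st_x (run w k))) _ Yw.
apply: (integral_centered (A w) _ (un1 a)); split; last first.
  exists C => s; rewrite (le_trans (coord_norm2 _ _))//.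
  by have [_] := bd (row i (st_x (run w k))) _ s Yw.
exact: (measurable_grady cY (sg i)).
Qed.

(** [noiseE] expanded into coordinates reduces the claim to scalar products of a past coefficient
    and one centred coordinate. *)
Lemma noise_bmeas_integral M k :
  let N w := noise f Gx Gy Y mu `|L| Cb W alpha beta gx gy c (run w) (gX w) (gY w) M k in
  bmeas N /\ (\int[P]_w (N w)%:E = 0)%E.
Proof.
move=> N.
pose cx w := coefx f Gx Y mu `|L| Cb alpha beta gx gy c (run w) M k.
pose cy i w := coefy f Gy Y mu `|L| Cb W beta gy c (run w) k i.
pose tx i a w := cx w 0 a * (gxr (gX w) k i 0 a - Gxr Gx (run w) k i 0 a).
pose ty i b w := cy i w 0 b * (gyr (gY w) k i 0 b - Gyr Gy (run w) k i 0 b).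
have -> : N = (fun w => \sum_i \sum_a tx i a w + \sum_i \sum_b ty i b w).
  apply/funext => w; rewrite /N noiseE /inner; congr (_ + _).
    by apply: eq_bigr => i _; apply: eq_bigr => a _; congr (_ * _); rewrite [LHS]mxE [X in _ + X]mxE.
  by apply: eq_bigr => i _; apply: eq_bigr => a _; congr (_ * _); rewrite [LHS]mxE [X in _ + X]mxE.
have toOmega (g : Omega -> R) : bmeas (g : hist k.+1 -> R) -> bmeas g.
  by move=> [mg bg]; split => //; exact: measurable_history_base mg.
have btx i a : bmeas (tx i a).
  apply: toOmega; apply: bmeasM; first exact: (bmeas_next (coefx_bmeas M k 0 a)).
  apply: bmeasB; last exact: (bmeas_next (Gxr_bmeas k i 0 a)).
  exact: (bmeas_row i (gX_bmeas (run_bmeas k)) 0 a).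
have bty i b : bmeas (ty i b).
  apply: toOmega; apply: bmeasM; first exact: (bmeas_next (coefy_bmeas k i 0 b)).
  apply: bmeasB; last exact: (bmeas_next (Gyr_bmeas k i 0 b)).
  exact: (bmeas_row i (gY_bmeas (run_bmeas k)) 0 b).
have btx' i := bmeas_sum (index_enum 'I_p) (btx i).
have bty' i := bmeas_sum (index_enum 'I_d) (bty i).
have bX := bmeas_sum (index_enum 'I_n) btx'.
have bY := bmeas_sum (index_enum 'I_n) bty'.
split; first exact: bmeasD.
under eq_integral do rewrite EFinD.
rewrite integralD//; [|exact: bounded_integrable bX|exact: bounded_integrable bY].
rewrite (integral_bmeas_sum _ _ btx') (integral_bmeas_sum _ _ bty').
rewrite big1 ?big1 ?adde0// => i _.
  rewrite (integral_bmeas_sum _ _ (bty i)) big1// => b _.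
  exact: (gradient_noise_y i b (coefy_bmeas k i 0 b)).
rewrite (integral_bmeas_sum _ _ (btx i)) big1// => a _.
exact: (gradient_noise_x i a (coefx_bmeas M k 0 a)).
Qed.

(** * Integration of the pathwise bound *)

Section Rate.
Variables (Delta zv zu : R).
Hypothesis hzv :
  ess_sup P (fun w => path_zeta_sq alpha (fun k => st_v (run w k))) = (zv ^+ 2)%:E.
Hypothesis hzu :
  ess_sup P (fun w => path_zeta_sq beta (fun k => st_u (run w k))) = (zu ^+ 2)%:E.

(** A single [T] for both accumulators: a squared relative deviation at most [z^2] bounds the
    stepsize ratio by [1 + |z|]. *)
Definition inconsistency := 1 + `|zv| + `|zu|.

Lemma run_consistent : {ae P, forall w, stepsize_consistent alpha beta inconsistency (run w)}.
Proof.
have := ess_sup_ge P (fun w => path_zeta_sq alpha (fun k => st_v (run w k))).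
have := ess_sup_ge P (fun w => path_zeta_sq beta (fun k => st_u (run w k))).
rewrite hzv hzu; apply: filterS2 => w zu_ zv_; have tr := run_path w.
split.
- by rewrite /inconsistency -addrA lerDl addr_ge0.
- move=> k i; have := path_zeta_le n0 c0 (st_v_ge tr) zv_ k i; move/le_trans; apply.
  by rewrite ler_wpM2r ?powR_ge0// lerDl.
move=> k i; have := path_zeta_le n0 c0 (st_u_ge tr) zu_ k i; move/le_trans; apply.
by rewrite ler_wpM2r ?powR_ge0// /inconsistency addrAC lerDl.
Qed.

Lemma expected_gradient_sum (K : nat) (m e M w : R) :
  (forall x, m <= Phi Y f x <= m + Delta) -> 0 <= e -> 0 <= M ->
  (forall V, c <= V -> (V `^ (beta - alpha)) ^+ 2 <= e + M / V) ->
  2 / aa beta gy c * K5 beta gx gy c * e = @dd R n mu `|L| Cb beta gy c ->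
  0 <= w ->
  [/\ Bmax Cb c K `^ alpha <= w, Bmax Cb c K `^ beta <= w,
      Bmax Cb c K `^ (1 - alpha) * Lg Cb c K <= w,
      Bmax Cb c K `^ (1 - beta) * Lg Cb c K <= w & Lg Cb c K <= w] ->
  [/\ (gap W)^-1 <= w, (gap W)^-1 * Lg Cb c K <= w,
      (gap W)^-1 * Bmax Cb c K `^ (1 - beta) * Lg Cb c K <= w &
      (gap W)^-1 ^+ 2 * E2 Cb beta c K * Lg Cb c K <= w] ->
  (\sum_(k < K) \int[P]_o (norm2 (grad (Phi Y f) (avg_row (st_x (run o k)))) ^+ 2)%:E <=
   (ktot mu `|L| Cb alpha beta gx gy c inconsistency
      (fun=> State x0 y0 (const_mx c) (const_mx c)) Delta M * w)%:E)%E.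
Proof.
move=> PhiB e0 M0 eM eE w0 facts1 facts2.
have toOmega k (g : Omega -> R) : bmeas (g : hist k -> R) -> bmeas g.
  by move=> [mg bg]; split => //; exact: measurable_history_base mg.
pose q k o := norm2 (grad (Phi Y f) (avg_row (st_x (run o k)))) ^+ 2.
have qE k o : q k o = norm2 (dPhi f Gx Y (xb (run o) k)) ^+ 2.
  by rewrite /q (grad_Phi mo).
have bq k : bmeas (q k).
  apply: (eq_bmeas (fun o => esym (qE k o))); apply: (@toOmega k).
  have := bmeas_gradPhi (xb_bmeas k) => bg.
  by apply: (eq_bmeas _ (bmeas_inner bg bg)) => o; rewrite norm2_sq.
pose N k o := noise f Gx Gy Y mu `|L| Cb W alpha beta gx gy c (run o) (gX o) (gY o) M k.
have bN k : bmeas (N k) by have [] := noise_bmeas_integral M k.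
have N0 k : (\int[P]_o (N k o)%:E = 0)%E by have [] := noise_bmeas_integral M k.
rewrite -(integral_bmeas_sum P (index_enum 'I_K) (fun k : 'I_K => bq k)).
apply: (integral_ae_le (N := fun o => \sum_(k < K) N k o)).
- by apply: bmeas_sum => k; exact: bq.
- by apply: bmeas_sum => k; exact: bN.
- by rewrite (integral_bmeas_sum P (index_enum 'I_K) (fun k : 'I_K => bN k)) big1.
apply: filterS run_consistent => o sco; have tr := run_path o.
under eq_bigr do rewrite qE.
rewrite (le_trans (path_total tr sco K PhiB e0 M0 eM eE))// lerD2r.
exact: (ktot_bound inconsistency tr PhiB M0 w0 facts1 facts2).
Qed.

End Rate.
End Run.

(** [e] has to be chosen before any trajectory is given, so positivity is derived from the constants
    alone. *)
Lemma dd_gt0 (R : realType) n (mu L C beta c gy : R) :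
  0 < mu -> 0 <= L -> 0 < c -> 0 < gy -> 0 < @dd R n mu L C beta gy c.
Proof.
move=> mu0 L0 c0 gy0; have a0 : 0 < aa beta gy c by rewrite divr_gt0 ?powR_gt0 ?mulr_gt0.
have k0 : 0 <= kap mu L ^+ 2 by exact: sqr_ge0.
have m0 : 0 <= Mr C c by rewrite addr_ge0// divr_ge0 ?sqr_ge0 ?(ltW c0).
have e0 : 0 <= eps mu by rewrite divr_ge0// ltW.
have cW0 : 0 <= @cW R n mu L C beta gy c.
  rewrite addr_ge0//.
    apply: mulr_ge0; first by apply: mulr_ge0.
    apply: addr_ge0; first by rewrite divr_ge0// mulr_ge0// ltW.
    by apply: divr_ge0 => //; apply: mulr_ge0; exact: sqr_ge0.
  by rewrite divr_ge0 ?(ltW mu0)// !mulr_ge0// sqr_ge0.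
have g0 : 0 <= @gam R n mu L C beta gy c.
  rewrite addr_ge0//.
    apply: mulr_ge0; last by apply: mulr_ge0 => //; rewrite divr_ge0// ltW.
    by apply: mulr_ge0 => //; rewrite divr_ge0 ?sqr_ge0.
  by apply: mulr_ge0 => //; apply: mulr_ge0 => //; exact: sqr_ge0.
by rewrite invr_gt0 mulr_gt0// ltr_wpDl.
Qed.

(** As [b < a], the larger exponent is [1 / b], and raising [(1 / (1 - r)^2)^(1 / b) <= K] to the
    power [b] gives the second bound. The base is at least 1, whence [1 <= K]. *)
Lemma horizon_bounds (R : realType) (a b g r K : R) : 0 < b -> b < a -> 0 <= r -> r < 1 ->
  1 * Num.max (g `^ (1 / (a - b))) ((1 / (1 - r) ^+ 2) `^ Num.max (1 / a) (1 / b)) <= K ->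
  1 <= K /\ (1 / (1 - r)) ^+ 2 <= K `^ b.
Proof.
move=> b0 ba r0 r1; rewrite mul1r ge_max => /andP[_].
have -> : Num.max (1 / a) (1 / b) = 1 / b.
  rewrite max_r// !div1r lef_pV2 ?posrE//; first exact: ltW.
  exact: lt_trans ba.
set u := 1 / (1 - r) ^+ 2 => uK.
have u1 : 1 <= u.
  by rewrite /u div1r invf_ge1 ?exprn_gt0 ?subr_gt0// exprn_ile1 ?subr_ge0 ?(ltW r1)// gerBl.
have u1b : 1 <= u `^ (1 / b).
  have e : (1 : R) `^ (1 / b) = 1 by rewrite powR1.
  by rewrite -[leLHS]e powR_le// divr_ge0// ltW.
split; first exact: le_trans uK.
rewrite expr_div_n expr1n -/u -[leLHS]powRr1 ?(le_trans ler01)//.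
have -> : (1 : R) = 1 / b * b by rewrite divfK// gt_eqF.
by rewrite powRrM powR_le ?powR_ge0 ?(ltW b0).
Qed.

(** Dividing by [K] turns [K^a] into the first term of the first bracket and [K^(1 - b) / t] into
    the second term of the second; the other two terms are nonnegative. *)
Lemma average_rate (R : realType) (a b t K A : R) : 1 <= K -> 0 <= A -> 0 < t ->
  K^-1 * (A * ((1 + ln K) * (K `^ a + t^-1 * K `^ (1 - b)))) <=
  A * (1 + ln K) ^+ 1 * (1 / K `^ (1 - a) + 1 / (t `^ a * K `^ a))
  + A * (1 + ln K) ^+ 1 * (1 / K `^ (1 - b) + 1 / (t * K `^ b)).
Proof.
move=> K1 A0 t0; have K0 : 0 < K by exact: lt_le_trans K1.
have e1 : K^-1 * K `^ a = 1 / K `^ (1 - a).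
  by rewrite -[K^-1]powR_inv1 ?(ltW K0)// div1r -powRN (powR_sum_exp (c := - (1 - a)))// opprB addrC.
have e2 : K^-1 * (t^-1 * K `^ (1 - b)) = 1 / (t * K `^ b).
  rewrite mulrCA -[K^-1]powR_inv1 ?(ltW K0)// (powR_sum_exp (c := - b))//; last by ring.
  by rewrite powRN div1r invfM.
have -> : K^-1 * (A * ((1 + ln K) * (K `^ a + t^-1 * K `^ (1 - b)))) =
    A * (1 + ln K) * (K^-1 * K `^ a + K^-1 * (t^-1 * K `^ (1 - b))).
  by move: (K `^ a) (K `^ (1 - b)) (ln K) => x y l; ring.
rewrite e1 e2 !expr1.
have q0 : 0 <= A * (1 + ln K) by rewrite mulr_ge0 ?addr_ge0 ?ln_ge0.
have : 0 <= 1 / (t `^ a * K `^ a) by rewrite divr_ge0 ?mulr_ge0 ?powR_ge0.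
have : 0 <= 1 / K `^ (1 - b) by rewrite divr_ge0 ?powR_ge0.
move: (1 / _) (1 / _) (1 / _) (1 / _) (A * _) q0 => w x y z q q0 w0 x0.
by rewrite -mulrDr ler_wpM2l//; lra.
Qed.

Theorem theorem2 (R : realType) (n p d : nat)
    (L mu C c alpha beta gx gy Delta zv zu : R)
    (x0 : 'M[R]_(n, p)) (y0 : 'M[R]_(n, d))
    (n_gt0 : (0 < n)%N) (mu_gt0 : 0 < mu) (c_gt0 : 0 < c)
    (beta_gt0 : 0 < beta) (beta_lt_alpha : beta < alpha) (alpha_lt1 : alpha < 1)
    (gx_gt0 : 0 < gx) (gy_gt0 : 0 < gy) :
  let kappa := L / mu in
  exists (K0 A1 A2 : R) (q1 q2 : nat),
    [/\ 0 < K0, 0 < A1 & 0 < A2] /\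
    forall (Y : set 'rV[R]_d)
      (dS : 'I_n -> measure_display) (S : forall i, measurableType (dS i))
      (D : forall i, probability (S i) R)
      (F : forall i, 'rV[R]_p -> 'rV[R]_d -> S i -> R)
      (W : 'M[R]_n)
      (dO : measure_display) (Omega : measurableType dO)
      (P : probability Omega R)
      (xix xiy : forall i : 'I_n, nat -> {RV P >-> S i})
      (K : nat),
    let fi i := expected_obj (D i) (F i) in
    let f x y := n%:R^-1 * \sum_i fi i x y in
    let run (w : Omega) : nat -> state :=
      dadast F W Y alpha beta gx gy c x0 y0
        (fun i k => xix i k w) (fun i k => xiy i k w) in
    let rho := rhoW W in
    closed Y -> convex_set Y -> (forall i, Y (row i y0)) ->
    (forall i, strongly_concave mu Y (fi i)) ->
    (forall i, smooth L Y (fi i)) ->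
    (forall i, stochastic_gradients C Y (D i) (F i)) ->
    doubly_stochastic W -> rho < 1 ->
    has_ubound (range (Phi Y f)) -> has_lbound (range (Phi Y f)) ->
    sup (range (Phi Y f)) - inf (range (Phi Y f)) = Delta ->
    (forall i k B, measurable B ->
       distribution P (xix i k) B = D i B /\
       distribution P (xiy i k) B = D i B) ->
    mutually_independent P
      (fun (j : bool * 'I_n * nat) (w : Omega) =>
         (if j.1.1 then xix j.1.2 j.2 else xiy j.1.2 j.2) w) ->
    ess_sup P (fun w => path_zeta_sq alpha (fun k => st_v (run w k)))
      = (zv ^+ 2)%:E ->
    ess_sup P (fun w => path_zeta_sq beta (fun k => st_u (run w k)))
      = (zu ^+ 2)%:E ->
    K0 * Num.max ((gx ^+ 2 * kappa ^+ 4 / gy ^+ 2) `^ (1 / (alpha - beta)))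
                 ((1 / (1 - rho) ^+ 2) `^ Num.max (1 / alpha) (1 / beta))
      <= K%:R ->
    ((K%:R^-1)%R%:E *
       \sum_(0 <= k < K)
         'E_P[fun w =>
              (norm2 (grad (Phi Y f) (avg_row (st_x (run w k)))) ^+ 2)%R]
     <=
     (A1 * (1 + ln K%:R) ^+ q1 *
        (1 / K%:R `^ (1 - alpha) + 1 / ((1 - rho) `^ alpha * K%:R `^ alpha))
      + A2 * (1 + ln K%:R) ^+ q2 *
        (1 / K%:R `^ (1 - beta) + 1 / ((1 - rho) * K%:R `^ beta)))%R%:E)%E.
Proof.
move=> kappa.
pose Cb := @Cbar R p d C.
have a0 : 0 < alpha by exact: lt_trans beta_lt_alpha.
have aa0 : 0 < aa beta gy c by rewrite divr_gt0 ?powR_gt0 ?mulr_gt0.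
have K50 : 0 < K5 beta gx gy c by apply: mulr_gt0; [exact: divr_gt0|exact: exprn_gt0 (divr_gt0 _ _)].
have dd0 : 0 < @dd R n mu `|L| Cb beta gy c by exact: dd_gt0.
(* Solves the equation [eE] required by [path_total]; [M] then follows from [powR_small] with
   [r = alpha - beta]. *)
pose e := @dd R n mu `|L| Cb beta gy c / (2 / aa beta gy c * K5 beta gx gy c).
have q0 : 0 < 2 / aa beta gy c * K5 beta gx gy c by apply: mulr_gt0 => //; exact: divr_gt0.
have e0 : 0 < e by exact: divr_gt0.
have eE : 2 / aa beta gy c * K5 beta gx gy c * e = @dd R n mu `|L| Cb beta gy c.
  by rewrite mulrC divfK// gt_eqF.
have [M M0 eM] := powR_small (r := alpha - beta) (etrans (subr_gt0 _ _) beta_lt_alpha) c_gt0 e0.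
rewrite opprB in eM.
have [w w0 rates] := rate_bounds Cb c_gt0 beta_gt0 beta_lt_alpha alpha_lt1.
pose T := inconsistency zv zu.
pose kt := ktot mu `|L| Cb alpha beta gx gy c T
  (fun=> State x0 y0 (const_mx c) (const_mx c)) Delta M.
(* The absolute value and the added 1 make the constant positive whatever the data. *)
pose A := `|kt| * w + 1.
have A0 : 0 < A by rewrite ltr_wpDl// mulr_ge0// ltW.
(* The horizon constant is 1, both brackets share the constant [A], and a single logarithm
   suffices. *)
exists 1, A, A, 1%N, 1%N; split; first by split.
move=> Y dS S D F W dO Omega P xix xiy K fi f run' rho cY vY y0Y sc sm sg dW rW ub lb supE
  samples indep hzv hzu hK.
have r0 : 0 <= rho by exact: rhoW_ge0.
have [K1 tK] := horizon_bounds beta_gt0 beta_lt_alpha r0 rW hK.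
have r1 : 0 < 1 - rho by rewrite subr_gt0.
have K0 : (0 < K)%N by rewrite -(ltr0n R) (lt_le_trans ltr01).
have t1 : 1 <= 1 / (1 - rho) by rewrite ler_pdivlMr// mul1r gerBl.
have g0 : 0 < gap W by exact: gap_gt0.
have gV : (gap W)^-1 <= 2 * (1 / (1 - rho)).
  have h : (1 - rho) / 2 <= gap W by exact: gap_ge.
  have -> : 2 * (1 / (1 - rho)) = ((1 - rho) / 2)^-1 by rewrite invf_div div1r.
  by rewrite lef_pV2 ?posrE ?divr_gt0.
have [facts1 facts2] := rates K _ _ K0 t1 tK (etrans (invr_ge0 _) (ltW g0)) gV.
have K1' : 0 <= 1 + ln K%:R :> R by rewrite addr_ge0// ln_ge0.
set Z := (1 + ln K%:R) * _ in facts1 facts2.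
have Z0 : 0 <= Z.
  apply: mulr_ge0 => //; rewrite addr_ge0 ?powR_ge0// mulr_ge0 ?powR_ge0//.
  exact: le_trans ler01 t1.
have PhiB x : inf (range (Phi Y f)) <= Phi Y f x <= inf (range (Phi Y f)) + Delta.
  rewrite -supE addrC subrK; apply/andP; split.
    by apply: ge_inf => //; exists x.
  by apply: ub_le_sup => //; exists x.
have := expected_gradient_sum (x0 := x0) n_gt0 mu_gt0 c_gt0 beta_gt0 beta_lt_alpha alpha_lt1
  gx_gt0 gy_gt0 cY vY y0Y sc sm sg dW rW samples indep hzv hzu PhiB (ltW e0) M0 eM eE
  (mulr_ge0 (ltW w0) Z0) facts1 facts2.
rewrite big_mkord => h.
under eq_bigr do rewrite unlock.
have KV0 : (0 <= (K%:R^-1)%:E :> \bar R)%E by rewrite lee_fin invr_ge0.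
refine (le_trans (lee_wpmul2l KV0 h) _).
rewrite -EFinM lee_fin.
have ktA : kt * (w * Z) <= A * Z.
  rewrite mulrA ler_wpM2r// /A ler_wpDr// ler_wpM2r ?(ltW w0)//; exact: ler_norm.
have KV0' : 0 <= K%:R^-1 :> R by rewrite invr_ge0.
refine (le_trans (ler_wpM2l KV0' ktA) _).
rewrite /Z div1r; exact: average_rate K1 (ltW A0) r1.
Qed.
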